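(* Let $m\geq 2$ and $d\geq 1$ be integers, let $s>\frac{(m-1)d}{2}+\frac12$, and let $\sigma$ be a (positive, finite) measure on $\mathbb{R}^{md}$ supported in the unit ball $\mathbb{B}^{md}(0,1)$ whose Fourier transform satisfies \[ |\widehat{\mathrm{d}\sigma}(\xi)|\lesssim (1+|\xi|)^{-s},\qquad \xi\in\mathbb{R}^{md}. \] For Schwartz functions $f_1,\dots,f_m$ on $\mathbb{R}^d$, writing $\mathrm{F}=(f_1,\dots,f_m)$ and $y=(y_1,\dots,y_m)\in(\mathbb{R}^d)^m$, define the local maximal function \[ \mathrm{M}_\sigma^{loc}(\mathrm{F})(x)=\sup_{1<t<2}\Big|\int \prod_{i=1}^m f_i(x-ty_i)\,\mathrm{d}\sigma(y)\Big|,\qquad x\in\mathbb{R}^d. \] Then there is a constant $C$ such that for every $p$ with $2/m\le p\le 2$, \[ \|\mathrm{M}_\sigma^{loc}(\mathrm{F})\|_{L^p(\mathbb{B}^d(0,1))}\le C\prod_{i=1}^m\|f_i\|_{L^2(\mathbb{R}^d)}, \] and moreover, for $p=2/m$, \[ \|\mathrm{M}_\sigma^{loc}(\mathrm{F})\|_{L^{2/m}(\mathbb{R}^d)}\le C\prod_{i=1}^m\|f_i\|_{L^2(\mathbb{R}^d)}. \]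
   Context: $\mathbb{B}^n(x,R)$ denotes the ball in $\mathbb{R}^n$ of radius $R$ centered at $x$. $\widehat{\mathrm{d}\sigma}$ is the Fourier transform of the measure $\sigma$ on $\mathbb{R}^{md}$. *)

(* Defs.v *)
From HB Require Import structures.
From mathcomp Require Import all_boot all_order all_algebra.
From mathcomp Require Import all_classical all_reals all_analysis.
From mathcomp Require Import complex.
Set Implicit Arguments. Unset Strict Implicit. Unset Printing Implicit Defensive.
Import Order.TTheory GRing.Theory Num.Theory.
Import numFieldNormedType.Exports.
Local Open Scope classical_set_scope.
Local Open Scope ring_scope.

(* R^(m*d) is represented by m x d real matrices (row i = y_i in R^d),
   equipped with its Borel sigma-algebra (generated by the open sets of the
   product = Euclidean topology). *)
Definition bmx (R : realType) (m d : nat) :=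
  g_sigma_algebraType (@open (matrix R m d : topologicalType)).

Definition enorm (R : realType) (m n : nat) (A : 'M[R]_(m, n)) : R :=
  Num.sqrt (\sum_(i < m) \sum_(j < n) A i j ^+ 2).
Definition mdot (R : realType) (m n : nat) (A B : 'M[R]_(m, n)) : R :=
  \sum_(i < m) \sum_(j < n) A i j * B i j.

Definition cmod (R : realType) (z : R[i]) : R :=
  Num.sqrt (complex.Re z ^+ 2 + complex.Im z ^+ 2).

Definition ft_re (R : realType) (m d : nat)
  (sigma : {measure set (bmx R m d) -> \bar R}) (xi : 'M[R]_(m, d)) : R :=
  Rintegral sigma setT (fun y : bmx R m d => cos (2 * pi * mdot (y : 'M[R]_(m, d)) xi)).
Definition ft_im (R : realType) (m d : nat)
  (sigma : {measure set (bmx R m d) -> \bar R}) (xi : 'M[R]_(m, d)) : R :=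
  Rintegral sigma setT (fun y : bmx R m d => - sin (2 * pi * mdot (y : 'M[R]_(m, d)) xi)).
Definition ft_abs (R : realType) (m d : nat)
  (sigma : {measure set (bmx R m d) -> \bar R}) (xi : 'M[R]_(m, d)) : R :=
  Num.sqrt (ft_re sigma xi ^+ 2 + ft_im sigma xi ^+ 2).

Definition iter_deriv (R : realType) (d : nat) (vs : seq 'rV[R]_d)
  (f : 'rV[R]_d -> R) : 'rV[R]_d -> R :=
  foldr (fun (v : 'rV[R]_d) (g : 'rV[R]_d -> R) => 'D_v g) f vs.

Definition schwartz_real (R : realType) (d : nat) (f : 'rV[R]_d -> R) : Prop :=
  forall vs : seq 'rV[R]_d,
    (forall (v x : 'rV[R]_d), derivable (iter_deriv vs f) x v) /\
    (forall k : nat, exists C : R, forall x : 'rV[R]_d,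
        (1 + enorm x) ^+ k * `|iter_deriv vs f x| <= C).

Definition schwartz (R : realType) (d : nat) (f : 'rV[R]_d -> R[i]) : Prop :=
  schwartz_real (fun x => complex.Re (f x)) /\ schwartz_real (fun x => complex.Im (f x)).

(* Lebesgue integral of a nonnegative function on R^d, written as the
   iterated integral over the coordinates (Tonelli). *)
Fixpoint Rd_int (R : realType) (d : nat) : ('rV[R]_d -> \bar R) -> \bar R :=
  match d return ('rV[R]_d -> \bar R) -> \bar R with
  | 0 => fun g => g 0
  | d'.+1 => fun g =>
      (\int[@lebesgue_measure R]_(x in setT)
         Rd_int (fun y : 'rV[R]_d' => g (row_mx (\row_(_ < 1) x) y)))%E
  end.

Definition Lp_on (R : realType) (d : nat) (D : set 'rV[R]_d) (p : R)
  (g : 'rV[R]_d -> \bar R) : \bar R :=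
  ((Rd_int (fun x => ((\1_D x)%:E * (`|g x| `^ p))%E)) `^ p^-1)%E.

Definition L2norm (R : realType) (d : nat) (f : 'rV[R]_d -> R[i]) : \bar R :=
  Lp_on setT 2 (fun x => (cmod (f x))%:E).

Definition avg_int (R : realType) (m d : nat)
  (sigma : {measure set (bmx R m d) -> \bar R})
  (f : 'I_m -> 'rV[R]_d -> R[i]) (x : 'rV[R]_d) (t : R) : R[i] :=
  let g := fun y : bmx R m d =>
             \prod_(i < m) f i (x - t *: row i (y : 'M[R]_(m, d))) in
  Complex (Rintegral sigma setT (fun y => complex.Re (g y)))
          (Rintegral sigma setT (fun y => complex.Im (g y))).

Definition Mloc (R : realType) (m d : nat)
  (sigma : {measure set (bmx R m d) -> \bar R})
  (f : 'I_m -> 'rV[R]_d -> R[i]) (x : 'rV[R]_d) : \bar R :=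
  ereal_sup [set (cmod (avg_int sigma f x t))%:E | t in [set t : R | 1 < t < 2]].

(* Main.v *)
Require Import Defs.
From HB Require Import structures.
From mathcomp Require Import all_boot all_order all_algebra.
From mathcomp Require Import all_classical all_reals all_analysis.
From mathcomp Require Import complex measurable_realfun ring lra zify.
Import Order.TTheory GRing.Theory Num.Theory.
Import numFieldNormedType.Exports.
Local Open Scope classical_set_scope.
Local Open Scope ring_scope.
Set Implicit Arguments. Unset Strict Implicit. Unset Printing Implicit Defensive.

(** On a cube of side 2 the maximal function only sees the f_i on the concentric
    cube of side 8, where they are uniform limits of trigonometric polynomials of
    period 8. For these, the average over sigma is a finite sum over frequencies
    K = (K_1, ..., K_m) of products of coefficients times the Fourier transform of
    sigma at t K / 8. Orthogonality on a fine lattice separates the values of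
    K_1 + ... + K_m, and Cauchy-Schwarz for a fixed value costs the sum of the
    squared symbol over a lattice of rank (m - 1) d.

    The supremum over t costs half a derivative. On the frequencies |K| ~ D^j, the
    N-th differences in t at a scale 2^-j D^-j are negligible for N large, because
    sigma has bounded support; hence the average at t is controlled by its mean
    over a window of that length, at the price of a factor 2^j D^j in the square.
    The blocks are summable, for D = 2^q with q large, since
    s > (m - 1) d / 2 + 1 / 2.

    Young's inequality gives every p <= 2 on the cube, and Hoelder's inequality for
    sums allows one to add up the cubes when p = 2 / m. Suprema and norms are compared
    through Riemann sums, that is, integrals of step functions, so the measurability
    of the maximal function is never needed. *)

(** * Iterated integrals *)

(** The threshold on s: for frequencies of size D^j, a fibre of the map K -> K_1 + ... + K_m has
    about D^(j (m-1) d) points, the squared symbol is of order D^(-2 j s), and the supremum costs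
    D^j. The product decays when 2 s > (m - 1) d + 1. Two further losses 2^j, one from the window
    length and one from adding the blocks by Cauchy-Schwarz, have a base that does not grow with D,
    so a large D absorbs them.

    The period 8: if x is within 1 of the centre, the points x - t y_i are within 3 of it in each
    coordinate, and the sampled points are within 4. Their distance is at most 7 < 8, so a kernel of
    period 8 does not mistake a sample for a translate, and the f_i need no cutoff and no
    periodization.

    Uniformity: the maximal estimate has a constant free of the degree n, the lattice size M and the
    time grid g, whereas the errors of discretization depend on them badly. They are chosen in the
    order n, M, g. The coefficients of the polynomials are controlled by lattice means of |f_i|^2,
    so no Fourier integral of f_i ever appears. *)

Lemma le_lower_integral {dsp} {T : measurableType dsp} {R : realType}
    (mu : {measure set T -> \bar R}) (f g : T -> \bar R) :
  (forall x, (0 <= f x)%E) -> (forall x, (f x <= g x)%E) ->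
  (\int[mu]_x f x <= \int[mu]_x g x)%E.
Proof.
move=> f0 fg.
have g0 x : (0 <= g x)%E by exact: le_trans (fg x).
(* A nonnegative integral is the supremum over the simple functions below the integrand, so
   monotonicity holds without measurability. *)
rewrite (ge0_integralTE _ f0) (ge0_integralTE _ g0).
by apply: le_ereal_sup => _ [h hf <-]; exists h => // x; exact: le_trans (hf x) (fg x).
Qed.

Definition cons_row {R : realType} {d : nat} (x : R) (y : 'rV[R]_d) : 'rV[R]_d.+1 :=
  row_mx (\row_(_ < 1) x) y.

Lemma cons_row0 {R : realType} {d : nat} (x : R) (y : 'rV[R]_d) :
  cons_row x y 0 ord0 = x.
Proof.
rewrite /cons_row (_ : ord0 = lshift d (ord0 : 'I_1)); last exact: val_inj.
by rewrite (@row_mxEl R 1 1 d) mxE.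
Qed.

Lemma cons_rowS {R : realType} {d : nat} (x : R) (y : 'rV[R]_d) (j : 'I_d) :
  cons_row x y 0 (lift ord0 j) = y 0 j.
Proof.
rewrite /cons_row (_ : lift ord0 j = rshift 1 j); last exact: val_inj.
by rewrite (@row_mxEr R 1 1 d).
Qed.

Lemma Rd_intS {R : realType} d (g : 'rV[R]_d.+1 -> \bar R) :
  Rd_int g = (\int[@lebesgue_measure R]_x Rd_int (fun y : 'rV[R]_d => g (cons_row x y)))%E.
Proof. by []. Qed.

Lemma Rd_int_ge0 {R : realType} d (g : 'rV[R]_d -> \bar R) :
  (forall x, (0 <= g x)%E) -> (0 <= Rd_int g)%E.
Proof.
elim: d g => [|d IH] g g0; first exact: g0.
by rewrite Rd_intS; apply: integral_ge0 => x _; apply: IH => y.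
Qed.

Lemma le_Rd_int {R : realType} d (g h : 'rV[R]_d -> \bar R) :
  (forall x, (0 <= g x)%E) -> (forall x, (g x <= h x)%E) ->
  (Rd_int g <= Rd_int h)%E.
Proof.
elim: d g h => [|d IH] g h g0 gh; first exact: gh.
rewrite !Rd_intS; apply: le_lower_integral => x; last exact: IH.
exact: Rd_int_ge0.
Qed.

Lemma eq_Rd_int {R : realType} d (g h : 'rV[R]_d -> \bar R) :
  (forall x, g x = h x) -> Rd_int g = Rd_int h.
Proof. by move=> gh; congr Rd_int; apply/funext. Qed.

(* The functions whose iterated integrals are integrals of measurable functions
   at every stage; [Rd_int] is only superadditive outside this class. *)
Fixpoint Rd_meas {R : realType} (d : nat) : ('rV[R]_d -> \bar R) -> Prop :=
  match d return ('rV[R]_d -> \bar R) -> Prop with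
  | 0 => fun g => True
  | d'.+1 => fun g =>
      (forall x, Rd_meas (fun y : 'rV[R]_d' => g (cons_row x y))) /\
      measurable_fun [set: measurableTypeR R]
        ((fun x => Rd_int (fun y : 'rV[R]_d' => g (cons_row x y))) : R -> \bar R)
  end.

Lemma Rd_meas_intD {R : realType} d (g h : 'rV[R]_d -> \bar R) :
  (forall x, (0 <= g x)%E) -> (forall x, (0 <= h x)%E) ->
  Rd_meas g -> Rd_meas h ->
  Rd_meas (fun x => g x + h x)%E /\
  (Rd_int (fun x => g x + h x) = Rd_int g + Rd_int h)%E.
Proof.
elim: d g h => [|d IH] g h g0 h0 //=.
move=> [mg Mg] [mh Mh].
have E x : Rd_int (fun y => g (cons_row x y) + h (cons_row x y))%E =
   (Rd_int (fun y => g (cons_row x y)) + Rd_int (fun y => h (cons_row x y)))%E.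
  by have [] := IH (fun y => g (cons_row x y)) (fun y => h (cons_row x y))
    (fun y => g0 _) (fun y => h0 _) (mg x) (mh x).
split.
  split=> [x|].
    by have [] := IH (fun y => g (cons_row x y)) (fun y => h (cons_row x y))
      (fun y => g0 _) (fun y => h0 _) (mg x) (mh x).
  under eq_fun do rewrite E; exact: emeasurable_funD.
under eq_integral do rewrite E.
by rewrite ge0_integralD//= => x _; apply: Rd_int_ge0.
Qed.

Lemma Rd_meas_intZ {R : realType} d (k : R) (g : 'rV[R]_d -> \bar R) :
  0 <= k -> (forall x, (0 <= g x)%E) -> Rd_meas g ->
  Rd_meas (fun x => k%:E * g x)%E /\
  (Rd_int (fun x => k%:E * g x) = k%:E * Rd_int g)%E.
Proof.
move=> k0; elim: d g => [|d IH] g g0 //=.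
move=> [mg Mg].
have E x : Rd_int (fun y => k%:E * g (cons_row x y))%E =
   (k%:E * Rd_int (fun y => g (cons_row x y)))%E.
  by have [] := IH (fun y => g (cons_row x y)) (fun y => g0 _) (mg x).
split.
  split=> [x|].
    by have [] := IH (fun y => g (cons_row x y)) (fun y => g0 _) (mg x).
  under eq_fun do rewrite E; exact: measurable_funeM.
under eq_integral do rewrite E.
by rewrite ge0_integralZl_EFin//= => x _; apply: Rd_int_ge0.
Qed.

Lemma Rd_meas_int0 {R : realType} d :
  Rd_meas (fun _ : 'rV[R]_d => 0%E) /\ Rd_int (fun _ : 'rV[R]_d => 0%E) = 0%E.
Proof.
elim: d => [|d [IH1 IH2]] //=; split.
  by split=> //; under eq_fun do rewrite IH2; exact: measurable_cst.
by under eq_integral do rewrite IH2; rewrite integral0.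
Qed.

Lemma Rd_meas_int_sum {R : realType} d (I : Type) (r : seq I) (P : pred I)
    (g : I -> 'rV[R]_d -> \bar R) :
  (forall i x, (0 <= g i x)%E) -> (forall i, Rd_meas (g i)) ->
  Rd_meas (fun x => \sum_(i <- r | P i) g i x)%E /\
  (Rd_int (fun x => \sum_(i <- r | P i) g i x) = \sum_(i <- r | P i) Rd_int (g i))%E.
Proof.
move=> g0 mg; elim: r => [|i r [IH1 IH2]].
  have [h1 h2] := @Rd_meas_int0 R d.
  by split; [under eq_fun do rewrite big_nil | under eq_fun do rewrite big_nil; rewrite big_nil].
under eq_fun do rewrite big_cons; rewrite big_cons; case: ifP => // Pi.
rewrite -IH2; apply: Rd_meas_intD => // x; exact: sume_ge0.
Qed.

(** Monotone convergence, one coordinate at a time. It is what allows countably many cubes to be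
    added up. *)
Lemma Rd_meas_int_lim {R : realType} d (g : nat -> 'rV[R]_d -> \bar R) :
  (forall n x, (0 <= g n x)%E) -> (forall n, Rd_meas (g n)) ->
  (forall x, {homo g ^~ x : a b / (a <= b)%N >-> (a <= b)%E}) ->
  Rd_meas (fun x => limn (g ^~ x)) /\
  Rd_int (fun x => limn (g ^~ x)) = limn (fun n => Rd_int (g n)).
Proof.
elim: d g => [|d IH] g g0 //= mg ndg.
have IHx x := IH (fun n y => g n (cons_row x y)) (fun n y => g0 n _)
    (fun n => (mg n).1 x) (fun y => ndg (cons_row x y)).
have E x := (IHx x).2.
split.
  split=> [x|]; first exact: (IHx x).1.
  under eq_fun do rewrite E.
  apply: (emeasurable_fun_cvg (fun n (x : measurableTypeR R) => Rd_int (fun y => g n (cons_row x y)))).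
    by move=> n; have [] := mg n.
  move=> x _; apply: ereal_nondecreasing_is_cvgn => a b ab.
  by apply: le_Rd_int => // y; exact: ndg.
under eq_integral do rewrite E.
rewrite monotone_convergence//.
- by move=> n; have [] := mg n.
- by move=> n x _; exact: Rd_int_ge0.
- by move=> x _ a b ab; apply: le_Rd_int => // y; exact: ndg.
Qed.

(** Serves twice: for indicators of boxes, and for the product of the 1 / (1 + x_j^2) that dominates
    a squared Schwartz function. *)
Lemma Rd_meas_int_prod {R : realType} d (phi : 'I_d -> R -> R) (I : 'I_d -> R) :
  (forall j x, 0 <= phi j x) ->
  (forall j, measurable_fun [set: measurableTypeR R] (phi j : R -> R)) ->
  (forall j, (\int[@lebesgue_measure R]_x (phi j x)%:E)%E = (I j)%:E) ->
  Rd_meas (fun x : 'rV[R]_d => (\prod_j phi j (x 0 j))%:E) /\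
  Rd_int (fun x : 'rV[R]_d => (\prod_j phi j (x 0 j))%:E) = (\prod_j I j)%:E.
Proof.
elim: d phi I => [|d IH] phi I phi0 mphi Iphi /=; first by rewrite !big_ord0.
pose g : 'rV[R]_d -> \bar R := fun y => (\prod_j phi (lift ord0 j) (y 0 j))%:E.
have [mg Ig] := IH (fun j => phi (lift ord0 j)) (fun j => I (lift ord0 j))
  (fun j => phi0 _) (fun j => mphi _) (fun j => Iphi _).
have E0 x : (fun y : 'rV[R]_d =>
    (\prod_(j < d.+1) phi j (cons_row x y 0 j))%:E) =
    (fun y => ((phi ord0 x)%:E * g y)%E).
  apply/funext => y; rewrite big_ord_recl cons_row0 EFinM; congr (_ * _%:E)%E.
  by apply: eq_bigr => j _; rewrite cons_rowS.
have g0 x : (0 <= g x)%E by rewrite lee_fin; apply: prodr_ge0 => j _.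
have mI : measurable_fun [set: measurableTypeR R]
    ((fun x => (phi ord0 x)%:E) : R -> \bar R).
  by apply/measurable_EFinP; exact: mphi.
have E1 x := Rd_meas_intZ (phi0 ord0 x) g0 mg.
split.
  split=> [x|]; first by rewrite E0; exact: (E1 x).1.
  under eq_fun do rewrite E0 (E1 _).2 Ig muleC.
  exact: measurable_funeM.
under eq_integral do rewrite E0 (E1 _).2 Ig.
have I0 j : 0 <= I j.
  by rewrite -lee_fin -Iphi; apply: integral_ge0 => x _; rewrite lee_fin.
rewrite ge0_integralZr//=.
- by rewrite Iphi big_ord_recl EFinM.
- by move=> x _; rewrite lee_fin.
- by rewrite lee_fin; apply: prodr_ge0 => j _.
Qed.

Lemma Rd_meas_int_box {R : realType} d (a b : 'I_d -> R) :
  (forall j, a j <= b j) ->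
  Rd_meas (fun x : 'rV[R]_d => (\prod_j \1_(`[a j, b j[%classic) (x 0 j))%:E)%E /\
  Rd_int (fun x : 'rV[R]_d => (\prod_j \1_(`[a j, b j[%classic) (x 0 j))%:E)%E =
    (\prod_j (b j - a j))%:E.
Proof.
move=> ab; apply: (@Rd_meas_int_prod R d (fun j => \1_(`[a j, b j[%classic)) (fun j => b j - a j)).
- by move=> j x; rewrite indicE.
- by move=> j; exact: measurable_indic.
move=> j; rewrite integral_indic//= setIT lebesgue_measure_itv /= lte_fin.
have := ab j; rewrite le_eqVlt => /orP[/eqP->|h]; last by rewrite h -EFinB.
by rewrite ltxx subrr.
Qed.

(** * Complex exponentials *)

Section Cmod.
Variable R : realType.
Implicit Types (z w : R[i]) (x y : R).

Lemma cmodE z : cmod z = Normc.normc z.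
Proof. by case: z. Qed.

Lemma cmod_ge0 z : 0 <= cmod z.
Proof. exact: sqrtr_ge0. Qed.

Lemma cmodM z w : cmod (z * w) = cmod z * cmod w.
Proof. by rewrite !cmodE Normc.normcM. Qed.

Lemma cmodD z w : cmod (z + w) <= cmod z + cmod w.
Proof. by rewrite !cmodE; exact: le_normcD. Qed.

Lemma cmodN z : cmod (- z) = cmod z.
Proof. by rewrite !cmodE; exact: normcN. Qed.

Lemma cmodB z w : cmod (z - w) = cmod (w - z).
Proof. by rewrite -cmodN opprB. Qed.

Lemma cmod0 : cmod (0 : R[i]) = 0.
Proof. by rewrite cmodE Normc.normc0. Qed.

Lemma cmod1 : cmod (1 : R[i]) = 1.
Proof. by rewrite cmodE Normc.normc1. Qed.

Lemma cmod_sum (I : Type) (r : seq I) (P : pred I) (F : I -> R[i]) :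
  cmod (\sum_(i <- r | P i) F i) <= \sum_(i <- r | P i) cmod (F i).
Proof.
elim/big_rec2: _ => [|i y z _ h]; first by rewrite cmod0.
by apply: (le_trans (cmodD _ _)); rewrite lerD2l.
Qed.

Lemma cmod_prod (I : Type) (r : seq I) (P : pred I) (F : I -> R[i]) :
  cmod (\prod_(i <- r | P i) F i) = \prod_(i <- r | P i) cmod (F i).
Proof.
elim/big_rec2: _ => [|i y z _ h]; first by rewrite cmod1.
by rewrite cmodM h.
Qed.

Lemma cmod_sqr z : cmod z ^+ 2 = complex.Re z ^+ 2 + complex.Im z ^+ 2.
Proof. by rewrite sqr_sqrtr// addr_ge0// sqr_ge0. Qed.

Lemma normr_Re_le z : `|complex.Re z| <= cmod z.
Proof. by rewrite -sqrtr_sqr ler_wsqrtr// lerDl sqr_ge0. Qed.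

Lemma normr_Im_le z : `|complex.Im z| <= cmod z.
Proof. by rewrite -sqrtr_sqr ler_wsqrtr// lerDr sqr_ge0. Qed.

Lemma cmod_le z : cmod z <= `|complex.Re z| + `|complex.Im z|.
Proof.
rewrite -(@ler_pXn2r _ 2)// ?nnegrE ?cmod_ge0 ?addr_ge0//.
rewrite cmod_sqr sqrrD !real_normK ?num_real//.
by rewrite -addrA lerD2l lerDr mulrn_wge0// mulr_ge0.
Qed.

Lemma cmod_real x : cmod (x%:C)%C = `|x|.
Proof. by rewrite /cmod /= expr0n addr0 sqrtr_sqr. Qed.

Lemma mulJc z : z * (z^*)%C = ((cmod z ^+ 2)%:C)%C.
Proof.
rewrite cmod_sqr; case: z => a b /=.
by apply/eqP; rewrite eq_complex /=; apply/andP; split; apply/eqP; ring.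
Qed.

End Cmod.

(** Symmetrizing the double sum reduces the claim, term by term, to (a_i b_j - a_j b_i)^2 >= 0. *)
Lemma cauchy_schwarz_sum {R : realFieldType} (I : finType) (P : pred I) (a b : I -> R) :
  (\sum_(i | P i) a i * b i) ^+ 2 <=
  (\sum_(i | P i) a i ^+ 2) * (\sum_(i | P i) b i ^+ 2).
Proof.
have E : (\sum_(i | P i) a i ^+ 2) * (\sum_(i | P i) b i ^+ 2) =
  \sum_(i | P i) \sum_(j | P j) (2^-1 * (a i ^+ 2 * b j ^+ 2 + a j ^+ 2 * b i ^+ 2)).
  transitivity (2^-1 * (\sum_(i | P i) \sum_(j | P j) a i ^+ 2 * b j ^+ 2 +
                \sum_(i | P i) \sum_(j | P j) a j ^+ 2 * b i ^+ 2)).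
    rewrite [X in _ + X]exchange_big/= -mulr2n.
    rewrite -[X in _ = _ * X]mulr_natl mulrA mulVf ?pnatr_eq0// mul1r big_distrl /=.
    by apply: eq_bigr => i _; rewrite big_distrr.
  rewrite -big_split mulr_sumr; apply: eq_bigr => i _.
  by rewrite -big_split mulr_sumr.
rewrite E expr2 big_distrl /=; apply: ler_sum => i _.
rewrite big_distrr /=; apply: ler_sum => j _.
have := sqr_ge0 (a i * b j - a j * b i); nra.
Qed.

Lemma cauchy_schwarz_csum {R : realType} (I : finType) (P : pred I) (a b : I -> R[i]) :
  cmod (\sum_(i | P i) a i * b i) ^+ 2 <=
  (\sum_(i | P i) cmod (a i) ^+ 2) * (\sum_(i | P i) cmod (b i) ^+ 2).
Proof.
apply: le_trans (cauchy_schwarz_sum _ _ _).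
rewrite ler_pXn2r ?nnegrE ?cmod_ge0 ?sumr_ge0//; last first.
  by move=> i _; rewrite mulr_ge0// cmod_ge0.
by apply: le_trans (cmod_sum _ _ _) _; apply: ler_sum => i _; rewrite cmodM.
Qed.

Section Expi.
Variable R : realType.
Implicit Types (x y : R).

Definition expi (x : R) : R[i] := Complex (cos x) (sin x).

Lemma expi0 : expi 0 = 1.
Proof. by rewrite /expi cos0 sin0. Qed.

Lemma expiD x y : expi (x + y) = expi x * expi y.
Proof.
by apply/eqP; rewrite eq_complex /= cosD sinD [cos x * sin y + _]addrC !eqxx.
Qed.

Lemma expiN x : expi (- x) = ((expi x)^*)%C.
Proof. by rewrite /expi cosN sinN. Qed.

Lemma cmod_expi x : cmod (expi x) = 1.
Proof. by rewrite /cmod /= cos2Dsin2 sqrtr1. Qed.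

Lemma expi_sum (I : Type) (r : seq I) (P : pred I) (F : I -> R) :
  expi (\sum_(i <- r | P i) F i) = \prod_(i <- r | P i) expi (F i).
Proof.
elim/big_rec2: _ => [|i y z _ h]; first by rewrite expi0.
by rewrite expiD h.
Qed.

Lemma expiMn x n : expi (x * n%:R) = expi x ^+ n.
Proof.
elim: n => [|n IH]; first by rewrite mulr0 expi0.
by rewrite exprSr -IH -natr1 mulrDr mulr1 expiD.
Qed.

Lemma expi_2pi : expi (2 * pi) = 1.
Proof. by rewrite mulr_natl /expi cos2pi sin2pi. Qed.

Lemma expi_eq1 x : 0 < x < 2 * pi -> expi x != 1.
Proof.
move=> /andP[x0 x2]; rewrite eq_complex /= negb_and; apply/orP; left.
have -> : x = (x / 2) *+ 2 by rewrite -mulr_natr divfK.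
rewrite cos_mulr2n cos2sin2.
have : 0 < sin (x / 2) by apply: sin_gt0_pi; lra.
by move=> h; apply/eqP; nra.
Qed.

Lemma lipschitz_derive (f f' : R -> R) (K : R) :
  (forall x, is_derive x 1 f (f' x)) -> (forall x, `|f' x| <= K) ->
  forall x y, `|f x - f y| <= K * `|x - y|.
Proof.
move=> df bf.
suff H x y : x < y -> `|f y - f x| <= K * `|y - x|.
  move=> x y; case: (ltgtP x y) => [xy|xy|->]; last by rewrite !subrr normr0 mulr0.
    by rewrite distrC [`|x - y|]distrC H.
  exact: H.
move=> xy; have dx z : derivable f z 1 by have [] := df z.
have [c _ ->] := MVT xy (fun x _ => df x)
  (derivable_within_continuous (fun z _ => dx z)).
by rewrite normrM ler_wpM2r.
Qed.

Lemma sin_lip x y : `|sin x - sin y| <= `|x - y|.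
Proof.
rewrite -[X in _ <= X]mul1r; apply: (@lipschitz_derive sin cos) => z; exact: cos_max.
Qed.

Lemma cos_lip x y : `|cos x - cos y| <= `|x - y|.
Proof.
rewrite -[X in _ <= X]mul1r; apply: (@lipschitz_derive cos (fun x => - sin x)) => z.
by rewrite normrN; exact: sin_max.
Qed.

Lemma expi_lip x y : cmod (expi x - expi y) <= 2 * `|x - y|.
Proof.
apply: le_trans (cmod_le _) _; rewrite /= mulr_natl mulr2n lerD//.
  exact: cos_lip.
exact: sin_lip.
Qed.

End Expi.

(** * Characters of the lattice *)

Section Lattice.
Variables (R : realType) (d M : nat).
Hypothesis M0 : (0 < M)%N.
Local Notation C := R[i].

Definition root1 : C := expi (2 * pi / M%:R).

Lemma root1_orth (a b : nat) : (a < M)%N -> (b < M)%N ->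
  \sum_(u < M) root1 ^+ (a * u) * ((root1 ^+ (b * u))^*)%C = (M * (a == b))%:R.
Proof.
move=> aM bM.
have M0' : (M%:R : R) != 0 by rewrite pnatr_eq0 -lt0n.
have E k : root1 ^+ k = expi (2 * pi / M%:R * k%:R) by rewrite expiMn.
pose w : C := expi (2 * pi / M%:R * (a%:R - b%:R)).
rewrite (eq_bigr (fun u : 'I_M => w ^+ u)); last first.
  move=> u _; rewrite !E -expiN -expiD -expiMn; congr expi.
  by rewrite !natrM; ring.
have wM : w ^+ M = 1.
  rewrite -expiMn mulrAC divfK// mulrBr expiD expiN !expiMn expi_2pi !expr1n.
  by rewrite conjc1 mulr1.
have [eab|nab] := eqVneq a b.
  rewrite /w eab subrr mulr0 expi0 muln1.
  by under eq_bigr do rewrite expr1n; rewrite sumr_const card_ord.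
rewrite muln0; have w1 : w != 1.
  have H (p q : nat) : (p < M)%N -> (q < p)%N -> expi (2 * pi / M%:R * (p%:R - q%:R)) != 1 :> C.
    move=> pM qp; apply: expi_eq1; rewrite -natrB ?(ltnW qp)// mulrAC.
    have pi0 := pi_gt0 R.
    rewrite ltr_pdivrMr ?ltr0n//; apply/andP; split.
      by rewrite divr_gt0 ?ltr0n// !mulr_gt0// ltr0n subn_gt0.
    by rewrite ltr_pM2l ?mulr_gt0// ltr_nat; apply: leq_ltn_trans pM; exact: leq_subr.
  (* For a < b the number [w] is the conjugate of the root attached to b - a. *)
  case: (ltngtP a b) nab => // ab _; last exact: H.
  have := H _ _ bM ab; apply: contraNN => /eqP h; apply/eqP.
  by rewrite -opprB mulrN expiN -/w h conjc1.
have := subrX1 w M; rewrite wM subrr => /esym/eqP.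
by rewrite mulf_eq0 subr_eq0 (negPf w1) => /eqP.
Qed.

(** A character of (Z/M)^d evaluated at [u]. Frequencies are kept as naturals below [B]; under B <=
    M distinct frequencies give distinct characters, so there is no aliasing. *)
Definition lat_char B (eta : {ffun 'I_d -> 'I_B}) (u : {ffun 'I_d -> 'I_M}) : C :=
  \prod_j root1 ^+ (eta j * u j).

Lemma lat_char_orth B (eta eta' : {ffun 'I_d -> 'I_B}) : (B <= M)%N ->
  \sum_u lat_char eta u * ((lat_char eta' u)^*)%C = (M ^ d * (eta == eta'))%:R.
Proof.
move=> BM.
rewrite (eq_bigr (fun u : {ffun 'I_d -> 'I_M} => \prod_j (root1 ^+ (eta j * u j) *
   ((root1 ^+ (eta' j * u j))^*)%C))); last first.
  by move=> u _; rewrite /lat_char rmorph_prod -big_split.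
rewrite -(bigA_distr_bigA (fun j (r : 'I_M) => root1 ^+ (eta j * r) *
   ((root1 ^+ (eta' j * r))^*)%C)).
under eq_bigr do rewrite root1_orth ?(leq_trans (ltn_ord _) BM)//.
rewrite -natr_prod; congr (_%:R); rewrite big_split /= prod_nat_const card_ord; congr (_ * _)%N.
have [->|ne] := eqVneq eta eta'; first by rewrite big1// => j _; rewrite eqxx.
have [j hj] : exists j, eta j != eta' j.
  apply/existsP; apply: contraNT ne; rewrite negb_exists => /forallP h.
  by apply/eqP/ffunP => j; apply/eqP; have := h j; rewrite negbK.
by rewrite (bigD1 j)//= (inj_eq val_inj) (negPf hj) mul0n.
Qed.

Lemma parseval B (b : {ffun 'I_d -> 'I_B} -> C) : (B <= M)%N ->
  \sum_u cmod (\sum_eta b eta * lat_char eta u) ^+ 2 =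
  (M ^ d)%:R * \sum_eta cmod (b eta) ^+ 2.
Proof.
move=> BM; apply: (@complexI R).
rewrite rmorphM rmorph_nat !rmorph_sum /=.
under eq_bigr do rewrite -mulJc rmorph_sum big_distrl /=.
rewrite exchange_big /= mulr_sumr; apply: eq_bigr => eta _.
under eq_bigr do rewrite big_distrr /=.
rewrite exchange_big /= (bigD1 eta)//= [X in _ + X]big1 => [|eta' ne].
  rewrite addr0 -mulJc.
  under eq_bigr do rewrite rmorphM mulrACA.
  by rewrite -mulr_sumr lat_char_orth// eqxx muln1 mulrC.
under eq_bigr do rewrite rmorphM mulrACA.
by rewrite -mulr_sumr lat_char_orth// eq_sym (negPf ne) muln0 mulr0.
Qed.

(* Cauchy-Schwarz inside each fibre of [e], Parseval across the fibres. *)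
Lemma l2_diag (T : finType) (P : pred T) B (e : T -> {ffun 'I_d -> 'I_B})
    (c s : T -> C) (W : R) : (B <= M)%N -> 0 <= W ->
  (forall eta, \sum_(K | P K && (e K == eta)) cmod (s K) ^+ 2 <= W) ->
  \sum_u cmod (\sum_(K | P K) c K * s K * lat_char (e K) u) ^+ 2 <=
  (M ^ d)%:R * (W * \sum_K cmod (c K) ^+ 2).
Proof.
move=> BM W0 hW.
rewrite (eq_bigr (fun u => cmod (\sum_eta (\sum_(K | P K && (e K == eta)) c K * s K)
    * lat_char eta u) ^+ 2)); last first.
  move=> u _; congr (cmod _ ^+ 2).
  rewrite (partition_big e xpredT)//=; apply: eq_bigr => eta _.
  by rewrite mulr_suml; apply: eq_bigr => K /andP[_ /eqP ->].
rewrite parseval// ler_wpM2l//.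
apply: (@le_trans _ _ (\sum_eta W * \sum_(K | P K && (e K == eta)) cmod (c K) ^+ 2)).
  apply: ler_sum => eta _; apply: (le_trans (cauchy_schwarz_csum _ _ _)).
  rewrite mulrC ler_wpM2r// sumr_ge0// => K _; exact: sqr_ge0.
rewrite -mulr_sumr ler_wpM2l//.
rewrite -(partition_big e xpredT (P := P))//= [leRHS](bigID P)//= lerDl.
by apply: sumr_ge0 => K _; exact: sqr_ge0.
Qed.

End Lattice.

(** * The maximal estimate for trigonometric polynomials *)

Lemma geometric_sum_le {R : realFieldType} (k : R) J : 0 <= k < 1 ->
  \sum_(j < J) k ^+ j <= (1 - k)^-1.
Proof.
move=> /andP[k0 k1].
have h : 0 < 1 - k by rewrite subr_gt0.
rewrite -[leRHS]mul1r ler_pdivlMr// mulrC.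
have -> : (1 - k) * \sum_(j < J) k ^+ j = 1 - k ^+ J.
  by rewrite -[1 - k]opprB mulNr -subrX1 opprB.
by rewrite gerBl exprn_ge0.
Qed.

Lemma sum_inj_le {R : realFieldType} (I J : finType) (h : I -> J) (f : J -> R) :
  injective h -> (forall j, 0 <= f j) -> \sum_i f (h i) <= \sum_j f j.
Proof.
move=> hi f0; rewrite -(big_imset f (A := predT) (h := h))//=; last by move=> x y _ _ /hi.
by rewrite [leRHS](bigID (mem [set h x | x in predT]%SET))/= lerDl sumr_ge0.
Qed.

Lemma sqr_sum_le {R : realFieldType} N (b : 'I_N -> R) :
  (\sum_k b k) ^+ 2 <= N%:R * \sum_k b k ^+ 2.
Proof.
have := cauchy_schwarz_sum xpredT (fun _ : 'I_N => 1) b.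
under eq_bigr do rewrite mul1r.
by under [X in _ <= X * _]eq_bigr do rewrite expr1n; rewrite sumr_const card_ord.
Qed.

(* A finite-difference substitute for the Sobolev embedding in [t]: if the N-th
   differences of [z] at scales up to [H] are negligible, then [z l] is controlled
   by the mean of [z] over a window of length [N * H]. *)
Lemma grid_sup {R : realType} (z : nat -> R[i]) (N H L l : nat) (rho : R) :
  (0 < H)%N -> (l + N * H < L)%N -> 0 <= rho ->
  (forall r : nat, (0 < r <= H)%N ->
     cmod (\sum_(k < N.+1) (-1) ^+ k * 'C(N, k)%:R * z (l + k * r)%N) <= rho) ->
  cmod (z l) ^+ 2 <=
  2 * 4 ^+ N * N%:R ^+ 2 / H%:R * \sum_(l' < L) cmod (z l') ^+ 2 + 2 * rho ^+ 2.
Proof.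
move=> H0 lL rho0 hr.
(* At a fixed scale r.+1, the term k = 0 of the difference is [z l], and the other terms have
   binomial weights at most 2^N. *)
have step (r : 'I_H) : cmod (z l) ^+ 2 <=
    2 * 4 ^+ N * N%:R * \sum_(k < N) cmod (z (l + k.+1 * r.+1)%N) ^+ 2 + 2 * rho ^+ 2.
  have := hr r.+1 (ltn_ord r).
  rewrite big_ord_recl /= expr0 bin0 !mul1r mul0n addn0.
  set s := \sum_(k < N) _ => h.
  have hs : cmod s <= 2 ^+ N * \sum_(k < N) cmod (z (l + k.+1 * r.+1)%N).
    apply: le_trans (cmod_sum _ _ _) _; rewrite mulr_sumr; apply: ler_sum => k _.
    rewrite !cmodM /bump /= add1n ler_wpM2r ?cmod_ge0//.
    have -> : cmod ((-1 : R[i]) ^+ k.+1) = 1.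
      elim: k.+1 => [|k' IH]; first by rewrite expr0 cmod1.
      by rewrite exprS cmodM IH cmodN cmod1 mulr1.
    rewrite mul1r -(rmorph_nat (real_complex R)) /= cmod_real ger0_norm// -natrX ler_nat.
    have /= := expnDn 1 1 N; rewrite addnn => ->.
    rewrite (bigD1 (inord k.+1))//= inordK ?ltnS//.
    by rewrite !exp1n !muln1 leq_addr.
  have hz : cmod (z l) <= 2 ^+ N * \sum_(k < N) cmod (z (l + k.+1 * r.+1)%N) + rho.
    have -> : z l = (z l + s) - s by rewrite addrK.
    by apply: le_trans (cmodD _ _) _; rewrite cmodN addrC lerD.
  have c0 := cmod_ge0 (z l).
  set t := \sum_(k < N) cmod _ in hz *.
  have t0 : 0 <= t by apply: sumr_ge0 => k _; exact: cmod_ge0.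
  have p0 : 0 <= (2 : R) ^+ N by rewrite exprn_ge0.
  have t2 : t ^+ 2 <= N%:R * \sum_(k < N) cmod (z (l + k.+1 * r.+1)%N) ^+ 2 by exact: sqr_sum_le.
  have -> : (4 : R) ^+ N = (2 ^+ N) ^+ 2 by rewrite -exprM mulnC exprM; congr (_ ^+ _); rewrite -natrX.
  apply: (@le_trans _ _ (2 * (2 ^+ N) ^+ 2 * t ^+ 2 + 2 * rho ^+ 2)).
    have : cmod (z l) ^+ 2 <= (2 ^+ N * t + rho) ^+ 2 by rewrite ler_pXn2r ?nnegrE// addr_ge0// mulr_ge0.
    have := sqr_ge0 (2 ^+ N * t - rho); nra.
  by rewrite lerD2r -[in leRHS]mulrA ler_wpM2l// mulr_ge0// exprn_ge0.
have Hr : 0 < H%:R :> R by rewrite ltr0n.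
rewrite -(ler_pM2l Hr).
(* Summing over the H scales: for each k the points l + k.+1 * r.+1 are distinct as r varies, so
   their contribution is at most the sum over the whole grid. This is where 1 / H is gained. *)
have -> : H%:R * cmod (z l) ^+ 2 = \sum_(r < H) cmod (z l) ^+ 2.
  by rewrite sumr_const card_ord mulr_natl.
apply: le_trans (ler_sum _ (fun r _ => step r)) _.
rewrite big_split /= sumr_const card_ord -[X in _ + X]mulr_natl mulrDr lerD2r.
rewrite -mulr_sumr exchange_big /=.
have -> : H%:R * (2 * 4 ^+ N * N%:R ^+ 2 / H%:R * \sum_(l' < L) cmod (z l') ^+ 2) =
  2 * 4 ^+ N * N%:R * (N%:R * \sum_(l' < L) cmod (z l') ^+ 2).
  by field; rewrite gt_eqF.
apply: ler_wpM2l; first by rewrite !mulr_ge0// exprn_ge0.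
rewrite mulr_natl -[X in _ *+ X]card_ord -sumr_const; apply: ler_sum => k _.
have hL (r : 'I_H) : (l + k.+1 * r.+1 < L)%N.
  by apply: leq_ltn_trans lL; rewrite leq_add2l leq_mul// ltn_ord.
apply: (sum_inj_le (h := fun r : 'I_H => Ordinal (hL r)) (f := fun l' : 'I_L => cmod (z l') ^+ 2)).
  by move=> r r' [] /eqP; rewrite eqn_add2l eqn_mul2l /= eqSS => /eqP /val_inj.
by move=> j; exact: sqr_ge0.
Qed.

(** Cauchy-Schwarz with weights 2^(j/2), so that the bound does not involve the number of levels. *)
Lemma dyadic_square {R : realType} J (a : 'I_J -> R[i]) :
  cmod (\sum_(j < J) a j) ^+ 2 <= 2 * \sum_(j < J) 2 ^+ j * cmod (a j) ^+ 2.
Proof.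
pose r : R := Num.sqrt 2.
have r0 : 0 < r by rewrite sqrtr_gt0.
have r2 : r ^+ 2 = 2 by rewrite sqr_sqrtr.
apply: (@le_trans _ _ ((\sum_(j < J) (r^-1) ^+ j * (r ^+ j * cmod (a j))) ^+ 2)).
  have h0 : 0 <= \sum_(j < J) (r^-1) ^+ j * (r ^+ j * cmod (a j)).
    by apply: sumr_ge0 => j _; rewrite !mulr_ge0 ?cmod_ge0 ?exprn_ge0 ?invr_ge0 ?(ltW r0).
  rewrite ler_pXn2r ?nnegrE ?cmod_ge0//; apply: le_trans (cmod_sum _ _ _) _.
  apply: ler_sum => j _; rewrite mulrA -exprMn mulVf ?gt_eqF// expr1n mul1r//.
apply: le_trans (cauchy_schwarz_sum _ _ _) _.
rewrite (eq_bigr (fun j : 'I_J => (2^-1) ^+ j)); last first.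
  by move=> j _; rewrite -exprM mulnC exprM; congr (_ ^+ _); rewrite exprVn r2.
rewrite [X in _ * X](eq_bigr (fun j : 'I_J => 2 ^+ j * cmod (a j) ^+ 2)); last first.
  by move=> j _; rewrite exprMn -exprM mulnC exprM r2.
apply: ler_wpM2r.
  by apply: sumr_ge0 => j _; rewrite mulr_ge0 ?sqr_ge0// exprn_ge0.
have h : 0 <= (2^-1 : R) < 1 by lra.
apply: le_trans (geometric_sum_le J h) _.
have -> : (1 - 2^-1 : R) = 2^-1 by lra.
by rewrite invrK.
Qed.

(** * Counting frequencies and summing the dyadic blocks *)

Section Core.
Variables (R : realType) (m d n : nat).
Local Notation C := R[i].

(** There are m.+1 functions here, so the rank (m - 1) d of the informal argument reads m * d. *)
Definition freqs := {ffun 'I_m.+1 -> {ffun 'I_d -> 'I_(n.*2).+1}}.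

Definition natdist (a b : nat) : nat := (a - b) + (b - a).

(* The sup norm of the frequency; an index in [0, 2n] stands for the integer
   index - n. *)
Definition height (K : freqs) : nat := \max_i \max_j natdist (K i j) n.

Lemma height_ge (K : freqs) i j : (natdist (K i j) n <= height K)%N.
Proof.
apply: (@leq_trans (\max_j natdist (K i j) n)); first exact: (leq_bigmax j).
exact: (leq_bigmax (F := fun i => \max_j natdist (K i j) n) i).
Qed.

(** The largest possible sum of m.+1 indices: the default value of [inord] in [sumK] is never taken,
    and sumB < M keeps the sums distinct modulo M. *)
Definition sumB := (m.+1 * n.*2)%N.

Definition sumK (K : freqs) : {ffun 'I_d -> 'I_sumB.+1} :=
  [ffun j => inord (\sum_i K i j)].

Lemma sumKE (K : freqs) j : sumK K j = (\sum_i K i j)%N :> nat.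
Proof.
rewrite ffunE inordK// ltnS /sumB -[X in (_ <= X * _)%N]card_ord -sum_nat_const.
by apply: leq_sum => i _; rewrite -ltnS.
Qed.

Let near_n b := [set r : 'I_(n.*2).+1 | (natdist r n < b)%N]%SET.

Let card_near b : (#|near_n b| <= 2 * b)%N.
Proof.
rewrite -(size_iota (n.+1 - b) (2 * b)) cardE -(size_map val).
apply: uniq_leq_size; first by rewrite map_inj_uniq ?enum_uniq//; exact: val_inj.
move=> x /mapP[r]; rewrite mem_enum inE /natdist => h ->.
by rewrite mem_iota /=; lia.
Qed.

Lemma card_height b :
  (#|[pred K : freqs | (height K < b)%N]| <= (2 * b) ^ (m.+1 * d))%N.
Proof.
apply: (@leq_trans #|@ffun_on 'I_m.+1 (@ffun_on 'I_d (mem (near_n b)))|).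
  apply: subset_leq_card; apply/fintype.subsetP => K; rewrite inE => h.
  apply/ffun_onP => i; apply/ffun_onP => j; rewrite inE.
  exact: leq_ltn_trans (height_ge K i j) h.
rewrite !card_ffun_on !card_ord -expnM [(d * _)%N]mulnC.
by case: (m.+1 * d)%N => // e; rewrite leq_exp2r//; exact: card_near.
Qed.

(** A prescribed sum determines the component K_0 from the others, so forgetting K_0 is injective on
    a fibre. The exponent drops from m.+1 * d to m * d, which decides the range of s. *)
Lemma card_height_sumK b eta :
  (#|[pred K : freqs | (height K < b)%N && (sumK K == eta)]| <= (2 * b) ^ (m * d))%N.
Proof.
pose proj (K : freqs) : {ffun 'I_m -> {ffun 'I_d -> 'I_(n.*2).+1}} :=
  [ffun i => K (lift ord0 i)].
set A := [pred K | _].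
have injA : {in A &, injective proj}.
  move=> K K'; rewrite !inE => /andP[_ /eqP e1] /andP[_ /eqP e2] /ffunP epr.
  have el i : K (lift ord0 i) = K' (lift ord0 i) by have := epr i; rewrite !ffunE.
  apply/ffunP => i; case: (unliftP ord0 i) => [i' ->|->]; first exact: el.
  apply/ffunP => j; apply: val_inj => /=.
  have : sumK K j = sumK K' j :> nat by rewrite e1 e2.
  rewrite !sumKE !big_ord_recl.
  under eq_bigr do rewrite el.
  by move/addIn.
rewrite -(card_in_imset injA).
apply: (@leq_trans #|@ffun_on 'I_m (@ffun_on 'I_d (mem (near_n b)))|).
  apply: subset_leq_card; apply/fintype.subsetP => K' /imsetP[K].
  rewrite inE => /andP[h _] ->.
  apply/ffun_onP => i; apply/ffun_onP => j; rewrite inE ffunE.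
  exact: leq_ltn_trans (height_ge K _ j) h.
rewrite !card_ffun_on !card_ord -expnM [(d * _)%N]mulnC.
by case: (m * d)%N => // e; rewrite leq_exp2r//; exact: card_near.
Qed.

Section Estimate.
Variables (q N M g : nat) (c : freqs -> C) (S : nat -> freqs -> C).
Variables (A E c0 rho : R).

(** Level j means D^j <= height + 1 < D^(j+1) with D = 2^q; adding 1 gives the zero frequency the
    level 0. *)
Definition level (K : freqs) : nat := trunc_log (2 ^ q) (height K).+1.

Definition nlevels : nat := (\max_K level K).+1.

Hypotheses (q0 : (0 < q)%N) (A0 : 0 <= A) (E0 : 0 <= E) (c00 : 0 <= c0) (rho0 : 0 <= rho).
Hypothesis M0 : (sumB < M)%N.
Hypothesis gbig : (q.+1 * nlevels + N <= g)%N.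
Hypothesis S_decay : forall l K, (l <= 2 * 2 ^ g)%N ->
  cmod (S l K) ^+ 2 <= A * rho ^+ level K.
Hypothesis S_diff : forall l r K,
  cmod (\sum_(k < N.+1) (-1) ^+ k * 'C(N, k)%:R * S (l + k * r)%N K) <=
  E * (c0 * (r%:R / 2 ^+ g) * (height K).+1%:R) ^+ N.

Let D : R := 2 ^+ q.
(** The ratios of the two series over the levels. In [kappa1], 2^(q+2) collects 2 from
    [dyadic_square] and 2 D from the window, D^(m d) is the growth of a fibre and [rho] the decay of
    the squared symbol. In [kappa2], 2 comes again from [dyadic_square], D^(m.+1 * d) is the growth
    of a whole block, and 4^-N comes from the squared N-th differences. *)
Let kappa1 := 2 ^+ q.+2 * D ^+ (m * d) * rho.
Let kappa2 := 2 * D ^+ (m.+1 * d) / 4 ^+ N.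
Hypotheses (kappa1_lt1 : kappa1 < 1) (kappa2_lt1 : kappa2 < 1).

(** Here 6 * 8^N is the factor 2 * 4^N of [grid_sup] times 3 * 2^N, because the grid has at most 3 *
    2^(q.+1 * j + N) * H j points. The outer 2 is that of [dyadic_square]. *)
Definition core_const : R :=
  2 * (6 * 8 ^+ N * N%:R ^+ 2 * (2 * D) ^+ (m * d) * A / (1 - kappa1)
     + 2 * (E * (c0 * D) ^+ N) ^+ 2 * (2 * D) ^+ (m.+1 * d) / (1 - kappa2)).

Let G := (2 ^ g)%N.
Let bl (j : 'I_nlevels) := [pred K : freqs | level K == j].
Let aj (j : 'I_nlevels) (l : nat) (u : {ffun 'I_d -> 'I_M}) : C :=
  \sum_(K | bl j K) c K * S l K * lat_char R (sumK K) u.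
Let P := \sum_K cmod (c K) ^+ 2.
(** In units of time this scale is 2^(-(q+1) j - N), so that its product with a height of level j is
    at most D * 2^-j. The summand N gives N * H j <= 2^g, which keeps the differences starting at l
    <= 2^g inside the grid of length 2 * 2^g. *)
Let H (j : nat) := (2 ^ (g - (q.+1 * j + N)))%N.

Let P0 : 0 <= P. Proof. by apply: sumr_ge0 => K _; exact: sqr_ge0. Qed.

Let DE : D = (2 ^ q)%:R. Proof. by rewrite natrX. Qed.

Let D1 : 1 <= D. Proof. by rewrite exprn_ege1// ler1n. Qed.

Let bl_height j K : bl j K -> ((height K).+1 <= (2 ^ q) ^ j.+1)%N.
Proof.
move=> /eqP <-; have := @trunc_log_bounds (2 ^ q) (height K).+1.
rewrite -{1}(expn0 2) ltn_exp2l// => /(_ q0 isT) /andP[_]; exact: ltnW.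
Qed.

Let bl_card_sumK j eta : (#|[pred K | bl j K & sumK K == eta]|%:R : R) <=
  (2 * D ^+ j.+1) ^+ (m * d).
Proof.
rewrite DE -natrX -natrM -natrX ler_nat; apply: leq_trans (card_height_sumK _ eta).
apply: subset_leq_card; apply/fintype.subsetP => K; rewrite !inE => /andP[/bl_height h ->].
by rewrite andbT.
Qed.

Let bl_card j : (#|bl j|%:R : R) <= (2 * D ^+ j.+1) ^+ (m.+1 * d).
Proof.
rewrite DE -natrX -natrM -natrX ler_nat; apply: leq_trans (card_height _).
apply: subset_leq_card; apply/fintype.subsetP => K; exact: bl_height.
Qed.

Let aj_l2 j l : (l <= 2 * G)%N ->
  \sum_u cmod (aj j l u) ^+ 2 <=
  (M ^ d)%:R * ((2 * D ^+ j.+1) ^+ (m * d) * (A * rho ^+ j) * P).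
Proof.
move=> hl; apply: l2_diag => //.
- exact: leq_ltn_trans M0.
- by rewrite !mulr_ge0// exprn_ge0// ?mulr_ge0// exprn_ge0// (le_trans ler01 D1).
move=> eta.
apply: (@le_trans _ _ (\sum_(K | bl j K && (sumK K == eta)) A * rho ^+ j)).
  apply: ler_sum => K /andP[/eqP <- _]; exact: S_decay.
rewrite sumr_const -[leLHS]mulr_natl ler_wpM2r ?mulr_ge0 ?exprn_ge0//.
exact: bl_card_sumK.
Qed.

(** The bound [S_diff] at the largest scale [H j] and the largest height of level j. *)
Let rem (j : nat) : R := E * (c0 * D) ^+ N * (2^-1) ^+ (j * N).

Let rem0 j : 0 <= rem j.
Proof. by rewrite !mulr_ge0 ?exprn_ge0 ?mulr_ge0 ?(le_trans ler01 D1). Qed.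

Let level_le (j : 'I_nlevels) : (q.+1 * j + N <= g)%N.
Proof. by apply: leq_trans gbig; rewrite leq_add2r leq_mul// ltnW. Qed.

(** The characters and the coefficients do not depend on l, so the differences fall on [S] alone. *)
Let aj_diff (j : 'I_nlevels) l u r : (0 < r <= H j)%N ->
  cmod (\sum_(k < N.+1) (-1) ^+ k * 'C(N, k)%:R * aj j (l + k * r)%N u) <=
  rem j * \sum_(K | bl j K) cmod (c K).
Proof.
move=> /andP[_ rH].
have -> : \sum_(k < N.+1) (-1) ^+ k * 'C(N, k)%:R * aj j (l + k * r)%N u =
  \sum_(K | bl j K) c K * lat_char R (sumK K) u *
     (\sum_(k < N.+1) (-1) ^+ k * 'C(N, k)%:R * S (l + k * r)%N K).
  under eq_bigr do rewrite mulr_sumr.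
  rewrite exchange_big /=; apply: eq_bigr => K _.
  by rewrite mulr_sumr; apply: eq_bigr => k _; ring.
apply: le_trans (cmod_sum _ _ _) _; rewrite mulr_sumr; apply: ler_sum => K bK.
rewrite !cmodM.
have -> : cmod (lat_char R (sumK K) u) = 1.
  rewrite /lat_char cmod_prod big1// => i _.
  by rewrite -expiMn cmod_expi.
rewrite mulr1 mulrC ler_wpM2r ?cmod_ge0//; apply: le_trans (S_diff l r K) _.
rewrite /rem -[leRHS]mulrA ler_wpM2l// exprM -exprMn.
have D0 : 0 <= D := le_trans ler01 D1.
rewrite lerXn2r ?nnegrE ?mulr_ge0 ?divr_ge0 ?exprn_ge0 ?invr_ge0//.
rewrite -[leLHS]mulrA -[leRHS]mulrA ler_wpM2l//.
have h2 e : 0 < (2 : R) ^+ e by rewrite exprn_gt0.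
apply: (@le_trans _ _ ((2 ^+ (q.+1 * j + N))^-1 * D ^+ j.+1)).
  apply: ler_pM => //.
    rewrite ler_pdivrMr// mulrC ler_pdivlMr// -!natrX -natrM ler_nat.
    by rewrite -[in leqRHS](subnK (level_le j)) [in leqRHS]expnD leq_mul2r rH orbT.
  by rewrite DE -natrX ler_nat; exact: bl_height.
rewrite ler_pdivrMl//.
have -> : 2 ^+ (q.+1 * j + N) * (D * 2^-1 ^+ j) = 2 ^+ N * D ^+ j.+1.
  rewrite mulSn -addnA exprD [2 ^+ (q * j + N)]exprD exprM -/D exprS exprVn.
  by field; rewrite gt_eqF.
rewrite ler_peMl ?exprn_ge0// exprn_ege1// ler1n//.
Qed.

Let b (u : {ffun 'I_d -> 'I_M}) : R :=
  2 * \sum_(j < nlevels) 2 ^+ j *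
    (2 * 4 ^+ N * N%:R ^+ 2 / (H j)%:R *
       \sum_(l < (2 * G).+1) cmod (aj j l u) ^+ 2 +
     2 * (rem j * \sum_(K | bl j K) cmod (c K)) ^+ 2).

Let sup_le_b l u : (l <= G)%N ->
  cmod (\sum_K c K * S l K * lat_char R (sumK K) u) ^+ 2 <= b u.
Proof.
move=> lG.
have -> : \sum_K c K * S l K * lat_char R (sumK K) u = \sum_j aj j l u.
  have lev K : (level K < nlevels)%N by rewrite ltnS; exact: (leq_bigmax K).
  by rewrite (partition_big (fun K => Ordinal (lev K)) xpredT)//=.
apply: le_trans (dyadic_square _) _; rewrite ler_wpM2l//.
apply: ler_sum => j _; rewrite ler_wpM2l ?exprn_ge0//.
apply: (grid_sup (z := fun l => aj j l u)).
- by rewrite expn_gt0.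
- rewrite ltnS mul2n -addnn leq_add//.
  rewrite /H /G -{2}(subnK (level_le j)) expnD mulnC leq_mul2l; apply/orP; right.
  by rewrite (leq_trans (ltnW (ltn_expl N (isT : 1 < 2)%N)))// leq_exp2l// leq_addl.
- by rewrite mulr_ge0// sumr_ge0// => K _; exact: cmod_ge0.
- by move=> r; exact: aj_diff.
Qed.

Let kappa1_ge0 : 0 <= kappa1.
Proof.
have D0 : 0 <= D := le_trans ler01 D1.
by apply: mulr_ge0 => //; apply: mulr_ge0; exact: exprn_ge0.
Qed.

Let kappa2_ge0 : 0 <= kappa2.
Proof.
have D0 : 0 <= D := le_trans ler01 D1.
apply: mulr_ge0; last by rewrite invr_ge0 exprn_ge0.
by apply: mulr_ge0 => //; exact: exprn_ge0.
Qed.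

Lemma core_const_ge0 : 0 <= core_const.
Proof.
have D0 : 0 <= D := le_trans ler01 D1.
have p k : 0 <= (2 * D) ^+ k by rewrite exprn_ge0// mulr_ge0.
apply: mulr_ge0 => //; apply: addr_ge0.
  apply: mulr_ge0; last by rewrite invr_ge0 subr_ge0 ltW.
  by do ![exact: p|apply: mulr_ge0|apply: exprn_ge0].
apply: mulr_ge0; last by rewrite invr_ge0 subr_ge0 ltW.
by apply: mulr_ge0 => //; rewrite mulr_ge0// sqr_ge0.
Qed.

Let sum_b : \sum_u b u <= (M ^ d)%:R * (core_const * P).
Proof.
have D0 : 0 <= D := le_trans ler01 D1.
pose C1 := 6 * 8 ^+ N * N%:R ^+ 2 * (2 * D) ^+ (m * d) * A.
pose C2 := 2 * (E * (c0 * D) ^+ N) ^+ 2 * (2 * D) ^+ (m.+1 * d).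
pose V := (M ^ d)%:R * P.
have V0 : 0 <= V by rewrite mulr_ge0.
rewrite -mulr_sumr exchange_big /=.
apply: (@le_trans _ _ (2 * \sum_(j < nlevels)
   V * (C1 * kappa1 ^+ j + C2 * kappa2 ^+ j))); last first.
  have hs : \sum_(j < nlevels) (C1 * kappa1 ^+ j + C2 * kappa2 ^+ j) <=
      C1 / (1 - kappa1) + C2 / (1 - kappa2).
    rewrite big_split -!mulr_sumr lerD// ler_wpM2l ?geometric_sum_le ?kappa1_ge0 ?kappa2_ge0//.
      by rewrite !mulr_ge0 ?exprn_ge0 ?mulr_ge0.
    by rewrite !mulr_ge0 ?exprn_ge0 ?mulr_ge0 ?exprn_ge0 ?mulr_ge0.
  have -> : (M ^ d)%:R * (core_const * P) =
      2 * (V * (C1 / (1 - kappa1) + C2 / (1 - kappa2))).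
    rewrite /core_const -/C1 -/C2 /V; ring.
  by rewrite -mulr_sumr !ler_wpM2l.
have pw k (j : nat) : (2 * D ^+ j.+1) ^+ k = (2 * D) ^+ k * (D ^+ k) ^+ j.
  by rewrite exprS mulrA exprMn -[D ^+ j ^+ k]exprM mulnC exprM.
rewrite ler_wpM2l//; apply: ler_sum => j _.
rewrite -mulr_sumr big_split /= -mulr_sumr exchange_big /= sumr_const.
rewrite card_ffun !card_ord mulrDr [leRHS]mulrDr lerD//.
  pose X := (M ^ d)%:R * ((2 * D ^+ j.+1) ^+ (m * d) * (A * rho ^+ j) * P).
  have X0 : 0 <= X.
    apply: mulr_ge0 => //; apply: mulr_ge0 => //.
    apply: mulr_ge0; last by rewrite mulr_ge0 ?exprn_ge0.
    by apply: exprn_ge0; apply: mulr_ge0 => //; exact: exprn_ge0.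
  have H0 : 0 < (H j)%:R :> R by rewrite ltr0n expn_gt0.
  have co0 : 0 <= 2 * 4 ^+ N * N%:R ^+ 2 / (H j)%:R :> R.
    apply: mulr_ge0; last by rewrite invr_ge0.
    by apply: mulr_ge0; rewrite ?exprn_ge0// mulr_ge0 ?exprn_ge0.
  have hG : ((2 * G).+1%:R : R) <= 3 * 2 ^+ (q.+1 * j + N) * (H j)%:R.
    rewrite -mulrA -natrX -!natrM ler_nat.
    have -> : (2 ^ (q.+1 * j + N) * H j = G)%N.
      by rewrite /H /G -expnD subnKC// level_le.
    by rewrite ltn_mul2r expn_gt0.
  apply: (@le_trans _ _ (2 ^+ j * (2 * 4 ^+ N * N%:R ^+ 2 / (H j)%:R *
     \sum_(l < (2 * G).+1) X))).
    rewrite ler_wpM2l ?exprn_ge0// ler_wpM2l//.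
    by apply: ler_sum => l _; apply: aj_l2; rewrite -ltnS.
  rewrite sumr_const card_ord -[X *+ _]mulr_natl.
  apply: (@le_trans _ _ (2 ^+ j * (2 * 4 ^+ N * N%:R ^+ 2 / (H j)%:R *
     (3 * 2 ^+ (q.+1 * j + N) * (H j)%:R * X)))).
    rewrite ler_wpM2l ?exprn_ge0// ler_wpM2l//.
    by rewrite ler_wpM2r.
  have k1E : kappa1 ^+ j = 2 ^+ j * (2 ^+ q.+1) ^+ j * (D ^+ (m * d)) ^+ j * rho ^+ j.
    by rewrite /kappa1 exprS !exprMn.
  rewrite /X /V /C1 k1E pw.
  have -> : (2 : R) ^+ (q.+1 * j + N) = (2 ^+ q.+1) ^+ j * 2 ^+ N by rewrite exprD exprM.
  have -> : (8 : R) ^+ N = 4 ^+ N * 2 ^+ N.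
    by rewrite -exprMn; congr (_ ^+ _); rewrite -natrM.
  rewrite le_eqVlt; apply/orP; left; apply/eqP.
  by field; rewrite gt_eqF.
(* A crude Cauchy-Schwarz over the whole block, with no use of orthogonality: its loss D^(j m.+1 d)
   is paid for by the factor 4^(-j N) in the square of [rem]. *)
have hc : (\sum_(K | bl j K) cmod (c K)) ^+ 2 <= (2 * D ^+ j.+1) ^+ (m.+1 * d) * P.
  have := cauchy_schwarz_sum (bl j) (fun _ : freqs => 1) (fun K => cmod (c K)).
  under eq_bigr do rewrite mul1r.
  under [X in _ <= X * _ -> _]eq_bigr do rewrite expr1n.
  rewrite sumr_const => h; apply: le_trans h _.
  apply: ler_pM => //; first by apply: sumr_ge0 => K _; exact: sqr_ge0.
    exact: bl_card.
  rewrite [leRHS](bigID (bl j))//= lerDl.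
  by apply: sumr_ge0 => K _; exact: sqr_ge0.
rewrite -[X in _ * X]mulr_natl.
apply: (@le_trans _ _ (2 ^+ j * ((M ^ d)%:R * (2 * (rem j ^+ 2 *
   ((2 * D ^+ j.+1) ^+ (m.+1 * d) * P)))))).
  rewrite !ler_wpM2l ?exprn_ge0// exprMn ler_wpM2l// sqr_ge0//.
rewrite /V /C2 /kappa2 pw /rem !exprMn.
have -> : ((2 : R)^-1 ^+ (j * N)) ^+ 2 = (4 ^+ N)^-1 ^+ j.
  rewrite (_ : 4 = 2 ^+ 2 :> R); last by rewrite -natrX.
  rewrite -!exprVn -!exprM; congr (_ ^+ _).
  by rewrite mulnC [(j * N)%N]mulnC mulnA.
rewrite le_eqVlt; apply/orP; left; apply/eqP.
ring.
Qed.

Lemma core_estimate : exists b : {ffun 'I_d -> 'I_M} -> R,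
  (forall u l, (l <= 2 ^ g)%N ->
     cmod (\sum_K c K * S l K * lat_char R (sumK K) u) ^+ 2 <= b u) /\
  \sum_u b u <= (M ^ d)%:R * (core_const * \sum_K cmod (c K) ^+ 2).
Proof. by exists b; split=> // u l; exact: sup_le_b. Qed.

End Estimate.
End Core.

(** * Integration against sigma *)

Section BorelMatrix.
Variables (R : realType) (m d : nat).
Local Notation T := (bmx R m d).

Lemma continuous_measurable_bmx (f : 'M[R]_(m, d) -> R) :
  continuous f -> measurable_fun [set: T] (f : T -> R).
Proof.
move=> cf mD; apply: (measurability _ (RGenOInfty.measurableE R)) => //.
move=> /= _ [_ [a ->] <-]; rewrite setTI.
apply: sub_sigma_algebra; apply: open_comp; last exact: interval_open.
by move=> x _; exact: cf.
Qed.

Lemma measurable_coord i j : measurable_fun [set: T] ((fun y => y i j) : T -> R).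
Proof. by apply: continuous_measurable_bmx; exact: coord_continuous. Qed.

Lemma measurable_mdot (xi : 'M[R]_(m, d)) :
  measurable_fun [set: T] ((fun y => mdot (y : 'M[R]_(m, d)) xi) : T -> R).
Proof.
apply: measurable_sum => i; apply: measurable_sum => j.
by apply: measurable_funM => //; exact: measurable_coord.
Qed.

Lemma measurable_enorm :
  measurable_fun [set: T] ((fun y => enorm (y : 'M[R]_(m, d))) : T -> R).
Proof.
have hs : measurable_fun [set: T]
    ((fun y => \sum_(i < m) \sum_(j < d) y i j ^+ 2) : T -> R).
  apply: measurable_sum => i; apply: measurable_sum => j.
  by apply: measurable_funX; exact: measurable_coord.
apply: (@measurableT_comp _ _ _ _ _ _ (@Num.sqrt R)) => //.
by apply: continuous_measurable_fun => x; exact: sqrt_continuous.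
Qed.

Definition bounded_meas (h : T -> R) :=
  measurable_fun [set: T] h /\ exists B, forall y, `|h y| <= B.

Definition cbounded_meas (g : T -> R[i]) :=
  bounded_meas (fun y => complex.Re (g y)) /\ bounded_meas (fun y => complex.Im (g y)).

Lemma bounded_measD f g : bounded_meas f -> bounded_meas g -> bounded_meas (fun y => f y + g y).
Proof.
move=> [mf [A hA]] [mg [B hB]]; split; first exact: measurable_funD.
by exists (A + B) => y; apply: le_trans (ler_normD _ _) _; exact: lerD.
Qed.

Lemma bounded_measM f g : bounded_meas f -> bounded_meas g -> bounded_meas (fun y => f y * g y).
Proof.
move=> [mf [A hA]] [mg [B hB]]; split; first exact: measurable_funM.
by exists (A * B) => y; rewrite normrM ler_pM.
Qed.

Lemma bounded_meas_cst k : bounded_meas (fun=> k).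
Proof. by split; [exact: measurable_cst | exists `|k|]. Qed.

Lemma bounded_measN f : bounded_meas f -> bounded_meas (fun y => - f y).
Proof.
move=> hf; have := bounded_measM (bounded_meas_cst (-1)) hf.
by under eq_fun do rewrite mulN1r.
Qed.

Lemma cbounded_measD f g : cbounded_meas f -> cbounded_meas g ->
  cbounded_meas (fun y => f y + g y).
Proof.
move=> [fr fi] [gr gi]; split.
  rewrite (_ : (fun y => _) = (fun y => complex.Re (f y) + complex.Re (g y))).
    exact: bounded_measD.
  by apply/funext => y; case: (f y) (g y) => ? ? [].
rewrite (_ : (fun y => _) = (fun y => complex.Im (f y) + complex.Im (g y))).
  exact: bounded_measD.
by apply/funext => y; case: (f y) (g y) => ? ? [].
Qed.

Lemma cbounded_measM f g : cbounded_meas f -> cbounded_meas g ->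
  cbounded_meas (fun y => f y * g y).
Proof.
move=> [fr fi] [gr gi]; split.
  rewrite (_ : (fun y => _) = (fun y => complex.Re (f y) * complex.Re (g y) +
      - (complex.Im (f y) * complex.Im (g y)))).
    by apply: bounded_measD; [|apply: bounded_measN]; exact: bounded_measM.
  by apply/funext => y; case: (f y) (g y) => ? ? [].
rewrite (_ : (fun y => _) = (fun y => complex.Re (f y) * complex.Im (g y) +
    complex.Im (f y) * complex.Re (g y))).
  by apply: bounded_measD; exact: bounded_measM.
by apply/funext => y; case: (f y) (g y) => ? ? [].
Qed.

Lemma cbounded_meas_cst k : cbounded_meas (fun=> k).
Proof. by split; exact: bounded_meas_cst. Qed.

Lemma cbounded_meas_sum (I : Type) (r : seq I) (P : pred I) (F : I -> T -> R[i]) :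
  (forall i, cbounded_meas (F i)) -> cbounded_meas (fun y => \sum_(i <- r | P i) F i y).
Proof.
move=> h; elim: r => [|i r IH].
  by under eq_fun do rewrite big_nil; exact: cbounded_meas_cst.
under eq_fun do rewrite big_cons; case: (P i) => //; exact: cbounded_measD.
Qed.

Lemma cbounded_meas_prod (I : Type) (r : seq I) (P : pred I) (F : I -> T -> R[i]) :
  (forall i, cbounded_meas (F i)) -> cbounded_meas (fun y => \prod_(i <- r | P i) F i y).
Proof.
move=> h; elim: r => [|i r IH].
  by under eq_fun do rewrite big_nil; exact: cbounded_meas_cst.
under eq_fun do rewrite big_cons; case: (P i) => //; exact: cbounded_measM.
Qed.

Lemma cbounded_meas_expi (h : T -> R) : measurable_fun [set: T] h ->
  cbounded_meas (fun y => expi (h y)).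
Proof.
move=> mh; split; split.
- apply: measurableT_comp => //; apply: continuous_measurable_fun; exact: continuous_cos.
- by exists 1 => y; exact: cos_max.
- apply: measurableT_comp => //; apply: continuous_measurable_fun; exact: continuous_sin.
- by exists 1 => y; exact: sin_max.
Qed.

Section Sigma.
Variable sigma : {measure set T -> \bar R}.
Hypothesis fin_sigma : (sigma setT < +oo)%E.

Definition Cint (g : T -> R[i]) : R[i] :=
  Complex (Rintegral sigma setT (fun y => complex.Re (g y)))
          (Rintegral sigma setT (fun y => complex.Im (g y))).

Lemma bounded_meas_integrable h : bounded_meas h -> sigma.-integrable setT (EFin \o h).
Proof.
move=> [mh [B hB]]; apply: measurable_bounded_integrable => //.
exists B; split; first exact: num_real.
by move=> x Bx y _ /=; apply: le_trans (hB y) (ltW Bx).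
Qed.

Lemma Cint_sum (I : Type) (r : seq I) (P : pred I) (F : I -> T -> R[i]) :
  (forall i, cbounded_meas (F i)) ->
  Cint (fun y => \sum_(i <- r | P i) F i y) = \sum_(i <- r | P i) Cint (F i).
Proof.
move=> h; elim: r => [|i r IH].
  rewrite big_nil /Cint; under eq_fun do rewrite big_nil.
  under [X in Complex _ X]eq_Rintegral do rewrite big_nil.
  by rewrite /Rintegral !integral0.
rewrite big_cons; case: ifPn => Pi; last first.
  by rewrite -IH; congr Cint; apply/funext => y; rewrite big_cons (negPf Pi).
rewrite -IH /Cint.
have [rr ri] := cbounded_meas_sum r P h.
have [fr fi] := h i.
rewrite [RHS]/(_ + _) /=; congr Complex.
  rewrite -RintegralD//; [|exact: bounded_meas_integrable..].
  by apply: eq_Rintegral => y _; rewrite big_cons Pi; case: (F i y) (\sum_(j <- r | P j) F j y) => ? ? [].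
rewrite -RintegralD//; [|exact: bounded_meas_integrable..].
by apply: eq_Rintegral => y _; rewrite big_cons Pi; case: (F i y) (\sum_(j <- r | P j) F j y) => ? ? [].
Qed.

Lemma CintZ k g : cbounded_meas g -> Cint (fun y => k * g y) = k * Cint g.
Proof.
move=> [gr gi]; case: k => a b; rewrite /Cint [RHS]/(_ * _) /=.
have Z c h : bounded_meas h -> Rintegral sigma setT (fun y => c * h y) = c * Rintegral sigma setT h.
  by move=> hh; rewrite RintegralZl//; exact: bounded_meas_integrable.
have bZ c h : bounded_meas h -> sigma.-integrable setT (EFin \o (fun y => c * h y)).
  by move=> hh; apply: bounded_meas_integrable; apply: bounded_measM => //; exact: bounded_meas_cst.
rewrite -!Z//; congr Complex.
  rewrite -RintegralB//; [|exact: bZ..].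
  by apply: eq_Rintegral => y _; case: (g y).
rewrite -RintegralD//; [|exact: bZ..].
by apply: eq_Rintegral => y _; case: (g y).
Qed.

Hypothesis supp_sigma : sigma [set y : T | 1 < enorm (y : 'M[R]_(m, d))] = 0%E.

Lemma Rintegral_bound h (e : R) : bounded_meas h -> 0 <= e ->
  (forall y : T, enorm (y : 'M[R]_(m, d)) <= 1 -> `|h y| <= e) ->
  `|Rintegral sigma setT h| <= e * fine (sigma setT).
Proof.
move=> bh e0 he; have ih := bounded_meas_integrable bh.
apply: le_trans (le_normr_Rintegral measurableT ih) _.
have fs : sigma setT \is a fin_num by rewrite ge0_fin_numE.
have key : (\int[sigma]_y `|(h y)%:E| <= e%:E * sigma setT)%E.
  apply: integral_le_bound => //.
    by apply/measurable_EFinP; exact: bh.1.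
  exists [set y : T | 1 < enorm (y : 'M[R]_(m, d))]; split => //.
    have := measurable_enorm measurableT (measurable_itv `]1, +oo[ : measurable (`]1, +oo[%classic : set R)).
    rewrite setTI; congr measurable; apply/seteqP; split => y /=; by rewrite in_itv /= andbT.
  move=> y /= hy; rewrite ltNge; apply/negP => hy1; apply: hy => _.
  by rewrite lee_fin; exact: he.
rewrite /Rintegral -lee_fin EFinM (fineK fs) fineK//.
rewrite ge0_fin_numE; last by apply: integral_ge0.
by apply: le_lt_trans key _; rewrite -(fineK fs) -EFinM ltry.
Qed.

Lemma Cint_bound g (e : R) : cbounded_meas g -> 0 <= e ->
  (forall y : T, enorm (y : 'M[R]_(m, d)) <= 1 -> cmod (g y) <= e) ->
  cmod (Cint g) <= 2 * e * fine (sigma setT).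
Proof.
move=> [gr gi] e0 he; apply: le_trans (cmod_le _) _.
rewrite -mulrA mulr_natl mulr2n; apply: lerD; apply: Rintegral_bound => // y /he h.
  exact: le_trans (normr_Re_le _) h.
exact: le_trans (normr_Im_le _) h.
Qed.

End Sigma.
End BorelMatrix.

Lemma exprn_powR {R : realType} (x s : R) k : 0 <= x -> (x `^ s) ^+ k = (x ^+ k) `^ s.
Proof.
by move=> x0; rewrite -powR_mulrn ?powR_ge0// -powRrM mulrC powRrM powR_mulrn.
Qed.

(** * The symbol: decay, differences and Lipschitz bounds *)

Section Symbol.
Variables (R : realType) (m d : nat).
Local Notation T := (bmx R m.+1 d).
Variable sigma : {measure set T -> \bar R}.
Hypothesis fin_sigma : (sigma setT < +oo)%E.
Hypothesis supp_sigma : sigma [set y : T | 1 < enorm (y : 'M[R]_(m.+1, d))] = 0%E.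

Let sm := fine (sigma setT).

Let sm0 : 0 <= sm. Proof. by rewrite fine_ge0. Qed.

Definition freqmx n (K : freqs m d n) : 'M[R]_(m.+1, d) :=
  \matrix_(i, j) ((K i j)%:R - n%:R).

(** Since pi / 4 = 2 pi / 8, this is the Fourier transform of sigma at t K / 8: the factor acquired
    by a product of waves of period 8 with frequencies K_i when it is taken at the points x - t y_i
    and integrated in y. *)
Definition symbol n (t : R) (K : freqs m d n) : R[i] :=
  Cint sigma (fun y => expi (- (t * (pi / 4 * mdot (y : 'M[R]_(m.+1, d)) (freqmx K))))).

(* The L^2 bound, over a lattice of M^d points, for the maximal function of a
   trigonometric polynomial, with [t] restricted to the grid 1 + l / 2^g. The
   constant depends neither on the degree n nor on M and g. *)
Definition symbol_bound (C0 : R) : Prop :=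
  forall n M (c : freqs m d n -> R[i]), (sumB m n < M)%N ->
  exists g0, forall g, (g0 <= g)%N -> exists b : {ffun 'I_d -> 'I_M} -> R,
    (forall u l, (l <= 2 ^ g)%N ->
       cmod (\sum_K c K * symbol (1 + l%:R / 2 ^+ g) K * lat_char R (sumK K) u) ^+ 2 <= b u) /\
    \sum_u b u <= (M ^ d)%:R * (C0 * \sum_K cmod (c K) ^+ 2).

Lemma coord_le_enorm p q (A : 'M[R]_(p, q)) i j : `|A i j| <= enorm A.
Proof.
rewrite -sqrtr_sqr /enorm ler_wsqrtr//.
rewrite (bigD1 i)//= (bigD1 j)//= -addrA lerDl addr_ge0// ?sumr_ge0// => ? _.
  exact: sqr_ge0.
by apply: sumr_ge0 => ? _; exact: sqr_ge0.
Qed.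

Lemma freqmx_norm n (K : freqs m d n) i j : `|freqmx K i j| = (natdist (K i j) n)%:R.
Proof.
rewrite mxE /natdist natrD; case: (leqP (K i j) n) => h.
  have /eqP -> : (K i j - n == 0)%N by rewrite subn_eq0.
  rewrite add0r natrB; last exact: h.
  rewrite ler0_norm; first by rewrite opprB.
  by rewrite subr_le0 ler_nat; exact: h.
have /eqP -> : (n - K i j == 0)%N by rewrite subn_eq0 ltnW.
rewrite addr0 natrB; last exact: ltnW.
rewrite ger0_norm; first by [].
by rewrite subr_ge0 ler_nat; exact: ltnW.
Qed.

Lemma symbol_ft n t (K : freqs m d n) :
  cmod (symbol t K) = ft_abs sigma ((t / 8) *: freqmx K).
Proof.
have E y : t * (pi / 4 * mdot y (freqmx K)) = 2 * pi * mdot y ((t / 8) *: freqmx K).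
  rewrite [in RHS]/mdot; under eq_bigr do under eq_bigr do rewrite mxE mulrCA.
  under eq_bigr do rewrite -mulr_sumr.
  by rewrite -mulr_sumr /mdot; field.
rewrite /cmod /ft_abs.
have -> : complex.Re (symbol t K) = ft_re sigma ((t / 8) *: freqmx K).
  by apply: eq_Rintegral => y _; rewrite /= E cosN.
have -> // : complex.Im (symbol t K) = ft_im sigma ((t / 8) *: freqmx K).
by apply: eq_Rintegral => y _; rewrite /= E sinN.
Qed.

Lemma height_le_freqmx n (K : freqs m d n) : (height K)%:R <= enorm (freqmx K).
Proof.
have e0 : 0 <= enorm (freqmx K) by exact: sqrtr_ge0.
rewrite /height.
elim/big_ind: _ => // [x y hx hy|i _].
  by rewrite /maxn; case: ifP.
elim/big_ind: _ => // [x y hx hy|j _].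
  by rewrite /maxn; case: ifP.
by rewrite -freqmx_norm coord_le_enorm.
Qed.

Lemma mdot_le n (K : freqs m d n) (y : 'M[R]_(m.+1, d)) : enorm y <= 1 ->
  `|mdot y (freqmx K)| <= (m.+1 * d)%:R * (height K)%:R.
Proof.
move=> hy; apply: le_trans (ler_norm_sum _ _ _) _.
apply: (@le_trans _ _ (\sum_(i < m.+1) \sum_(j < d) (height K)%:R)).
  apply: ler_sum => i _; apply: le_trans (ler_norm_sum _ _ _) _.
  apply: ler_sum => j _; rewrite normrM freqmx_norm -[leRHS]mul1r ler_pM//.
    exact: le_trans (coord_le_enorm _ _ _) hy.
  by rewrite ler_nat height_ge.
rewrite sumr_const card_ord sumr_const card_ord -mulrnA mulr_natl mulnC//.
Qed.

Let meas_phase n t (K : freqs m d n) : cbounded_meas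
  (fun y : T => expi (- (t * (pi / 4 * mdot (y : 'M[R]_(m.+1, d)) (freqmx K))))).
Proof.
apply: cbounded_meas_expi; apply: measurableT_comp => //.
by apply: measurable_funM => //; apply: measurable_funM => //; exact: measurable_mdot.
Qed.

Let phase_le n h (K : freqs m d n) (y : 'M[R]_(m.+1, d)) : enorm y <= 1 ->
  `|h * (pi / 4 * mdot y (freqmx K))| <= `|h| * (pi / 4 * ((m.+1 * d)%:R * (height K)%:R)).
Proof.
move=> hy; rewrite !normrM ler_wpM2l// (ger0_norm (x := pi)) ?pi_ge0//.
by rewrite ger0_norm ?invr_ge0// ler_wpM2l ?mulr_ge0 ?pi_ge0 ?invr_ge0// mdot_le.
Qed.

(** The leading 2 is that of [expi_lip]; the rest bounds the phase on the unit ball, per unit of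
    height. *)
Definition diff_const : R := 2 * (pi / 4 * (m.+1 * d)%:R).

Lemma diff_const_ge0 : 0 <= diff_const.
Proof. by rewrite !mulr_ge0 ?pi_ge0 ?invr_ge0. Qed.

(** By the binomial theorem the N-th difference of t -> e^(-i t phi) is e^(-i t phi) (1 - e^(-i h
    phi))^N, and |phi| is at most a multiple of the height on the support of sigma. Each order of
    difference thus gains a factor h * height. *)
Lemma symbol_diff n N t h (K : freqs m d n) : 0 <= h ->
  cmod (\sum_(k < N.+1) (-1) ^+ k * 'C(N, k)%:R * symbol (t + k%:R * h) K) <=
  2 * sm * (diff_const * h * (height K).+1%:R) ^+ N.
Proof.
move=> h0.
have dh0 : 0 <= diff_const * h * (height K).+1%:R.
  by apply: mulr_ge0 => //; apply: mulr_ge0 => //; exact: diff_const_ge0.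
have -> : \sum_(k < N.+1) (-1) ^+ k * 'C(N, k)%:R * symbol (t + k%:R * h) K =
  Cint sigma (fun y => expi (- (t * (pi / 4 * mdot (y : 'M[R]_(m.+1, d)) (freqmx K)))) *
     (1 - expi (- (h * (pi / 4 * mdot (y : 'M[R]_(m.+1, d)) (freqmx K))))) ^+ N).
  under eq_bigr do rewrite -CintZ//.
  rewrite -Cint_sum//; last first.
    by move=> k; apply: cbounded_measM => //; exact: cbounded_meas_cst.
  congr Cint; apply/funext => y; rewrite exprBn [RHS]mulr_sumr; apply: eq_bigr => k _.
  rewrite expr1n mulr1 -mulr_natr -expiMn mulrDl opprD expiD.
  set a := expi (- (t * _)).
  rewrite (_ : expi (- (k%:R * h * _)) = expi (- (h * (pi / 4 * mdot y (freqmx K))) * k%:R)); last by congr expi; ring.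
  by ring.
apply: le_trans (Cint_bound fin_sigma supp_sigma (e := (diff_const * h * (height K).+1%:R) ^+ N) _ _ _) _.
- apply: cbounded_measM => //.
  rewrite (_ : (fun y => _) = (fun y : T => \prod_(k < N)
    (1 + (- 1) * expi (- (h * (pi / 4 * mdot (y : 'M[R]_(m.+1, d)) (freqmx K))))))).
    apply: cbounded_meas_prod => k; apply: cbounded_measD; first exact: cbounded_meas_cst.
    by apply: cbounded_measM => //; exact: cbounded_meas_cst.
  by apply/funext => y; rewrite prodr_const card_ord mulN1r.
- exact: exprn_ge0.
- move=> y hy; rewrite cmodM cmod_expi mul1r.
  have -> z k : cmod (z ^+ k) = cmod z ^+ k :> R.
    by elim: k => [|k IH]; rewrite ?expr0 ?cmod1// !exprS cmodM IH.
  rewrite lerXn2r ?nnegrE ?cmod_ge0//.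
  have := expi_lip 0 (- (h * (pi / 4 * mdot y (freqmx K)))).
  rewrite expi0 => hl; apply: le_trans hl _.
  rewrite sub0r opprK /diff_const.
  apply: le_trans (ler_wpM2l _ (phase_le h K hy)) _ => //; rewrite ger0_norm//.
  have : (height K)%:R <= (height K).+1%:R :> R by rewrite ler_nat.
  have : 0 <= h * (pi / 4) * (m.+1 * d)%:R :> R by rewrite !mulr_ge0 ?pi_ge0 ?invr_ge0.
  set u := h * _ * _ => u0 hh; have := ler_wpM2l u0 hh; rewrite /u; nra.
by rewrite [2 * _ * sm]mulrAC.
Qed.

(** Grows with the height, which is harmless: it only serves to pass from grid times to all times,
    and the time grid is chosen after the degree. *)
Lemma symbol_lip n t t' (K : freqs m d n) :
  cmod (symbol t K - symbol t' K) <=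
  2 * sm * (diff_const * (height K)%:R) * `|t - t'|.
Proof.
have -> : symbol t K - symbol t' K = Cint sigma (fun y : T =>
   expi (- (t * (pi / 4 * mdot (y : 'M[R]_(m.+1, d)) (freqmx K)))) +
   (-1) * expi (- (t' * (pi / 4 * mdot (y : 'M[R]_(m.+1, d)) (freqmx K))))).
  have h2 (k : bool) : cbounded_meas (fun y : T => (if k then 1 else -1) *
      expi (- ((if k then t else t') * (pi / 4 * mdot (y : 'M[R]_(m.+1, d)) (freqmx K))))).
    by apply: cbounded_measM; [exact: cbounded_meas_cst|case: k].
  have := Cint_sum fin_sigma [:: true; false] xpredT h2.
  rewrite !big_cons big_nil addr0 CintZ ?mul1r// CintZ// mulN1r => <-.
  by congr Cint; apply/funext => y; rewrite !big_cons big_nil mul1r addr0.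
apply: le_trans (Cint_bound fin_sigma supp_sigma (e := diff_const * (height K)%:R * `|t - t'|) _ _ _) _.
- apply: cbounded_measD => //; apply: cbounded_measM => //; exact: cbounded_meas_cst.
- by apply: mulr_ge0 => //; apply: mulr_ge0 => //; exact: diff_const_ge0.
- move=> y hy; rewrite mulN1r; apply: le_trans (expi_lip _ _) _.
  rewrite (_ : - (t * _) - - (t' * _) = (t' - t) * (pi / 4 * mdot y (freqmx K))); last by ring.
  rewrite [`|t - t'|]distrC.
  rewrite /diff_const.
  apply: le_trans (ler_wpM2l _ (phase_le _ K hy)) _ => //.
  by rewrite le_eqVlt; apply/orP; left; apply/eqP; ring.
by rewrite le_eqVlt; apply/orP; left; apply/eqP; rewrite -/sm; ring.
Qed.

Section Decay.
Variables (A s : R).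
Hypothesis s0 : 0 < s.
Hypothesis ft_decay : forall xi : 'M[R]_(m.+1, d),
  ft_abs sigma xi <= A * (1 + enorm xi) `^ (- s).

Definition decay_ratio (q : nat) : R := ((2 ^+ q) `^ (- s)) ^+ 2.

(** For t >= 1 the quantity 1 + |t K / 8| is at least (height + 1) / 8, whence 8^s. The absolute
    value of [A] is there because its sign is not known. *)
Lemma symbol_decay n q t (K : freqs m d n) : (0 < q)%N -> 1 <= t ->
  cmod (symbol t K) ^+ 2 <= (`|A| * 8 `^ s) ^+ 2 * decay_ratio q ^+ level q K.
Proof.
move=> q0 t1; rewrite -exprM mulnC exprM -exprMn.
have w0 : 0 <= (`|A| * 8 `^ s * ((2 ^+ q) `^ (- s)) ^+ level q K).
  by rewrite !mulr_ge0 ?powR_ge0 ?exprn_ge0 ?powR_ge0.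
rewrite lerXn2r ?nnegrE ?cmod_ge0//.
rewrite symbol_ft; apply: le_trans (ft_decay _) _.
apply: (@le_trans _ _ (`|A| * (1 + enorm ((t / 8) *: freqmx K)) `^ (- s))).
  by rewrite ler_wpM2r ?powR_ge0// ler_norm.
rewrite -mulrA ler_wpM2l//.
have t0 : 0 <= t / 8 by rewrite divr_ge0// (le_trans ler01).
have en : enorm ((t / 8) *: freqmx K) = t / 8 * enorm (freqmx K).
  rewrite /enorm -[in RHS](ger0_norm t0) -sqrtr_sqr -sqrtrM ?sqr_ge0//.
  congr Num.sqrt; rewrite mulr_sumr; apply: eq_bigr => i _.
  by rewrite mulr_sumr; apply: eq_bigr => j _; rewrite mxE exprMn.
have hL : (2 ^+ q) ^+ level q K / 8 <= 1 + enorm ((t / 8) *: freqmx K).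
  have h1 : ((2 ^+ q) ^+ level q K : R) <= (height K).+1%:R.
    rewrite -!natrX ler_nat.
    have := @trunc_log_bounds (2 ^ q) (height K).+1.
    by rewrite -{1}(expn0 2) ltn_exp2l// => /(_ q0 isT) /andP[].
  have h2 := height_le_freqmx K.
  have e0 : 0 <= enorm (freqmx K) by exact: sqrtr_ge0.
  rewrite en -natr1 in h1 *; nra.
have -> : 8 `^ s * ((2 ^+ q) `^ (- s)) ^+ level q K = ((2 ^+ q) ^+ level q K / 8) `^ (- s) :> R.
  rewrite powRM ?invr_ge0 ?exprn_ge0 ?exprn_ge0//.
  rewrite -powR_inv1// -powRrM mulN1r opprK mulrC; congr (_ * _).
  by rewrite exprn_powR// exprn_ge0.
have D0 : 0 < (2 ^+ q) ^+ level q K / 8 :> R by rewrite divr_gt0// !exprn_gt0.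
rewrite !powRN lef_pV2 ?posrE ?powR_gt0//; last exact: lt_le_trans hL.
apply: ge0_ler_powR => //; first exact: ltW.
  by rewrite nnegrE ltW.
by rewrite nnegrE (le_trans _ hL)// ltW.
Qed.

Hypothesis s_big : m%:R * d%:R / 2 + 2^-1 < s.

(** The left side is 2 to the power 2 - q (2 s - 1 - m d), and the hypothesis on s makes the bracket
    positive; any q > 2 / (2 s - 1 - m d) will do. *)
Lemma exists_block_size : exists2 q : nat, (0 < q)%N &
  2 ^+ q.+2 * (2 ^+ q) ^+ (m * d) * decay_ratio q < 1.
Proof.
pose gam := 2 * s - 1 - m%:R * d%:R.
have gam0 : 0 < gam by rewrite /gam; move: s_big; lra.
have [q q0 hq] : exists2 q : nat, (0 < q)%N & 2 < q%:R * gam.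
  by exists (Num.truncn (2 / gam)).+1 => //; rewrite -ltr_pdivrMr// truncnS_gt.
exists q => //.
have two_pow x k : (2 `^ x) ^+ k = 2 `^ (x * k%:R) :> R.
  by rewrite exprn_powR// -powR_mulrn// -powRrM mulrC.
have p2 k : (2 : R) ^+ k = 2 `^ k%:R by rewrite powR_mulrn.
rewrite /decay_ratio !p2 -powRrM !two_pow.
rewrite -!powRD ?pnatr_eq0 ?implybT//.
set e := (X in 2 `^ X).
have e0 : e < 0.
  have -> : e = 2 - q%:R * gam by rewrite /e -natr1 -natr1 natrM /gam; ring.
  by rewrite subr_lt0.
rewrite /powR pnatr_eq0 /= expR_lt1.
by rewrite nmulr_rlt0// ln_gt0// ltr1n.
Qed.

Lemma symbol_estimate : exists2 C0 : R, 0 <= C0 & symbol_bound C0.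
Proof.
have [q q0 k1] := exists_block_size.
(* Chosen so that 4^N beats the growth 2 * D^(m.+1 * d) of a whole block. *)
pose N := (q * (m.+1 * d)).+1.
have k2 : 2 * (2 ^+ q) ^+ (m.+1 * d) / 4 ^+ N < 1 :> R.
  rewrite ltr_pdivrMr ?exprn_gt0// mul1r.
  rewrite -exprM /N exprS.
  apply: (@lt_le_trans _ _ (4 * 2 ^+ (q * (m.+1 * d)))).
    by rewrite ltr_pM2r ?exprn_gt0// ltr_nat.
  by rewrite ler_wpM2l// lerXn2r ?nnegrE// ler_nat.
have r0 : 0 <= decay_ratio q by rewrite sqr_ge0.
exists (core_const m d q N ((`|A| * 8 `^ s) ^+ 2) (2 * sm) diff_const (decay_ratio q)).
  by apply: core_const_ge0; rewrite ?sqr_ge0.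
move=> n M c hM; exists (q.+1 * nlevels m d n q + N)%N => g hg.
apply: (@core_estimate _ _ _ _ q N M g c (fun l K => symbol (1 + l%:R / 2 ^+ g) K)
   ((`|A| * 8 `^ s) ^+ 2) (2 * sm) diff_const (decay_ratio q)) => //.
- by rewrite mulr_ge0.
- exact: diff_const_ge0.
- by move=> l K _; apply: symbol_decay => //; rewrite lerDl divr_ge0// exprn_ge0.
- move=> l r K; have h0 : 0 <= r%:R / 2 ^+ g :> R by rewrite divr_ge0// exprn_ge0.
  have := symbol_diff N (1 + l%:R / 2 ^+ g) K h0.
  under eq_bigr do rewrite -addrA mulrA -mulrDl -natrM -natrD.
  exact.
Qed.

End Decay.
End Symbol.

(** * Trigonometric approximation on a lattice *)

(** Gives the ratio of the normalizing constants of [kern] in degrees n and n.+1. *)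
Lemma bin_central (n : nat) :
  (n.+1 * 'C(n.+1.*2, n.+1) = (n.*2.+1).*2 * 'C(n.*2, n))%N.
Proof.
have h1 := mul_bin_diag n.*2.+2 n.
have h2 := mul_bin_down n.*2.+1 n.
rewrite doubleS -h1 /= -[n.*2.+2]doubleS -muln2 mulnAC.
have -> : (n.+1 = n.*2.+1 - n)%N by rewrite -addnn -addSn addnK.
by rewrite -h2 /= muln2 -!muln2 mulnAC.
Qed.


(** Hence [kcoef] is at most 1: smoothing by [kern] never increases a Fourier coefficient. *)
Lemma leq_bin_central (n r : nat) : ('C(n.*2, r) <= 'C(n.*2, n))%N.
Proof.
suff H k : (k <= n)%N -> ('C(n.*2, n - k) <= 'C(n.*2, n))%N.
  case: (leqP r n) => h.
    by rewrite -(subKn h) H// leq_subr.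
  case: (leqP r n.*2) => h2; last by rewrite bin_small.
  rewrite -bin_sub// (_ : n.*2 - r = n - (r - n))%N; last by rewrite -addnn; lia.
  by rewrite H// leq_subLR addnn.
elim: k => [|k IH] kn; first by rewrite subn0.
apply: leq_trans (IH (ltnW kn)).
have := mul_bin_left n.*2 (n - k.+1).
rewrite -subSn// subSS => h.
have n0 : (0 < n - k)%N by rewrite subn_gt0.
rewrite -(leq_pmul2l n0) h leq_mul2r; apply/orP; right.
by rewrite -addnn; lia.
Qed.

Section Kernel.
Variables (R : realType) (M : nat).
Hypothesis M0 : (0 < M)%N.

(* Positive, and of mass one on every translate of the lattice (8 / M) Z modulo 8;
   as a function of period 8 it concentrates at 0 as n grows. *)
Definition kern (n : nat) (x : R) : R :=
  4 ^+ n / (M%:R * ('C(n.*2, n))%:R) * cos (pi / 8 * x) ^+ n.*2.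

(** The Fourier coefficients of M * [kern]; the index r stands for the frequency r - n, and the
    coefficient at frequency 0 is 1. *)
Definition kcoef (n r : nat) : R := ('C(n.*2, r))%:R / ('C(n.*2, n))%:R.

Lemma bin_central_neq0 n : ('C(n.*2, n))%:R != 0 :> R.
Proof. by rewrite pnatr_eq0 -lt0n bin_gt0 -addnn leq_addr. Qed.

Lemma kern_ge0 n x : 0 <= kern n x.
Proof.
apply: mulr_ge0; first by rewrite divr_ge0 ?exprn_ge0 ?mulr_ge0.
by rewrite -muln2 exprM sqr_ge0.
Qed.

Lemma kcoef01 n r : 0 <= kcoef n r <= 1.
Proof.
rewrite divr_ge0//= ler_pdivrMr ?mul1r ?ler_nat ?leq_bin_central//.
by rewrite lt0r bin_central_neq0 ler0n.
Qed.

(** Binomial expansion of ((e^(i a) + e^(-i a)) / 2)^(2n) with a = pi x / 8. Only even multiples of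
    a occur, so the period is 8 and not 16. *)
Lemma kernE n x : ((kern n x)%:C)%C =
  M%:R^-1 * \sum_(r < n.*2.+1) ((kcoef n r)%:C)%C * expi (pi / 4 * (r%:R - n%:R) * x) :> R[i].
Proof.
have cosE t : ((cos t)%:C)%C = (expi t + expi (- t)) / 2 :> R[i].
  rewrite expiN (_ : 2 = ((2 : R)%:C)%C); last by rewrite rmorph_nat.
  rewrite -fmorphV; apply/eqP; rewrite eq_complex /=; apply/andP; split; apply/eqP; by field.
have MC : (M%:R : R[i]) != 0 by rewrite pnatr_eq0 -lt0n.
have BC : (('C(n.*2, n))%:R : R[i]) != 0.
  by rewrite pnatr_eq0 -lt0n bin_gt0 -addnn leq_addr.
transitivity ((4 ^+ n / (M%:R * ('C(n.*2, n))%:R)) * (((cos (pi / 8 * x))%:C)%C) ^+ n.*2 : R[i]).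
  by rewrite /kern !rmorphM fmorphV rmorphM !rmorphXn !rmorph_nat.
rewrite cosE expr_div_n [expi _ + _]addrC (exprDn (expi _)).
have -> : (2 : R[i]) ^+ n.*2 = 4 ^+ n by rewrite -mul2n exprM -natrX.
rewrite (_ : \sum_(i < (n.*2).+1) expi (- (pi / 8 * x)) ^+ (n.*2 - i) * expi (pi / 8 * x) ^+ i *+ 'C(n.*2, i) =
   ('C(n.*2, n))%:R * \sum_(r < n.*2.+1) ((kcoef n r)%:C)%C * expi (pi / 4 * (r%:R - n%:R) * x)).
  have F : (4 : R[i]) ^+ n != 0 by rewrite expf_neq0// pnatr_eq0.
  by field; rewrite ?MC ?BC ?F.
rewrite mulr_sumr; apply: eq_bigr => r _.
have rn : (r <= n.*2)%N by rewrite -ltnS.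
rewrite /kcoef rmorphM fmorphV !rmorph_nat /= -!expiMn -expiD.
rewrite mulrA mulrCA mulfV// mulr1 -mulr_natl; congr (_ * expi _).
by rewrite natrB// (_ : n.*2%:R = n%:R + n%:R :> R); [field | rewrite -natrD addnn].
Qed.

(** For 2 n < M, summing over the lattice kills every frequency except r = n. *)
Lemma kern_sum n x : (n.*2 < M)%N -> \sum_(u < M) kern n (x - 8 / M%:R * u%:R) = 1.
Proof.
move=> nM; apply: (@complexI R); rewrite rmorph_sum /=.
under eq_bigr do rewrite kernE.
rewrite -mulr_sumr exchange_big /=.
have MC : (M%:R : R[i]) != 0 by rewrite pnatr_eq0 -lt0n.
have MR : (M%:R : R) != 0 by rewrite pnatr_eq0 -lt0n.
rewrite (eq_bigr (fun r : 'I_(n.*2).+1 => ((kcoef n r)%:C)%C * expi (pi / 4 * (r%:R - n%:R) * x) *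
    (M * (n == r))%:R)); last first.
  move=> r _; rewrite -(@root1_orth R M M0)//; last 2 first.
  - by apply: leq_ltn_trans nM; rewrite -addnn leq_addr.
  - by apply: leq_trans nM.
  rewrite mulr_sumr; apply: eq_bigr => u _.
  rewrite /root1 -!expiMn -expiN -expiD -[RHS]mulrA -expiD; congr (_ * expi _).
  by rewrite !natrM; field.
have hn : (n < n.*2.+1)%N by rewrite ltnS -addnn leq_addr.
rewrite (bigD1 (Ordinal hn))//= eqxx muln1 big1 ?addr0.
  rewrite subrr mulr0 mul0r expi0 mulr1 /kcoef divff ?bin_central_neq0// mul1r.
  by rewrite mulVf.
move=> r hr; suff -> : (n == r) = false by rewrite muln0 mulr0.
by apply: contraNF hr => /eqP e; apply/eqP/val_inj.
Qed.

(** By sin^2 = 1 - cos^2, the product of [kern n] and sin^2 is kern n - (2n+1)/(2n+2) * kern n.+1,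
    and both kernels have mass one. This second moment measures the concentration. *)
Lemma kern_sin2_sum n x : ((n.+1).*2 < M)%N ->
  \sum_(u < M) kern n (x - 8 / M%:R * u%:R) * sin (pi / 8 * (x - 8 / M%:R * u%:R)) ^+ 2 =
  (n.+1.*2)%:R^-1.
Proof.
move=> nM.
have nM' : (n.*2 < M)%N by apply: leq_trans nM; rewrite ltnS leq_double.
have MR : (M%:R : R) != 0 by rewrite pnatr_eq0 -lt0n.
have E y : kern n y * sin (pi / 8 * y) ^+ 2 = kern n y - n.*2.+1%:R / (n.+1.*2)%:R * kern n.+1 y.
  have hb := bin_central n.
  rewrite sin2cos2 mulrBr mulr1; congr (_ - _).
  have c2 : cos (pi / 8 * y) ^+ n.+1.*2 = cos (pi / 8 * y) ^+ n.*2 * cos (pi / 8 * y) ^+ 2.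
    by rewrite -exprD -addn2 -[(n.*2 + 2)%N]/(n.*2 + 1.*2)%N -doubleD addn1.
  rewrite /kern c2 (exprS 4).
  have b0 := bin_central_neq0 n; have b1 := bin_central_neq0 n.+1.
  have n1 : (n.+1.*2%:R : R) != 0 by rewrite pnatr_eq0.
  have eb : (n.+1.*2)%:R * ('C(n.+1.*2, n.+1))%:R = 4 * n.*2.+1%:R * ('C(n.*2, n))%:R :> R.
    rewrite -!natrM; congr (_%:R).
    by rewrite -doubleMl hb -!mul2n !mulnA.
  have -> : n.*2.+1%:R / n.+1.*2%:R * (4 * 4 ^+ n / (M%:R * 'C(n.+1.*2, n.+1)%:R) *
      (cos (pi / 8 * y) ^+ n.*2 * cos (pi / 8 * y) ^+ 2)) =
     4 ^+ n / M%:R * (4 * n.*2.+1%:R / (n.+1.*2%:R * 'C(n.+1.*2, n.+1)%:R)) *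
      (cos (pi / 8 * y) ^+ n.*2 * cos (pi / 8 * y) ^+ 2) :> R.
    by field; rewrite b1 MR n1.
  by rewrite eb; field; rewrite b0 MR nat1r pnatr_eq0.
under eq_bigr do rewrite E.
rewrite big_split /= kern_sum// sumrN -mulr_sumr kern_sum// mulr1.
rewrite doubleS -[n.*2.+2%:R]natr1.
have h : n.*2.+1%:R + 1 != 0 :> R by rewrite natr1 pnatr_eq0.
apply: (mulIf h); rewrite mulVf// mulrBl divfK// mul1r; ring.
Qed.
End Kernel.

Section SinLower.
Variable R : realType.

Lemma mul_cos_le_sin (x : R) : 0 <= x <= pi / 2 -> x * cos x <= sin x.
Proof.
move=> /andP[x0 xp]; move: x0; rewrite le_eqVlt => /orP[/eqP <-|x0].
  by rewrite mul0r sin0.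
have ds (z : R) : is_derive z 1 sin (cos z) by exact: is_derive_sin.
have dx (z : R) : derivable sin z 1 by exact: derivable_sin.
have [c] := MVT x0 (fun z _ => ds z) (derivable_within_continuous (fun z _ => dx z)).
rewrite in_itv /= => /andP[c0 cx]; rewrite sin0 !subr0 mulrC => ->.
have pi0 := pi_gt0 R.
rewrite ler_wpM2l ?ltW//.
by rewrite ltr_cos ?in_itv//=; apply/andP; split; lra.
Qed.

(** For |r| <= 7 the half angle x = pi |r| / 16 is at most 7 pi / 16 < pi / 2, so sin (2 x) = 2 sin
    x cos x >= 2 x cos^2 x stays comparable with |r|. *)
Definition sin_const : R := 8 / (pi * cos (pi * 7 / 16) ^+ 2).

Lemma sin_const_gt0 : 0 < sin_const.
Proof.
have pi0 := pi_gt0 R.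
rewrite divr_gt0// mulr_gt0// exprn_gt0// cos_gt0_pihalf//.
by apply/andP; split; lra.
Qed.

Lemma le_sin_const (r : R) : `|r| <= 7 -> `|r| <= sin_const * `|sin (pi / 8 * r)|.
Proof.
move=> hr; have pi0 := pi_gt0 R.
have -> : `|sin (pi / 8 * r)| = `|sin (pi / 8 * `|r|)|.
  by case: (ger0P r) => // _; rewrite mulrN sinN normrN.
have := normr_ge0 r; move: `|r| hr => {r} r r7 r0.
have c0 : 0 < cos (pi * 7 / 16) :> R by apply: cos_gt0_pihalf; apply/andP; split; lra.
have a1 : 0 <= pi / 16 * r <= pi / 2.
  apply/andP; split; first by rewrite mulr_ge0// divr_ge0// ltW.
  by nra.
have h1 := mul_cos_le_sin a1.
have hc : cos (pi * 7 / 16) <= cos (pi / 16 * r).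
  by rewrite leNgt ltr_cos ?in_itv/= -?leNgt; [nra|apply/andP; split; nra..].
have a0 : 0 <= pi / 16 * r by case/andP: a1.
have e : pi / 8 * r = (pi / 16 * r) *+ 2 by rewrite -mulr_natr; field.
rewrite e sin_mulr2n.
have s0 : 0 <= sin (pi / 16 * r) by apply: le_trans h1; rewrite mulr_ge0//; lra.
rewrite ger0_norm; last by rewrite mulrn_wge0// mulr_ge0//; lra.
rewrite /sin_const mulrAC ler_pdivlMr ?mulr_gt0// ?exprn_gt0//.
set x := pi / 16 * r in e h1 hc a0 s0 *; set k := cos (pi * 7 / 16) in c0 hc *.
have -> : r * (pi * k ^+ 2) = 16 * (x * k ^+ 2) by rewrite /x; field.
have : x * k ^+ 2 <= cos x * sin x.
  apply: (@le_trans _ _ (cos x * (x * cos x))); last by rewrite ler_wpM2l//; lra.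
  rewrite expr2; have : k * k <= cos x * cos x by rewrite ler_pM//; lra.
  by move=> h; have := ler_wpM2l a0 h; lra.
by rewrite -mulr_natl; lra.
Qed.

End SinLower.

Section TrigApprox.
Variables (R : realType) (d M : nat).
Hypothesis M0 : (0 < M)%N.
Variable x0 : 'I_d -> R.
Local Notation C := R[i].
Local Notation lat := {ffun 'I_d -> 'I_M}.

Definition latpt (u : lat) : 'rV[R]_d := \row_j (x0 j + 8 / M%:R * (u j)%:R).

Let MR : (M%:R : R) != 0. Proof. by rewrite pnatr_eq0 -lt0n. Qed.

(** Centring the frequencies at s costs a unimodular factor that depends on [u] but not on [e]; it
    comes out of any sum over frequencies and vanishes in the modulus. *)
Lemma wave_lat B (e : {ffun 'I_d -> 'I_B}) (s : nat) (u : lat) :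
  expi (pi / 4 * \sum_j ((e j)%:R - s%:R) * latpt u 0 j) =
  expi (pi / 4 * \sum_j ((e j)%:R - s%:R) * x0 j) *
  expi (- (2 * pi / M%:R * \sum_j s%:R * (u j)%:R)) * lat_char R e u.
Proof.
have -> : lat_char R e u = expi (\sum_j 2 * pi / M%:R * ((e j * u j)%N)%:R).
  by rewrite expi_sum /lat_char; apply: eq_bigr => j _; rewrite expiMn.
rewrite -!expiD; congr expi; rewrite !mulr_sumr -sumrN -!big_split /=.
by apply: eq_bigr => j _; rewrite mxE natrM; field.
Qed.

Variable n : nat.

Definition phase (k : {ffun 'I_d -> 'I_n.*2.+1}) (x : 'rV[R]_d) : R :=
  pi / 4 * \sum_j ((k j)%:R - n%:R) * x 0 j.

Variable f : 'rV[R]_d -> C.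

(** Discrete Fourier coefficients of the samples of f, damped by [kcoef]. Thus [trigp] is the
    convolution of the samples with the product kernel, as [trigpE] shows. *)
Definition trigc (k : {ffun 'I_d -> 'I_n.*2.+1}) : C :=
  ((\prod_j kcoef R n (k j))%:C)%C *
  (((M ^ d)%:R)^-1 * \sum_u f (latpt u) * expi (- phase k (latpt u))).

Definition trigp (x : 'rV[R]_d) : C := \sum_k trigc k * expi (phase k x).

Definition kernd (x : 'rV[R]_d) (u : lat) : R := \prod_j kern M n (x 0 j - latpt u 0 j).

Lemma kernd_ge0 x u : 0 <= kernd x u.
Proof. by apply: prodr_ge0 => j _; exact: kern_ge0. Qed.

Lemma trigpE x : trigp x = \sum_u f (latpt u) * ((kernd x u)%:C)%C.
Proof.
rewrite /trigp /trigc.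
under eq_bigr do rewrite mulrA mulr_sumr mulr_suml.
rewrite exchange_big /=; apply: eq_bigr => u _.
have -> : ((kernd x u)%:C)%C = ((M ^ d)%:R)^-1 *
   \sum_(k : {ffun 'I_d -> 'I_n.*2.+1}) ((\prod_j kcoef R n (k j))%:C)%C *
     (expi (- phase k (latpt u)) * expi (phase k x)).
  rewrite /kernd rmorph_prod /=.
  under eq_bigr do rewrite (kernE M0).
  rewrite big_split /= prodr_const card_ord natrX exprVn; congr (_ * _).
  rewrite bigA_distr_bigA /=; apply: eq_bigr => k _.
  rewrite big_split /= rmorph_prod; congr (_ * _).
  rewrite -expi_sum -expiD; congr expi.
  rewrite /phase !mulr_sumr -sumrN -big_split /=; apply: eq_bigr => j _; ring.
rewrite mulrCA mulr_sumr mulr_sumr; apply: eq_bigr => k _; ring.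
Qed.

Lemma kernd_sum x : (n.*2 < M)%N -> \sum_u kernd x u = 1.
Proof.
move=> nM; rewrite /kernd.
rewrite (eq_bigr (fun u : lat => \prod_j kern M n ((x 0 j - x0 j) - 8 / M%:R * (u j)%:R))); last first.
  by move=> u _; apply: eq_bigr => j _; rewrite mxE opprD addrA.
rewrite -(bigA_distr_bigA (fun j (r : 'I_M) => kern M n ((x 0 j - x0 j) - 8 / M%:R * r%:R))).
by rewrite big1// => j _; rewrite kern_sum.
Qed.

Lemma kernd_sin2_sum x j : ((n.+1).*2 < M)%N ->
  \sum_u kernd x u * sin (pi / 8 * (x 0 j - latpt u 0 j)) ^+ 2 = (n.+1.*2)%:R^-1.
Proof.
move=> nM; rewrite /kernd.
have nM' : (n.*2 < M)%N by apply: leq_trans nM; rewrite ltnS leq_double.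
pose F (i : 'I_d) (r : 'I_M) := kern M n ((x 0 i - x0 i) - 8 / M%:R * r%:R) *
  (if i == j then sin (pi / 8 * ((x 0 i - x0 i) - 8 / M%:R * r%:R)) ^+ 2 else 1).
rewrite (eq_bigr (fun u : lat => \prod_i F i (u i))); last first.
  move=> u _; rewrite (bigD1 j)//= [RHS](bigD1 j)//= /F eqxx mulrAC !mxE opprD addrA.
  congr (_ * _); apply: eq_bigr => i ij.
  by rewrite (negPf ij) mulr1 !mxE opprD addrA.
rewrite -bigA_distr_bigA (bigD1 j)//= {1}/F eqxx kern_sin2_sum// big1 ?mulr1// => i ij.
by rewrite /F (negPf ij); under eq_bigr do rewrite mulr1; rewrite kern_sum.
Qed.

(** Korovkin's argument: positivity and mass one reduce the error to a mean of |x_j - u_j|; this is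
    at most a constant times |sin (pi (x_j - u_j) / 8)|, and |sin| <= eta + sin^2 / eta brings in
    the second moment of the kernel. *)
Lemma trigp_approx (L eta : R) (x : 'rV[R]_d) : ((n.+1).*2 < M)%N -> 0 <= L -> 0 < eta ->
  (forall x x' : 'rV[R]_d, cmod (f x - f x') <= L * \sum_j `|x 0 j - x' 0 j|) ->
  (forall j, `|x 0 j - (x0 j + 4)| <= 3) ->
  cmod (trigp x - f x) <=
  L * sin_const R * d%:R * (eta + (n.+1.*2)%:R^-1 / eta).
Proof.
move=> nM L0 eta0 lipf hx.
have nM' : (n.*2 < M)%N by apply: leq_trans nM; rewrite ltnS leq_double.
have -> : trigp x - f x = \sum_u (f (latpt u) - f x) * ((kernd x u)%:C)%C.
  under eq_bigr do rewrite mulrBl.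
  by rewrite trigpE sumrB -mulr_sumr -rmorph_sum /= kernd_sum// mulr1.
apply: le_trans (cmod_sum _ _ _) _.
pose c := sin_const R.
have c0 : 0 < c := sin_const_gt0 R.
apply: (@le_trans _ _ (\sum_u \sum_j L * c * (eta * kernd x u + eta^-1 *
   (kernd x u * sin (pi / 8 * (x 0 j - latpt u 0 j)) ^+ 2)))).
  apply: ler_sum => u _; rewrite cmodM cmod_real (ger0_norm (kernd_ge0 _ _)).
  apply: le_trans (ler_wpM2r (kernd_ge0 x u) (lipf _ _)) _.
  rewrite mulr_sumr mulr_suml; apply: ler_sum => j _.
  rewrite -[leLHS]mulrA -[leRHS]mulrA ler_wpM2l//.
  (* 3 from x to the centre of the cube of side 8, 4 from the centre to a lattice point. *)
  have h7 : `|x 0 j - latpt u 0 j| <= 7.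
    rewrite !mxE; have := hx j.
    pose r : R := 8 / M%:R * (u j)%:R.
    have r0 : 0 <= r by rewrite mulr_ge0 ?divr_ge0.
    have r8 : r <= 8.
      by rewrite /r mulrAC ler_pdivrMr ?ltr0n// ler_wpM2l// ler_nat ltnW.
    rewrite -/r.
    rewrite !ler_norml => /andP[h1 h2]; apply/andP; split; lra.
  have h := le_sin_const h7; rewrite distrC.
  set sj := sin _ in h *; set K := kernd x u.
  have K0 : 0 <= K := kernd_ge0 x u.
  have hs : `|sj| <= eta + eta^-1 * sj ^+ 2.
    rewrite -(ler_pM2l eta0) mulrDr mulrA divff ?gt_eqF// mul1r.
    rewrite -[sj ^+ 2]real_normK ?num_real//.
    have := normr_ge0 sj; have := sqr_ge0 (eta - `|sj|); nra.
  have : `|x 0 j - latpt u 0 j| <= c * (eta + eta^-1 * sj ^+ 2).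
    by apply: le_trans h _; rewrite ler_wpM2l// ltW.
  move=> hh; apply: le_trans (ler_wpM2r K0 hh) _.
  by rewrite le_eqVlt; apply/orP; left; apply/eqP; ring.
rewrite exchange_big /=.
have -> : L * c * d%:R * (eta + n.+1.*2%:R^-1 / eta) =
  \sum_(j < d) L * c * (eta + n.+1.*2%:R^-1 / eta).
  by rewrite sumr_const card_ord -mulr_natr; ring.
apply: ler_sum => j _; rewrite -mulr_sumr big_split /= -mulr_sumr -[X in eta * _ + X]mulr_sumr.
by rewrite kernd_sum// kernd_sin2_sum// mulr1 [eta^-1 * _]mulrC.
Qed.

(** Bessel's inequality by duality. Without damping, the partial sum F satisfies |F|^2 = <f, F> on
    the lattice, by Parseval, and Cauchy-Schwarz bounds this by |f| |F|. *)
Lemma trigc_l2 : (n.*2 < M)%N ->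
  \sum_k cmod (trigc k) ^+ 2 <= ((M ^ d)%:R)^-1 * \sum_u cmod (f (latpt u)) ^+ 2.
Proof.
move=> nM.
have Md0 : 0 < (M ^ d)%:R :> R by rewrite ltr0n expn_gt0 M0.
pose c k : C := ((M ^ d)%:R)^-1 * \sum_u f (latpt u) * expi (- phase k (latpt u)).
have hc k : cmod (trigc k) ^+ 2 <= cmod (c k) ^+ 2.
  rewrite ler_pXn2r ?nnegrE ?cmod_ge0// /trigc cmodM cmod_real ger0_norm.
    rewrite ler_piMl ?cmod_ge0//; apply: prodr_ile1 => j _; exact: kcoef01.
  by apply: prodr_ge0 => j _; have /andP[] := kcoef01 R n (k j).
apply: le_trans (ler_sum _ (fun k _ => hc k)) _.
pose F u := \sum_k c k * expi (phase k (latpt u)).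
have pF : \sum_u cmod (F u) ^+ 2 = (M ^ d)%:R * \sum_k cmod (c k) ^+ 2.
  pose ph (k : {ffun 'I_d -> 'I_n.*2.+1}) := expi (pi / 4 * \sum_j ((k j)%:R - n%:R) * x0 j) : C.
  have := @parseval R d M M0 n.*2.+1 (fun k => c k * ph k) nM.
  have -> : \sum_k cmod (c k * ph k) ^+ 2 = \sum_k cmod (c k) ^+ 2.
    by apply: eq_bigr => k _; rewrite cmodM cmod_expi mulr1.
  move=> <-; apply: eq_bigr => u _.
  have -> : F u = expi (- (2 * pi / M%:R * \sum_j n%:R * (u j)%:R)) *
       \sum_k c k * ph k * lat_char R k u.
    rewrite /F mulr_sumr; apply: eq_bigr => k _.
    rewrite /phase wave_lat -/(ph k); ring.
  by rewrite cmodM cmod_expi mul1r.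
set Q := \sum_k cmod (c k) ^+ 2 in pF *.
have Q0 : 0 <= Q by apply: sumr_ge0 => k _; exact: sqr_ge0.
set S := \sum_u cmod (f (latpt u)) ^+ 2.
have E : ((((M ^ d)%:R * Q)%:C)%C : C) = \sum_u f (latpt u) * ((F u)^*)%C.
  have cE k : \sum_u f (latpt u) * expi (- phase k (latpt u)) = (M ^ d)%:R * c k.
    by rewrite /c mulrA divff ?mul1r// pnatr_eq0 -lt0n expn_gt0 M0.
  rewrite /F; under [RHS]eq_bigr do rewrite rmorph_sum mulr_sumr.
  have QE : (Q%:C)%C = \sum_k c k * ((c k)^*)%C :> C.
    by rewrite rmorph_sum; apply: eq_bigr => k _; rewrite mulJc.
  rewrite exchange_big (_ : (((M ^ d)%:R * Q)%:C)%C = (M ^ d)%:R * \sum_k c k * ((c k)^*)%C); last first.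
    by rewrite -QE rmorphM rmorph_nat.
  rewrite mulr_sumr.
  apply: eq_bigr => k _; rewrite mulrA -cE mulr_suml; apply: eq_bigr => u _.
  rewrite expiN -[RHS]/(f (latpt u) * ((c k * expi (phase k (latpt u)))^*)%C).
  have -> : (((c k * expi (phase k (latpt u)))^*)%C) = ((c k)^*)%C * ((expi (phase k (latpt u)))^*)%C.
    by rewrite rmorphM.
  ring.
have CS : ((M ^ d)%:R * Q) ^+ 2 <= S * ((M ^ d)%:R * Q).
  have := cauchy_schwarz_csum xpredT (fun u => f (latpt u)) (fun u => ((F u)^*)%C).
  rewrite -E cmod_real real_normK ?num_real//.
  suff -> : \sum_u cmod ((F u)^*)%C ^+ 2 = \sum_u cmod (F u) ^+ 2 by rewrite pF.
  by apply: eq_bigr => u _; rewrite !cmod_sqr; case: (F u) => a b /=; rewrite sqrrN.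
rewrite ler_pdivlMl//.
have := mulr_ge0 (ltW Md0) Q0; rewrite le_eqVlt => /orP[/eqP <-|h].
  by apply: sumr_ge0 => u _; exact: sqr_ge0.
by rewrite -(ler_pM2r h) -expr2.
Qed.

Lemma trigc_bound (B : R) k : 0 <= B -> (forall x, cmod (f x) <= B) -> cmod (trigc k) <= B.
Proof.
move=> B0 hB; rewrite /trigc cmodM cmod_real ger0_norm; last first.
  by apply: prodr_ge0 => j _; have /andP[] := kcoef01 R n (k j).
apply: (@le_trans _ _ (1 * B)); last by rewrite mul1r.
apply: ler_pM; rewrite ?cmod_ge0//.
- by apply: prodr_ge0 => j _; have /andP[] := kcoef01 R n (k j).
- by apply: prodr_ile1 => j _; exact: kcoef01.
have Md0 : 0 < (M ^ d)%:R :> R by rewrite ltr0n expn_gt0 M0.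
rewrite cmodM -(rmorph_nat (real_complex R)) -fmorphV cmod_real.
rewrite ger0_norm ?invr_ge0 ?(ltW Md0)// ler_pdivrMl//.
apply: le_trans (cmod_sum _ _ _) _.
apply: (@le_trans _ _ (\sum_(u : lat) B)).
  apply: ler_sum => u _; rewrite cmodM cmod_expi mulr1; exact: hB.
by rewrite sumr_const card_ffun !card_ord mulr_natl.
Qed.

End TrigApprox.

(** * The maximal function on a cube *)

Lemma prod_sub_le {R : realType} k (a b : 'I_k -> R[i]) (B e : R) :
  1 <= B -> 0 <= e -> (forall i, cmod (a i) <= B) -> (forall i, cmod (b i) <= B) ->
  (forall i, cmod (a i - b i) <= e) ->
  cmod (\prod_i a i - \prod_i b i) <= k%:R * B ^+ k * e.
Proof.
move=> B1 e0; have B0 : 0 <= B := le_trans ler01 B1.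
elim: k a b => [|k IH] a b ha hb hab.
  by rewrite !big_ord0 subrr cmod0 !mul0r.
rewrite !big_ord_recl.
set pa := \prod_i a _; set pb := \prod_i b _.
have -> : a ord0 * pa - b ord0 * pb = (a ord0 - b ord0) * pa + b ord0 * (pa - pb) by ring.
apply: le_trans (cmodD _ _) _; rewrite !cmodM.
have h1 : cmod pa <= B ^+ k.
  rewrite /pa cmod_prod -[X in _ ^+ X]card_ord -prodr_const.
  by apply: ler_prod => i _; rewrite cmod_ge0 ha.
have h2 : cmod (pa - pb) <= k%:R * B ^+ k * e by apply: IH => i.
have Bk0 : 0 <= B ^+ k by exact: exprn_ge0.
have BkB : B ^+ k <= B ^+ k.+1 by rewrite exprS ler_peMl.
apply: (@le_trans _ _ (e * B ^+ k.+1 + B * (k%:R * B ^+ k * e))).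
  apply: lerD; apply: ler_pM; rewrite ?cmod_ge0//.
  exact: le_trans h1 BkB.
by rewrite -natr1 exprS; nra.
Qed.

Definition lip_bounded {R : realType} d (B L : R) (f : 'rV[R]_d -> R[i]) :=
  (forall x, cmod (f x) <= B) /\
  (forall x x' : 'rV[R]_d, cmod (f x - f x') <= L * \sum_j `|x 0 j - x' 0 j|).

Lemma lipschitz_continuous_mx {R : realType} p q (h : 'M[R]_(p, q) -> R) (L : R) :
  (forall x x', `|h x - h x'| <= L * \sum_i \sum_j `|x i j - x' i j|) -> continuous h.
Proof.
move=> hL /= x s /= /(nbhs_ballP (h x)) [e e0 es].
pose r := `|L| * (p * q)%:R + 1.
have r0 : 0 < r by rewrite ltr_wpDl// mulr_ge0.
apply/nbhs_ballP; exists (e / r) => /=; first exact: divr_gt0.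
move=> y [_ xy]; apply: es; rewrite -ball_normE /ball_ /=.
apply: le_lt_trans (hL _ _) _.
apply: (@le_lt_trans _ _ (`|L| * (p * q)%:R * (e / r))).
  rewrite -mulrA; apply: (@le_trans _ _ (`|L| * \sum_i \sum_j `|x i j - y i j|)).
    rewrite ler_wpM2r ?ler_norm//.
    by apply: sumr_ge0 => i _; apply: sumr_ge0.
  rewrite ler_wpM2l//.
  apply: (@le_trans _ _ (\sum_(i < p) \sum_(j < q) e / r)).
    apply: ler_sum => i _; apply: ler_sum => j _; apply: ltW.
    by have := xy i j; rewrite -ball_normE.
  by rewrite !sumr_const !card_ord -mulrnA mulr_natl mulnC.
rewrite mulrCA -[ltRHS]mulr1 ltr_pM2l// ltr_pdivrMr// mul1r.
by rewrite ltrDl.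
Qed.

Section Average.
Variables (R : realType) (m d : nat).
Local Notation T := (bmx R m.+1 d).
Variable sigma : {measure set T -> \bar R}.
Hypothesis fin_sigma : (sigma setT < +oo)%E.
Hypothesis supp_sigma : sigma [set y : T | 1 < enorm (y : 'M[R]_(m.+1, d))] = 0%E.

Let sm := fine (sigma setT).
Let sm0 : 0 <= sm. Proof. by rewrite fine_ge0. Qed.

Lemma lip_bounded_meas (B L : R) f (x : 'rV[R]_d) (t : R) i : lip_bounded B L f ->
  cbounded_meas (fun y : T => f (x - t *: row i (y : 'M[R]_(m.+1, d)))).
Proof.
move=> [fB fL].
have H y y' : cmod (f (x - t *: row i y) - f (x - t *: row i y')) <=
    `|L| * `|t| * \sum_i \sum_j `|y i j - y' i j|.
  apply: le_trans (fL _ _) _.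
  apply: le_trans (ler_wpM2r _ (ler_norm L)) _; first by apply: sumr_ge0.
  rewrite -mulrA ler_wpM2l//.
  apply: (@le_trans _ _ (`|t| * \sum_j `|y i j - y' i j|)).
    rewrite mulr_sumr; apply: ler_sum => j _; rewrite !mxE.
    rewrite (_ : _ - _ = t * (y' i j - y i j)); last by ring.
    by rewrite normrM distrC.
  rewrite ler_wpM2l// [leRHS](bigD1 i)//= lerDl.
  by apply: sumr_ge0 => k _; apply: sumr_ge0.
have RB (z w : R[i]) : complex.Re z - complex.Re w = complex.Re (z - w) by case: z w => ? ? [].
have IB (z w : R[i]) : complex.Im z - complex.Im w = complex.Im (z - w) by case: z w => ? ? [].
split; split.
- apply: continuous_measurable_bmx; apply: (@lipschitz_continuous_mx _ _ _ _ (`|L| * `|t|)) => y y'.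
  by apply: le_trans (H y y'); rewrite RB; exact: normr_Re_le.
- by exists B => y; apply: le_trans (normr_Re_le _) (fB _).
- apply: continuous_measurable_bmx; apply: (@lipschitz_continuous_mx _ _ _ _ (`|L| * `|t|)) => y y'.
  by apply: le_trans (H y y'); rewrite IB; exact: normr_Im_le.
- by exists B => y; apply: le_trans (normr_Im_le _) (fB _).
Qed.

Variables (M n : nat) (x0 : 'I_d -> R) (f : 'I_m.+1 -> 'rV[R]_d -> R[i]).
Hypothesis M0 : (0 < M)%N.

Definition avg_coef (K : freqs m d n) : R[i] := \prod_i trigc M x0 (f i) (K i).

Definition avg_phase (K : freqs m d n) (x : 'I_d -> R) : R :=
  pi / 4 * \sum_j (\sum_i ((K i j)%:R - n%:R)) * x j.

Definition avg_trig (t : R) (x : 'rV[R]_d) : R[i] :=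
  \sum_K avg_coef K * expi (avg_phase K (x 0)) * symbol sigma t K.

Lemma trigp_meas i t (x : 'rV[R]_d) : cbounded_meas
  (fun y : T => trigp M x0 n (f i) (x - t *: row i (y : 'M[R]_(m.+1, d)))).
Proof.
apply: cbounded_meas_sum => k; apply: cbounded_measM; first exact: cbounded_meas_cst.
apply: cbounded_meas_expi; apply: measurable_funM => //.
apply: measurable_sum => j; apply: measurable_funM => //.
under eq_fun do rewrite !mxE.
apply: measurable_funB => //; apply: measurable_funM => //; exact: measurable_coord.
Qed.

(** Expanding the product gives one wave for each K: the variable x sees only the sum of the K_i,
    whereas sigma sees all of K, through the symbol. *)
Lemma avg_trigE t x :
  Cint sigma (fun y : T => \prod_i trigp M x0 n (f i) (x - t *: row i (y : 'M[R]_(m.+1, d)))) =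
  avg_trig t x.
Proof.
have E (y : T) : \prod_i trigp M x0 n (f i) (x - t *: row i (y : 'M[R]_(m.+1, d))) =
  \sum_(K : freqs m d n) avg_coef K * expi (avg_phase K (x 0)) *
     expi (- (t * (pi / 4 * mdot (y : 'M[R]_(m.+1, d)) (freqmx R K)))).
  rewrite /trigp bigA_distr_bigA /=; apply: eq_bigr => K _.
  rewrite big_split /= -mulrA; congr (_ * _).
  rewrite -expi_sum -expiD; congr expi.
  rewrite /phase /avg_phase /mdot.
  rewrite -mulr_sumr [t * _]mulrCA -mulrN -mulrDr; congr (_ * _).
  under [in RHS]eq_bigr do rewrite mulr_suml.
  rewrite [X in _ = X + _]exchange_big mulr_sumr -sumrN -big_split /=.
  apply: eq_bigr => i _; rewrite mulr_sumr -sumrN -big_split /=.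
  by apply: eq_bigr => j _; rewrite !mxE; ring.
rewrite (_ : (fun y : T => _) = (fun y : T => \sum_(K : freqs m d n)
    avg_coef K * expi (avg_phase K (x 0)) *
     expi (- (t * (pi / 4 * mdot (y : 'M[R]_(m.+1, d)) (freqmx R K)))))); last exact/funext.
have mp K : cbounded_meas (fun y : T =>
    expi (- (t * (pi / 4 * mdot (y : 'M[R]_(m.+1, d)) (freqmx R K))))).
  apply: cbounded_meas_expi; apply: measurableT_comp => //.
  by apply: measurable_funM => //; apply: measurable_funM => //; exact: measurable_mdot.
rewrite Cint_sum//; last by move=> K; apply: cbounded_measM => //; exact: cbounded_meas_cst.
by apply: eq_bigr => K _; rewrite CintZ.
Qed.

Variables (B : R).
Hypotheses (B1 : 1 <= B) (fB : forall i x, cmod (f i x) <= B).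

Lemma avg_coef_bound K : cmod (avg_coef K) <= B ^+ m.+1.
Proof.
rewrite cmod_prod -[X in _ ^+ X]card_ord -prodr_const.
by apply: ler_prod => i _; rewrite cmod_ge0 trigc_bound// (le_trans ler01 B1).
Qed.

Lemma avg_trig_lip_t t t' x :
  cmod (avg_trig t x - avg_trig t' x) <=
  (\sum_(K : freqs m d n) B ^+ m.+1 * (2 * sm * (diff_const R m d * (height K)%:R))) * `|t - t'|.
Proof.
rewrite -sumrB mulr_suml; apply: le_trans (cmod_sum _ _ _) _; apply: ler_sum => K _.
rewrite -mulrBr !cmodM cmod_expi mulr1 -mulrA; apply: ler_pM; rewrite ?cmod_ge0//.
  exact: avg_coef_bound.
exact: symbol_lip.
Qed.

(** The constant is crude but free of [M], so that the lattice can be refined after the degree is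
    fixed. *)
Lemma avg_trig_lip_x t x x' :
  cmod (avg_trig t x - avg_trig t x') <=
  (\sum_(K : freqs m d n) B ^+ m.+1 * (2 * (pi / 4 * (m.+1 * n)%:R) * (2 * sm))) *
    \sum_j `|x 0 j - x' 0 j|.
Proof.
rewrite -sumrB mulr_suml; apply: le_trans (cmod_sum _ _ _) _; apply: ler_sum => K _.
have -> : avg_coef K * expi (avg_phase K (x 0)) * symbol sigma t K -
  avg_coef K * expi (avg_phase K (x' 0)) * symbol sigma t K =
  avg_coef K * ((expi (avg_phase K (x 0)) - expi (avg_phase K (x' 0))) * symbol sigma t K) by ring.
rewrite !cmodM -mulrA; apply: ler_pM; rewrite ?mulr_ge0 ?cmod_ge0//.
  exact: avg_coef_bound.
have hs : cmod (symbol sigma t K) <= 2 * sm.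
  apply: le_trans (Cint_bound fin_sigma supp_sigma (e := 1) _ _ _) _; rewrite ?mulr1//.
    apply: cbounded_meas_expi; apply: measurableT_comp => //.
    by apply: measurable_funM => //; apply: measurable_funM => //; exact: measurable_mdot.
  by move=> y _; rewrite cmod_expi.
rewrite [leRHS]mulrAC; apply: ler_pM; rewrite ?cmod_ge0//.
apply: le_trans (expi_lip _ _) _; rewrite -[leRHS]mulrA ler_wpM2l//.
rewrite /avg_phase -mulrBr -sumrB normrM ger0_norm; last by rewrite divr_ge0// pi_ge0.
rewrite -[leRHS]mulrA ler_wpM2l ?divr_ge0 ?pi_ge0//.
apply: le_trans (ler_norm_sum _ _ _) _; rewrite mulr_sumr; apply: ler_sum => j _.
rewrite -mulrBr normrM ler_wpM2r//; apply: le_trans (ler_norm_sum _ _ _) _.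
have -> : (m.+1 * n)%:R = \sum_(i < m.+1) n%:R :> R.
  by rewrite sumr_const card_ord natrM mulr_natl.
apply: ler_sum => i _.
have hk : (K i j <= n.*2)%N by rewrite -ltnS.
rewrite ler_norml; apply/andP; split.
  by rewrite lerBrDr addrC subrr.
by rewrite lerBlDr -natrD addnn ler_nat.
Qed.

(** Brings the lattice values into the form of [symbol_bound]: the phase at the corner [x0] goes
    into the coefficients, and the centring of the frequencies only contributes a unimodular
    factor. *)
Lemma avg_trig_lat t u :
  cmod (avg_trig t (latpt x0 u)) =
  cmod (\sum_(K : freqs m d n) (avg_coef K * expi (avg_phase K x0)) * symbol sigma t K *
          lat_char R (sumK K) (u : {ffun 'I_d -> 'I_M})).
Proof.
have E (K : freqs m d n) (z : 'I_d -> R) :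
    avg_phase K z = pi / 4 * \sum_j ((sumK K j)%:R - (m.+1 * n)%:R) * z j.
  congr (_ * _); apply: eq_bigr => j _; congr (_ * _).
  by rewrite sumrB sumr_const card_ord sumKE natr_sum natrM mulr_natl.
have -> : avg_trig t (latpt x0 u) =
  expi (- (2 * pi / M%:R * \sum_j (m.+1 * n)%:R * (u j)%:R)) *
  \sum_(K : freqs m d n) (avg_coef K * expi (avg_phase K x0)) * symbol sigma t K *
          lat_char R (sumK K) u.
  rewrite [RHS]mulr_sumr; apply: eq_bigr => K _.
  rewrite !E (wave_lat M0); ring.
by rewrite cmodM cmod_expi mul1r.
Qed.

Lemma avg_coef_l2 : (n.*2 < M)%N ->
  \sum_(K : freqs m d n) cmod (avg_coef K * expi (avg_phase K x0)) ^+ 2 <=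
  \prod_i (((M ^ d)%:R)^-1 * \sum_(u : {ffun 'I_d -> 'I_M}) cmod (f i (latpt x0 u)) ^+ 2 : R).
Proof.
move=> nM.
rewrite (eq_bigr (fun K : freqs m d n => \prod_i cmod (trigc M x0 (f i) (K i)) ^+ 2)); last first.
  by move=> K _; rewrite cmodM cmod_expi mulr1 cmod_prod -prodrXl.
rewrite -(bigA_distr_bigA (fun i k => cmod (trigc M x0 (f i) k (n := n)) ^+ 2)).
apply: ler_prod => i _; rewrite sumr_ge0//=; last by move=> k _; exact: sqr_ge0.
exact: trigc_l2.
Qed.

End Average.

Section LocalSup.
Variables (R : realType) (m d : nat).
Local Notation T := (bmx R m.+1 d).
Variable sigma : {measure set T -> \bar R}.
Hypothesis fin_sigma : (sigma setT < +oo)%E.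
Hypothesis supp_sigma : sigma [set y : T | 1 < enorm (y : 'M[R]_(m.+1, d))] = 0%E.

Let sm := fine (sigma setT).
Let sm0 : 0 <= sm. Proof. by rewrite fine_ge0. Qed.

Lemma CintB g h : cbounded_meas g -> cbounded_meas h ->
  Cint sigma g - Cint sigma h = Cint sigma (fun y => g y - h y).
Proof.
move=> bg bh.
have h2 (k : bool) : cbounded_meas (fun y : T => (if k then 1 else -1) * (if k then g y else h y)).
  by apply: cbounded_measM; [exact: cbounded_meas_cst|case: k].
have := Cint_sum fin_sigma [:: true; false] xpredT h2.
rewrite !big_cons big_nil addr0 CintZ// CintZ// mul1r mulN1r => <-.
by congr Cint; apply/funext => y; rewrite !big_cons big_nil mul1r addr0 mulN1r.
Qed.

Lemma avg_int_trig (M n : nat) (x0 : 'I_d -> R) (f : 'I_m.+1 -> 'rV[R]_d -> R[i])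
    (B L eta t : R) (x : 'rV[R]_d) :
  (0 < M)%N -> 1 <= B -> 0 <= eta <= 1 -> (forall i, lip_bounded B L (f i)) ->
  (forall i (z : 'rV[R]_d), (forall j, `|z 0 j - (x0 j + 4)| <= 3) ->
     cmod (trigp M x0 n (f i) z - f i z) <= eta) ->
  1 < t < 2 -> (forall j, `|x 0 j - (x0 j + 4)| <= 1) ->
  cmod (avg_int sigma f x t - avg_trig sigma M n x0 f t x) <=
  2 * (m.+1%:R * (B + 1) ^+ m.+1 * eta) * sm.
Proof.
move=> M0 B1 /andP[eta0 eta1] nf happ /andP[t1 t2] hx.
have B0 : 0 <= B by exact: le_trans B1.
have mf : cbounded_meas (fun y : T => \prod_i f i (x - t *: row i (y : 'M[R]_(m.+1, d)))).
  by apply: cbounded_meas_prod => i; exact: lip_bounded_meas (nf i).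
have mP : cbounded_meas (fun y : T => \prod_i trigp M x0 n (f i) (x - t *: row i (y : 'M[R]_(m.+1, d)))).
  apply: cbounded_meas_prod => i; exact: trigp_meas.
rewrite -(avg_trigE fin_sigma) -/(Cint sigma _) CintB//.
apply: Cint_bound => //.
- rewrite (_ : (fun y => _) = (fun y : T =>
    \prod_i f i (x - t *: row i (y : 'M[R]_(m.+1, d))) +
    (-1) * \prod_i trigp M x0 n (f i) (x - t *: row i (y : 'M[R]_(m.+1, d))))).
    by apply: cbounded_measD => //; apply: cbounded_measM => //; exact: cbounded_meas_cst.
  by apply/funext => y; rewrite mulN1r.
- by rewrite !mulr_ge0 ?exprn_ge0// addr_ge0.
move=> y hy.
(* 1 from x and at most 2 from t y_i, since t < 2 and |y| <= 1. *)
have hz i j : `|(x - t *: row i (y : 'M[R]_(m.+1, d))) 0 j - (x0 j + 4)| <= 3.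
  rewrite !mxE; have := hx j; have := le_trans (coord_le_enorm y i j) hy.
  rewrite !ler_norml => /andP[a1 a2] /andP[b1 b2]; apply/andP; split; nra.
apply: prod_sub_le => //.
- by rewrite (le_trans B1)// lerDl.
- by move=> i; apply: le_trans ((nf i).1 _) _; rewrite lerDl.
- move=> i; set z := x - _.
  have -> : trigp M x0 n (f i) z = f i z + (trigp M x0 n (f i) z - f i z) by ring.
  apply: le_trans (cmodD _ _) _; apply: lerD; first exact: (nf i).1.
  exact: le_trans (happ i z (hz i)) eta1.
- by move=> i; rewrite cmodB; exact: happ.
Qed.

Variable C0 : R.
Hypothesis C00 : 0 <= C0.
Hypothesis HC0 : symbol_bound sigma C0.

Lemma exists_pow2 (a : R) : exists g0, forall g, (g0 <= g)%N -> a <= 2 ^+ g.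
Proof.
exists (Num.truncn a).+1 => g hg; apply: ltW; apply: lt_le_trans (truncnS_gt a) _.
by rewrite -natrX ler_nat; apply: leq_trans hg _; exact: ltnW (ltn_expl _ _).
Qed.

(** Three errors of e / 3 separate the true average from one at a lattice point and a grid time:
    approximation by polynomials, rounding of t, rounding of x. The threshold [M1] is fixed before
    the corner [x0]. *)
Lemma local_sup (B L e : R) (f : 'I_m.+1 -> 'rV[R]_d -> R[i]) :
  1 <= B -> 0 <= L -> 0 < e -> (forall i, lip_bounded B L (f i)) ->
  exists M1, forall M, (M1 <= M)%N -> (0 < M)%N -> forall x0 : 'I_d -> R,
  exists b : {ffun 'I_d -> 'I_M} -> R,
  [/\ forall u, 0 <= b u,
      forall u (x : 'rV[R]_d) t, 1 < t < 2 ->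
        (forall j, `|x 0 j - latpt x0 u 0 j| <= 8 / M%:R) ->
        (forall j, `|x 0 j - (x0 j + 4)| <= 1) ->
        cmod (avg_int sigma f x t) <= Num.sqrt (b u) + e &
      \sum_u b u <= (M ^ d)%:R * (C0 * \prod_i (((M ^ d)%:R)^-1 *
         \sum_u cmod (f i (latpt x0 (u : {ffun 'I_d -> 'I_M}))) ^+ 2))].
Proof.
move=> B1 L0 e0 nf.
have B0 : 0 <= B by exact: le_trans B1.
have e30 : 0 < e / 3 by rewrite divr_gt0.
pose P := 2 * (m.+1%:R * (B + 1) ^+ m.+1) * sm.
have P0 : 0 <= P by rewrite !mulr_ge0 ?exprn_ge0// addr_ge0.
have [eta eta0 etaP] : exists2 eta : R, 0 < eta <= 1 & P * eta <= e / 3.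
  exists (Num.min 1 (e / 3 / (P + 1))).
    by rewrite lt_min ltr01 divr_gt0 ?ltr_wpDl//= ge_min lexx.
  apply: (@le_trans _ _ (P * (e / 3 / (P + 1)))).
    by rewrite ler_wpM2l// ge_min lexx orbT.
  by rewrite mulrCA ler_piMr ?ltW// ltr_pdivrMr ?ltr_wpDl// mul1r ltrDl.
pose K := L * sin_const R * d%:R.
have K0 : 0 <= K.
  by apply: mulr_ge0 => //; apply: mulr_ge0 => //; exact: ltW (sin_const_gt0 _).
have [eta0' eta1] := andP eta0.
pose eta' : R := eta / (2 * (K + 1)).
have K10 : 0 < 2 * (K + 1) by rewrite mulr_gt0// ltr_wpDl.
have eta'0 : 0 < eta' by rewrite divr_gt0.
(* Then 1 / (2 n + 2) <= eta'^2, so both terms of [trigp_approx] are at most K * eta', and 2 K eta'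
   <= eta. *)
pose n := Num.truncn (eta' ^- 2).
have hn : K * (eta' + (n.+1.*2)%:R^-1 / eta') <= eta.
  have h1 : (n.+1.*2)%:R^-1 / eta' <= eta'.
    rewrite ler_pdivrMr// -expr2 -[leRHS]invrK lef_pV2 ?posrE ?invr_gt0 ?exprn_gt0 ?ltr0n//.
    rewrite ltW// (lt_le_trans (truncnS_gt _))// ler_nat -addnn leq_addr//.
  apply: (@le_trans _ _ (K * (2 * eta'))).
    by rewrite ler_wpM2l// mulr_natl mulr2n lerD2l.
  have -> : K * (2 * eta') = eta * (K / (K + 1)).
    by rewrite /eta'; field; rewrite gt_eqF// ltr_wpDl.
  by rewrite ler_piMr ?ltW// ltr_pdivrMr ?ltr_wpDl// mul1r ltrDl.
pose CX := \sum_(K : freqs m d n) B ^+ m.+1 * (2 * (pi / 4 * (m.+1 * n)%:R) * (2 * sm)).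
have CX0 : 0 <= CX.
  apply: sumr_ge0 => k _; rewrite mulr_ge0 ?exprn_ge0// !mulr_ge0 ?divr_ge0 ?pi_ge0//.
pose CT := \sum_(K : freqs m d n) B ^+ m.+1 * (2 * sm * (diff_const R m d * (height K)%:R)).
(* M >= w makes the variation of the trigonometric average over a cell of side 8 / M at most e /
   3. *)
pose w := 8 * d%:R * CX / (e / 3).
exists (n.+1.*2 + sumB m n + (Num.truncn w)).+1 => M hM M0 x0.
have hM1 : (n.+1.*2 < M)%N by apply: leq_trans hM; rewrite ltnS -addnA leq_addr.
have hM2 : (sumB m n < M)%N.
  by apply: leq_trans hM; rewrite ltnS [(_ + sumB m n)%N]addnC -addnA leq_addr.
have hM3 : CX * (d%:R * (8 / M%:R)) <= e / 3.
  have wM : w <= M%:R.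
    apply: ltW; apply: lt_le_trans (truncnS_gt w) _; rewrite ler_nat.
    by apply: leq_trans hM; rewrite ltnS leq_addl.
  move: wM; rewrite /w ler_pdivrMr// => wM.
  rewrite !mulrA ler_pdivrMr ?ltr0n// [e / 3 * _]mulrC; apply: le_trans wM.
  by rewrite le_eqVlt; apply/orP; left; apply/eqP; ring.
pose c (K : freqs m d n) := avg_coef M x0 f K * expi (avg_phase K x0).
have [g0 Hg] := HC0 c hM2.
have [g1 Hg1] := exists_pow2 (CT / (e / 3)).
have {Hg}[b [hb1 hb2]] := Hg (maxn g0 g1) (leq_maxl _ _).
have {}Hg1 := Hg1 _ (leq_maxr g0 g1).
move: (maxn g0 g1) Hg1 hb1 => g Hg hb1.
have G0 : 0 < (2 : R) ^+ g by rewrite exprn_gt0.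
have b0 u : 0 <= b u by apply: le_trans (hb1 u 0%N _) => //; exact: sqr_ge0.
exists b; split=> // [u x t ht hxu hx|]; last first.
  apply: le_trans hb2 _; rewrite ler_wpM2l// ler_wpM2l//.
  by apply: avg_coef_l2 => //; apply: leq_trans hM1; rewrite ltnS leq_double.
have [t1 t2] := andP ht.
(* The grid time 1 + l / 2^g is the last one not exceeding t. *)
pose l := Num.truncn ((t - 1) * 2 ^+ g).
have tg0 : 0 <= (t - 1) * 2 ^+ g by rewrite mulr_ge0 ?subr_ge0 ?ltW.
have lG : (l <= 2 ^ g)%N.
  rewrite -(ler_nat R) natrX; apply: (@le_trans _ _ ((t - 1) * 2 ^+ g)); first by rewrite truncn_le.
  by rewrite ler_piMl ?ltW// ltrBlDr.
pose tl : R := 1 + l%:R / 2 ^+ g.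
have htl : `|t - tl| <= (2 ^+ g)^-1.
  have h1 : l%:R / 2 ^+ g <= t - 1 by rewrite ler_pdivrMr// truncn_le.
  have h2 : t - 1 <= (l%:R + 1) / 2 ^+ g.
    by rewrite ler_pdivlMr// natr1 ltW// truncnS_gt.
  move: h2; rewrite mulrDl mul1r => h2.
  by rewrite /tl ler_norml; apply/andP; split; lra.
have fB i z := (nf i).1 z.
pose AP := avg_trig sigma M n x0 f.
have s1 : cmod (avg_int sigma f x t - AP t x) <= e / 3.
  apply: le_trans (avg_int_trig (eta := eta) M0 B1 _ nf _ ht hx) _.
  - by rewrite ltW.
  - move=> i z hz; have hz' := trigp_approx M0 hM1 L0 eta'0 (nf i).2 hz; apply: le_trans hz' _.
    exact: hn.
  by apply: le_trans etaP; rewrite /P -/sm le_eqVlt; apply/orP; left; apply/eqP; ring.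
have s2 : cmod (AP t x - AP tl x) <= e / 3.
  apply: le_trans (avg_trig_lip_t fin_sigma supp_sigma n x0 M0 B1 fB t tl x) _.
  rewrite -/CT; apply: le_trans (ler_wpM2l _ htl) _.
    apply: sumr_ge0 => k _; rewrite mulr_ge0 ?exprn_ge0// mulr_ge0//.
      by rewrite mulr_ge0.
    by rewrite mulr_ge0// diff_const_ge0.
  by rewrite ler_pdivrMr// mulrC -ler_pdivrMr.
have s3 : cmod (AP tl x - AP tl (latpt x0 u)) <= e / 3.
  apply: le_trans (avg_trig_lip_x fin_sigma supp_sigma n x0 M0 B1 fB tl x (latpt x0 u)) _.
  rewrite -/CX; apply: le_trans hM3; rewrite ler_wpM2l//.
  have -> : d%:R * (8 / M%:R) = \sum_(j < d) 8 / M%:R :> R.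
    by rewrite sumr_const card_ord mulr_natl.
  by apply: ler_sum => j _; exact: hxu.
have s4 : cmod (AP tl (latpt x0 u)) <= Num.sqrt (b u).
  rewrite -[cmod _]ger0_norm ?cmod_ge0// -sqrtr_sqr ler_wsqrtr//.
  by rewrite /AP avg_trig_lat//; exact: hb1.
have -> : avg_int sigma f x t = (avg_int sigma f x t - AP t x) + (AP t x - AP tl x) +
   (AP tl x - AP tl (latpt x0 u)) + AP tl (latpt x0 u) by ring.
apply: le_trans (cmodD _ _) _; rewrite addrC lerD//.
apply: le_trans (cmodD _ _) _.
have -> : e = e / 3 + e / 3 + e / 3 by field.
rewrite lerD//; apply: le_trans (cmodD _ _) _; exact: lerD.
Qed.

End LocalSup.

(** * Step functions on the cells of the lattice *)

Section Step.
Variables (R : realType) (d M : nat).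
Hypothesis M0 : (0 < M)%N.
Variable x0 : 'I_d -> R.
Local Notation lat := {ffun 'I_d -> 'I_M}.

Let Mr : 0 < (M%:R : R). Proof. by rewrite ltr0n. Qed.

Definition in_cell (u : lat) (x : 'rV[R]_d) :=
  forall j, latpt x0 u 0 j <= x 0 j < latpt x0 u 0 j + 8 / M%:R.

Definition in_cube (x : 'rV[R]_d) := forall j, x0 j <= x 0 j < x0 j + 8.

(** Written as a product over coordinates, the form that [Rd_meas_int_box] integrates; half-open
    cells tile the half-open cube exactly. *)
Definition cellbox (u : lat) (x : 'rV[R]_d) : R :=
  \prod_j \1_(`[latpt x0 u 0 j, latpt x0 u 0 j + 8 / M%:R[%classic) (x 0 j).

Definition step_fun (c : lat -> R) (x : 'rV[R]_d) : \bar R :=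
  (\sum_u (c u)%:E * (cellbox u x)%:E)%E.

Lemma cellbox_ge0 u x : 0 <= cellbox u x.
Proof. by apply: prodr_ge0 => j _; rewrite indicE. Qed.

Lemma cellbox_in u x : in_cell u x -> cellbox u x = 1.
Proof.
move=> h; rewrite /cellbox big1// => j _; rewrite indicE mem_set//= in_itv /=.
exact: h.
Qed.

Lemma cellbox_out u x : ~ in_cell u x -> cellbox u x = 0.
Proof.
move=> /existsNP[j hj]; rewrite /cellbox (bigD1 j)//= indicE memNset ?mul0r//=.
Qed.

Lemma in_cell_inj u u' x : in_cell u x -> in_cell u' x -> u = u'.
Proof.
move=> h h'; apply/ffunP => j; apply/val_inj/eqP.
have w0 : 0 < 8 / M%:R :> R by rewrite divr_gt0.
have := h j; have := h' j; rewrite !mxE => /andP[a1 a2] /andP[b1 b2].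
have c1 : 8 / M%:R * (u j)%:R < 8 / M%:R * ((u' j).+1)%:R :> R.
  by rewrite -[(u' j).+1%:R]natr1 mulrDr mulr1; lra.
have c2 : 8 / M%:R * (u' j)%:R < 8 / M%:R * ((u j).+1)%:R :> R.
  by rewrite -[(u j).+1%:R]natr1 mulrDr mulr1; lra.
move: c1 c2; rewrite !ltr_pM2l// !ltr_nat !ltnS => c1 c2.
by rewrite eqn_leq c1 c2.
Qed.

Lemma in_cell_cube u x : in_cell u x -> in_cube x.
Proof.
move=> h j; have := h j; rewrite mxE => /andP[a1 a2].
have w0 : 0 < 8 / M%:R :> R by rewrite divr_gt0.
have c1 : 0 <= 8 / M%:R * (u j)%:R :> R by rewrite mulr_ge0// ltW.
have c2 : 8 / M%:R * (u j)%:R + 8 / M%:R <= 8 :> R.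
  rewrite -[X in _ + X]mulr1 -mulrDr natr1 mulrAC ler_pdivrMr// ler_wpM2l// ler_nat.
  exact: ltn_ord.
apply/andP; split; lra.
Qed.

Lemma in_cubeP x : in_cube x -> exists u, in_cell u x.
Proof.
move=> h.
have w0 : 0 < 8 / M%:R :> R by rewrite divr_gt0.
have lt (j : 'I_d) : (Num.truncn ((x 0 j - x0 j) / (8 / M%:R))%R < M)%N.
  have /andP[a1 a2] := h j.
  rewrite -(ltr_nat R); apply: (@le_lt_trans _ _ ((x 0 j - x0 j) / (8 / M%:R))).
    by rewrite truncn_le divr_ge0 ?subr_ge0 ?(ltW w0).
  by rewrite ltr_pdivrMr// mulrCA divff ?gt_eqF// mulr1; lra.
exists [ffun j => Ordinal (lt j)] => j; rewrite mxE ffunE /=.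
have /andP[a1 a2] := h j.
set y := (x 0 j - x0 j) / (8 / M%:R).
have y0 : 0 <= y by rewrite divr_ge0 ?subr_ge0 ?(ltW w0).
have xE : x 0 j = x0 j + 8 / M%:R * y by rewrite /y; field; rewrite !gt_eqF.
rewrite xE; apply/andP; split.
  by rewrite lerD2l ler_wpM2l ?(ltW w0)// truncn_le.
by rewrite -addrA ltrD2l -[X in _ + X]mulr1 -mulrDr ltr_pM2l// natr1 truncnS_gt.
Qed.

Lemma step_fun_in c u x : in_cell u x -> step_fun c x = (c u)%:E.
Proof.
move=> h; rewrite /step_fun (bigD1 u)//= cellbox_in// mule1 big1 ?adde0// => u' ne.
rewrite cellbox_out ?mule0// => h'; move/eqP: ne; apply; exact: in_cell_inj h' h.
Qed.

Lemma step_fun_out c x : ~ in_cube x -> step_fun c x = 0%E.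
Proof.
move=> h; rewrite /step_fun big1// => u _.
by rewrite cellbox_out ?mule0// => h'; apply: h; exact: in_cell_cube h'.
Qed.

Lemma step_fun_ge0 c x : (forall u, 0 <= c u) -> (0 <= step_fun c x)%E.
Proof.
by move=> c0; apply: sume_ge0 => u _; rewrite mule_ge0// lee_fin ?cellbox_ge0.
Qed.

Lemma step_fun_int c : (forall u, 0 <= c u) ->
  Rd_meas (step_fun c) /\
  Rd_int (step_fun c) = ((8 / M%:R) ^+ d * \sum_u c u)%:E.
Proof.
move=> c0.
have w0 : 0 <= 8 / M%:R :> R by rewrite divr_ge0.
have hb u : Rd_meas (fun x : 'rV[R]_d => (c u)%:E * (cellbox u x)%:E)%E /\
    Rd_int (fun x : 'rV[R]_d => (c u)%:E * (cellbox u x)%:E)%E = ((8 / M%:R) ^+ d * c u)%:E.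
  have [m1 i1] := @Rd_meas_int_box R d (fun j => latpt x0 u 0 j)
     (fun j => latpt x0 u 0 j + 8 / M%:R) (fun j => ltac:(by rewrite lerDl)).
  have g0 (x : 'rV[R]_d) : (0 <= (cellbox u x)%:E)%E by rewrite lee_fin cellbox_ge0.
  have [m2 i2] := Rd_meas_intZ (c0 u) g0 m1; split=> //.
  rewrite i2 i1 -EFinM mulrC; congr (_ * _)%:E.
  rewrite -[in RHS](card_ord d) -prodr_const; apply: eq_bigr => j _; ring.
have [m3 i3] := @Rd_meas_int_sum R d _ (index_enum lat) xpredT
   (fun u x => (c u)%:E * (cellbox u x)%:E)%E
   (fun u x => ltac:(by rewrite mule_ge0// lee_fin ?cellbox_ge0)) (fun u => (hb u).1).
split=> //; rewrite /step_fun i3.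
under eq_bigr do rewrite (hb _).2.
by rewrite sumEFin mulr_sumr.
Qed.

End Step.

(* Young's inequality with [w] the expected size of c^2; it replaces Hoelder's
   inequality when passing from L^2 to L^p on a cube. *)
Lemma powR_le_square {R : realType} (c w p : R) : 0 <= c -> 0 < w -> 0 < p <= 2 ->
  c `^ p <= w `^ (p / 2) * (1 + c ^+ 2 / w).
Proof.
move=> c0 w0 /andP[p0 p2].
have -> : c `^ p = w `^ (p / 2) * (c ^+ 2 / w) `^ (p / 2).
  rewrite -powRM ?divr_ge0 ?sqr_ge0 ?ltW// mulrCA divff ?gt_eqF// mulr1.
  by rewrite -powR_mulrn// -powRrM; congr (_ `^ _); field.
rewrite ler_wpM2l ?powR_ge0//.
set r := c ^+ 2 / w; have r0 : 0 <= r by rewrite divr_ge0 ?sqr_ge0// ltW.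
have [r1|r1] := leP r 1.
  apply: (@le_trans _ _ 1); last by rewrite lerDl.
  have h1 : 1 `^ (p / 2) = 1 :> R by rewrite powR1.
  rewrite -[leRHS]h1.
  by apply: ge0_ler_powR; rewrite ?nnegrE// ltW// divr_gt0.
apply: (@le_trans _ _ r); last by rewrite lerDr.
rewrite -[leRHS]powRr1//; apply: ler_powR; first exact: ltW.
by rewrite ler_pdivrMr// mul1r.
Qed.

Section LocalEstimate.
Variables (R : realType) (m d : nat).
Local Notation T := (bmx R m.+1 d).
Variable sigma : {measure set T -> \bar R}.

Lemma Mloc_ge0 f (x : 'rV[R]_d) : (0 <= Mloc sigma f x)%E.
Proof.
apply: (@le_trans _ _ (cmod (avg_int sigma f x (3 / 2)))%:E).
  by rewrite lee_fin cmod_ge0.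
apply: ereal_sup_ubound; exists (3 / 2) => //=; apply/andP; split; lra.
Qed.

Lemma Mloc_pow_le f (x : 'rV[R]_d) (a p : R) : 0 <= a -> 0 <= p ->
  (forall t, 1 < t < 2 -> cmod (avg_int sigma f x t) <= a) ->
  (`|Mloc sigma f x| `^ p <= (a `^ p)%:E)%E.
Proof.
move=> a0 p0 h; rewrite gee0_abs ?Mloc_ge0// -poweR_EFin.
apply: gt0_ler_poweR => //.
- by rewrite in_itv /= Mloc_ge0 leey.
- by rewrite in_itv /= lee_fin a0 leey.
by apply: ge_ereal_sup => _ [t ht <-]; rewrite lee_fin; exact: h.
Qed.

Hypothesis fin_sigma : (sigma setT < +oo)%E.
Hypothesis supp_sigma : sigma [set y : T | 1 < enorm (y : 'M[R]_(m.+1, d))] = 0%E.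
Variable C0 : R.
Hypothesis C00 : 0 <= C0.
Hypothesis HC0 : symbol_bound sigma C0.

(** The step functions [g i] below |f_i|^2 stand for the restriction of |f_i|^2 to the cube of side
    8. They are known to satisfy [Rd_meas], so integrals from several cubes can later be added. The
    parameter [e] absorbs the errors of discretization and keeps the factors N i + e positive. *)
Lemma local_estimate (B L : R) (f : 'I_m.+1 -> 'rV[R]_d -> R[i]) (v : 'I_d -> R) (e : R) :
  1 <= B -> 0 <= L -> (forall i, lip_bounded B L (f i)) -> 0 < e ->
  exists (N : 'I_m.+1 -> R) (g : 'I_m.+1 -> 'rV[R]_d -> \bar R),
  [/\ forall i, 0 <= N i,
      forall i, [/\ forall x, (0 <= g i x)%E, Rd_meas (g i) & Rd_int (g i) = (N i)%:E],
      forall i x, (g i x <= (cmod (f i x) ^+ 2)%:E)%E,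
      forall i x, ~ in_cube (fun j => v j - 4) x -> g i x = 0%E &
      forall p, 0 < p <= 2 -> exists G : 'rV[R]_d -> \bar R,
        [/\ forall x, (0 <= G x)%E, Rd_meas G,
            forall x : 'rV[R]_d, (forall j, `|x 0 j - v j| <= 1) ->
              (`|Mloc sigma f x| `^ p <= G x)%E &
            (Rd_int G <= (8 ^+ d * (3 + 2 * C0) * (\prod_i (N i + e)) `^ (p / 2))%:E)%E]].
Proof.
move=> B1 L0 nf e0.
have B0 : 0 <= B by exact: le_trans B1.
pose x0 j := v j - 4.
(* With e1 <= 1, the square of the error e1 ^+ m.+1 of [local_sup] is at most e ^+ m.+1, hence at
   most the product of the N i + e. *)
pose e1 : R := Num.min 1 e.
have e10 : 0 < e1 by rewrite lt_min ltr01.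
have e11 : e1 <= 1 by rewrite ge_min lexx.
have e1e : e1 <= e by rewrite ge_min lexx orbT.
have [M1 HM1] := local_sup fin_sigma supp_sigma C00 HC0 B1 L0 (exprn_gt0 m.+1 e10) nf.
(* M >= w makes 2 B times the oscillation of f_i on a cell at most e / 8^d, so the Riemann sum errs
   by at most e on the cube. *)
pose w := L * d%:R * 8 * (8 ^+ d * 2 * B) / e.
pose M := (M1 + Num.truncn w).+1.
have M0 : (0 < M)%N by [].
have Mr : 0 < M%:R :> R by rewrite ltr0n.
have [b [b0 hb sb]] := HM1 M (leq_trans (leq_addr _ _) (leqnSn _)) M0 x0.
pose eta : R := L * (d%:R * (8 / M%:R)).
have eta0 : 0 <= eta by rewrite !mulr_ge0// divr_ge0.
have etae : 8 ^+ d * (2 * B * eta) <= e.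
  have wM : w <= M%:R.
    apply: ltW; apply: lt_le_trans (truncnS_gt w) _; rewrite ler_nat ltnS leq_addl//.
  move: wM; rewrite /w ler_pdivrMr// => wM.
  have -> : 8 ^+ d * (2 * B * eta) = L * d%:R * 8 * (8 ^+ d * 2 * B) / M%:R.
    by rewrite /eta; ring.
  by rewrite ler_pdivrMr// [e * _]mulrC.
pose lo i (u : {ffun 'I_d -> 'I_M}) : R := Num.max (cmod (f i (latpt x0 u)) - eta) 0 ^+ 2.
have lo0 i u : 0 <= lo i u by exact: sqr_ge0.
pose N i := (8 / M%:R) ^+ d * \sum_u lo i u.
exists N, (fun i => step_fun x0 (lo i)).
have w0 : 0 <= (8 / M%:R) ^+ d :> R by rewrite exprn_ge0// divr_ge0.
have N0 i : 0 <= N i by rewrite mulr_ge0// sumr_ge0.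
split=> //.
- move=> i; have [h1 h2] := step_fun_int x0 (lo0 i).
  by split=> // x; exact: step_fun_ge0.
- move=> i x; have [hx|hx] := pselect (in_cube x0 x); last first.
    by rewrite step_fun_out// lee_fin sqr_ge0.
  have [u hu] := in_cubeP M0 hx.
  rewrite (step_fun_in M0 _ hu) lee_fin /lo ler_pXn2r ?nnegrE ?cmod_ge0 ?le_max ?lexx ?orbT//.
  rewrite ge_max cmod_ge0 andbT lerBlDr.
  have -> : f i (latpt x0 u) = f i x + (f i (latpt x0 u) - f i x) by ring.
  apply: le_trans (cmodD _ _) _; rewrite lerD2l.
  apply: le_trans ((nf i).2 _ _) _; rewrite /eta ler_wpM2l//.
  have -> : d%:R * (8 / M%:R) = \sum_(j < d) 8 / M%:R :> R by rewrite sumr_const card_ord mulr_natl.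
  apply: ler_sum => j _; have := hu j => /andP[a1 a2].
  rewrite ler_norml; apply/andP; split; lra.
- by move=> i x hx; rewrite step_fun_out.
move=> p hp; have /andP[p0 p2] := hp.
pose W := \prod_i (N i + e).
have W0 : 0 < W by apply: prodr_gt0 => i _; rewrite ltr_wpDl.
pose G (u : {ffun 'I_d -> 'I_M}) : R := (Num.sqrt (b u) + e1 ^+ m.+1) `^ p.
have G0 u : 0 <= G u by exact: powR_ge0.
exists (step_fun x0 G); have [h1 h2] := step_fun_int x0 G0.
split=> //.
- by move=> x; exact: step_fun_ge0.
- move=> x hx.
  have cx : in_cube x0 x.
    move=> j; have := hx j; rewrite /x0 ler_norml => /andP[a1 a2]; apply/andP; split; lra.
  have [u hu] := in_cubeP M0 cx.
  rewrite (step_fun_in M0 _ hu); apply: Mloc_pow_le.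
  + by rewrite addr_ge0 ?sqrtr_ge0// exprn_ge0// ltW.
  + exact: ltW.
  move=> t ht; apply: (hb u) => // j.
    by have := hu j => /andP[a1 a2]; rewrite ler_norml; apply/andP; split; lra.
  by rewrite /x0 subrK; exact: hx.
rewrite h2 lee_fin.
have hW : e1 ^+ m.+1 ^+ 2 <= W.
  apply: (@le_trans _ _ (e ^+ m.+1)).
    rewrite -exprM mulnC exprM; apply: lerXn2r; rewrite ?nnegrE ?sqr_ge0// ?(ltW e0)//.
    by rewrite expr2; apply: le_trans e1e; rewrite ler_piMr// ltW.
  rewrite -[X in _ ^+ X]card_ord -prodr_const; apply: ler_prod => i _.
  by rewrite ltW//= lerDr.
have hS i : ((M ^ d)%:R)^-1 * \sum_u cmod (f i (latpt x0 (u : {ffun 'I_d -> 'I_M}))) ^+ 2 <= N i + e.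
  have hu u : cmod (f i (latpt x0 u)) ^+ 2 <= lo i u + 2 * B * eta.
    rewrite /lo; set a := cmod _; have a0 : 0 <= a := cmod_ge0 _.
    have aB : a <= B := (nf i).1 _.
    by case: (leP (a - eta) 0) => h; nra.
  apply: (@le_trans _ _ (((M ^ d)%:R)^-1 * \sum_(u : {ffun 'I_d -> 'I_M}) (lo i u + 2 * B * eta))).
    by rewrite ler_wpM2l ?invr_ge0//; apply: ler_sum => u _; exact: hu.
  rewrite big_split /= sumr_const card_ffun !card_ord mulrDr; apply: lerD.
    rewrite /N; apply: ler_wpM2r; first exact: sumr_ge0.
    by rewrite expr_div_n natrX ler_peMl ?invr_ge0 ?exprn_ge0// exprn_ege1// ler1n.
  rewrite -[X in _ * X <= _]mulr_natl mulKf; last by rewrite pnatr_eq0 -lt0n expn_gt0.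
  apply: le_trans etae; rewrite ler_peMl ?exprn_ege1 ?ler1n//.
  by rewrite !mulr_ge0.
have hprod : \prod_i (((M ^ d)%:R)^-1 * \sum_u cmod (f i (latpt x0 (u : {ffun 'I_d -> 'I_M}))) ^+ 2) <= W.
  apply: ler_prod => i _; rewrite hS andbT mulr_ge0 ?invr_ge0// sumr_ge0// => u _.
  exact: sqr_ge0.
have Md : 0 < (M ^ d)%:R :> R by rewrite ltr0n expn_gt0.
have sb' : \sum_u b u <= (M ^ d)%:R * (C0 * W).
  by apply: le_trans sb _; rewrite ler_wpM2l// ler_wpM2l.
(* Young's inequality with W as the expected size: the square is at most 2 b + 2 W, which gives 3 =
   1 + 2 and the coefficient 2 / W. *)
have Gle u : G u <= W `^ (p / 2) * (3 + 2 / W * b u).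
  apply: le_trans (powR_le_square _ W0 hp) _.
    by rewrite addr_ge0 ?sqrtr_ge0// exprn_ge0// ltW.
  rewrite ler_wpM2l ?powR_ge0//.
  have h : (Num.sqrt (b u) + e1 ^+ m.+1) ^+ 2 <= 2 * b u + 2 * W.
    have := sqr_sqrtr (b0 u); set s := Num.sqrt (b u).
    have := sqr_ge0 (s - e1 ^+ m.+1); move: hW; nra.
  have hd : (Num.sqrt (b u) + e1 ^+ m.+1) ^+ 2 / W <= (2 * b u + 2 * W) / W.
    by rewrite ler_pM2r ?invr_gt0.
  have wE : (2 * b u + 2 * W) / W = 2 / W * b u + 2 by field; rewrite gt_eqF.
  by move: hd; rewrite wE; lra.
apply: (@le_trans _ _ ((8 / M%:R) ^+ d * \sum_u W `^ (p / 2) * (3 + 2 / W * b u))).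
  by rewrite ler_wpM2l//; apply: ler_sum => u _; exact: Gle.
rewrite -mulr_sumr big_split /= sumr_const card_ffun !card_ord -mulr_sumr.
have key : 3 *+ M ^ d + 2 / W * \sum_u b u <= (M ^ d)%:R * (3 + 2 * C0).
  rewrite mulrDr -[3 *+ _]mulr_natl lerD2l.
  have -> : (M ^ d)%:R * (2 * C0) = 2 / W * ((M ^ d)%:R * (C0 * W)) by field; rewrite gt_eqF.
  by rewrite ler_wpM2l// divr_ge0// ltW.
have -> : (8 / M%:R) ^+ d = 8 ^+ d / (M ^ d)%:R :> R by rewrite expr_div_n natrX.
have -> : 8 ^+ d * (3 + 2 * C0) * W `^ (p / 2) =
    8 ^+ d / (M ^ d)%:R * (W `^ (p / 2) * ((M ^ d)%:R * (3 + 2 * C0))).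
  by field; rewrite gt_eqF.
rewrite ler_wpM2l ?divr_ge0 ?exprn_ge0//.
by rewrite ler_wpM2l ?powR_ge0.
Qed.

End LocalEstimate.

(** * Schwartz functions *)

Section Schwartz.
Variables (R : realType) (d : nat).

Definition axis (j : 'I_d) : 'rV[R]_d := \row_k (k == j)%:R.

Lemma is_derive_line (h : 'rV[R]_d -> R) (x v : 'rV[R]_d) (t : R) :
  derivable h (x + t *: v) v ->
  is_derive t 1 (fun s : R => h (x + s *: v)) ('D_v h (x + t *: v)).
Proof.
move=> dh.
have E : (fun s : R => s^-1 *: (((fun r => h (x + r *: v)) \o shift t) (s *: (1 : R)) - h (x + t *: v))) =
  (fun s : R => s^-1 *: ((h \o shift (x + t *: v)) (s *: v) - h (x + t *: v))).
  apply/funext => s /=; congr (_ *: (h _ - _)).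
  by rewrite [s *: 1]mulr1 scalerDl addrCA.
by constructor; rewrite ?/derivable ?/derive E.
Qed.

Lemma schwartz_real_bounded (h : 'rV[R]_d -> R) : schwartz_real h ->
  exists C, forall x, `|h x| <= C.
Proof.
move=> /(_ [::])[_ /(_ 0%N)[C hC]]; exists C => x.
by have := hC x; rewrite expr0 mul1r.
Qed.

(** Derivability is directional, so x is joined to x' by changing one coordinate at a time, with the
    mean value theorem along each axis. *)
Lemma schwartz_real_lipschitz (h : 'rV[R]_d -> R) : schwartz_real h ->
  exists2 L, 0 <= L & forall x x' : 'rV[R]_d, `|h x - h x'| <= L * \sum_j `|x 0 j - x' 0 j|.
Proof.
move=> hs.
have dh v x : derivable h x v by have [+ _] := hs [::]; exact.
have : forall j, exists C, forall x, `|'D_(axis j) h x| <= C.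
  move=> j; have [_ /(_ 0%N)[C hC]] := hs [:: axis j]; exists C => x.
  by have := hC x; rewrite expr0 mul1r.
move=> /choice[C hC].
pose L := \sum_j `|C j|.
have CL j : C j <= L.
  by apply: le_trans (ler_norm _) _; rewrite /L (bigD1 j)//= lerDl sumr_ge0.
exists L; first exact: sumr_ge0.
have step j x a : `|h x - h (x + a *: axis j)| <= L * `|a|.
  have := @lipschitz_derive R (fun s => h (x + s *: axis j)) _ L
    (fun t => is_derive_line (dh _ _)) (fun t => le_trans (hC j _) (CL j)) 0 a.
  by rewrite scale0r addr0 sub0r normrN.
move=> x x'.
pose z k : 'rV[R]_d := \row_j (if (j < k)%N then x' 0 j else x 0 j).
have z0 : z 0%N = x by apply/rowP => j; rewrite mxE.
have zd : z d = x' by apply/rowP => j; rewrite mxE ltn_ord.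
suff H k : (k <= d)%N -> `|h x - h (z k)| <= L * \sum_(j < d | (j < k)%N) `|x 0 j - x' 0 j|.
  by have := H d (leqnn d); rewrite zd; under eq_bigl do rewrite ltn_ord.
elim: k => [_|k IH kd]; first by rewrite z0 subrr normr0 big_pred0_eq mulr0.
have -> : h x - h (z k.+1) = (h x - h (z k)) + (h (z k) - h (z k.+1)) by ring.
pose j0 := Ordinal kd.
have -> : \sum_(j < d | (j < k.+1)%N) `|x 0 j - x' 0 j| =
    \sum_(j < d | (j < k)%N) `|x 0 j - x' 0 j| + `|x 0 j0 - x' 0 j0|.
  rewrite (bigD1 j0)//= addrC; congr (_ + _); apply: eq_bigl => j.
  by rewrite ltnS ltn_neqAle andbC; congr (_ && _).
rewrite mulrDr; apply: le_trans (ler_normD _ _) _; apply: lerD; first exact: IH (ltnW kd).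
have -> : z k.+1 = z k + (x' 0 j0 - x 0 j0) *: axis j0.
  apply/rowP => j; rewrite !mxE ltnS leq_eqVlt -(inj_eq val_inj) /=.
  case: eqVneq => [e|_] /=; last by rewrite mulr0 addr0.
  rewrite e ltnn; have -> : j = j0 by exact: val_inj.
  by rewrite mulr1; ring.
by apply: le_trans (step _ _ _) _; rewrite distrC.
Qed.

Lemma schwartz_lip_bounded (f : 'rV[R]_d -> R[i]) : schwartz f ->
  exists B L, 0 <= L /\ lip_bounded B L f.
Proof.
move=> [sr si].
have [B1 h1] := schwartz_real_bounded sr; have [B2 h2] := schwartz_real_bounded si.
have [L1 L10 k1] := schwartz_real_lipschitz sr; have [L2 L20 k2] := schwartz_real_lipschitz si.
exists (B1 + B2), (L1 + L2); split; first exact: addr_ge0.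
split=> [x|x x']; first by apply: le_trans (cmod_le _) _; exact: lerD.
apply: le_trans (cmod_le _) _; rewrite mulrDl; apply: lerD.
  by apply: le_trans (k1 x x'); case: (f x) (f x') => ? ? [].
by apply: le_trans (k2 x x'); case: (f x) (f x') => ? ? [].
Qed.

Lemma schwartz_uniform (I : finType) (f : I -> 'rV[R]_d -> R[i]) :
  (forall i, schwartz (f i)) ->
  exists B L, [/\ 1 <= B, 0 <= L & forall i, lip_bounded B L (f i)].
Proof.
move=> hf.
have /choice[B /choice[L hL]] : forall i, exists B L, 0 <= L /\ lip_bounded B L (f i).
  by move=> i; exact: schwartz_lip_bounded.
exists (1 + \sum_i `|B i|), (\sum_i L i); split.
- by rewrite lerDl sumr_ge0.
- by apply: sumr_ge0 => i _; exact: (hL i).1.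
move=> i; have [L0 [hB hl]] := hL i; split=> [x|x x'].
  apply: le_trans (hB x) _; apply: le_trans (ler_norm _) _.
  by rewrite (bigD1 i)//= addrCA lerDl addr_ge0// sumr_ge0.
apply: le_trans (hl x x') _; rewrite ler_wpM2r ?sumr_ge0//.
by rewrite (bigD1 i)//= lerDl sumr_ge0// => k _; exact: (hL k).1.
Qed.

Lemma integral_oneDsqrV :
  (\int[@lebesgue_measure R]_x ((oneDsqr x)^-1)%:E)%E = (pi)%:E.
Proof.
rewrite ge0_symfun_integralT//=.
- rewrite (_ : [set x | _] = `[0, +oo[%classic); last first.
    by apply/seteqP; split => x/=; rewrite in_itv/= andbT.
  by rewrite integral0y_oneDsqr -EFinM mulrCA divff// mulr1.
- exact: continuous_oneDsqrV.
- by move=> x /=; rewrite /oneDsqr sqrrN.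
Qed.

(** (1 + |x|)^(2 d) dominates the product of the 1 + x_j^2, whose inverse is integrable coordinate
    by coordinate. *)
Lemma schwartz_L2_finite (f : 'rV[R]_d -> R[i]) : schwartz f ->
  exists S : R, 0 <= S /\ Rd_int (fun x => (cmod (f x) ^+ 2)%:E) = S%:E.
Proof.
move=> [sr si].
have [_ /(_ d)[C1 h1]] := sr [::]; have [_ /(_ d)[C2 h2]] := si [::].
pose phi (j : 'I_d) (x : R) : R := (oneDsqr x)^-1.
have phi0 j x : 0 <= phi j x by rewrite invr_ge0 (le_trans ler01)// oneDsqr_ge1.
have [m1 i1] := @Rd_meas_int_prod R d phi (fun=> pi) phi0
  (fun j => continuous_measurable_fun (@continuous_oneDsqrV R)) (fun j => integral_oneDsqrV).
pose C := C1 ^+ 2 + C2 ^+ 2.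
have C0 : 0 <= C by rewrite addr_ge0 ?sqr_ge0.
have p0 (x : 'rV[R]_d) : (0 <= (\prod_j phi j (x 0 j))%:E)%E by rewrite lee_fin; apply: prodr_ge0.
have [m2 i2] := Rd_meas_intZ C0 p0 m1.
have bound (h : 'rV[R]_d -> R) c : (forall x, (1 + enorm x) ^+ d * `|h x| <= c) ->
    forall x, h x ^+ 2 <= c ^+ 2 * \prod_j phi j (x 0 j).
  move=> hc x.
  have e0 : 0 <= enorm x by exact: sqrtr_ge0.
  have q0 : 0 < \prod_j oneDsqr (x 0 j).
    by apply: prodr_gt0 => j _; rewrite (lt_le_trans ltr01)// oneDsqr_ge1.
  have -> : \prod_j phi j (x 0 j) = (\prod_j oneDsqr (x 0 j))^-1 by rewrite prodfV.
  rewrite ler_pdivlMr//.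
  have q1 : \prod_j oneDsqr (x 0 j) <= ((1 + enorm x) ^+ d) ^+ 2.
    rewrite -exprM mulnC exprM -[X in _ ^+ X](card_ord d) -prodr_const.
    apply: ler_prod => j _; rewrite (le_trans ler01) ?oneDsqr_ge1//=.
    have := coord_le_enorm x 0 j; rewrite /oneDsqr -real_normK ?num_real//.
    by have := normr_ge0 (x 0 j); nra.
  rewrite -(@real_normK _ (h x)) ?num_real//.
  apply: (@le_trans _ _ (`|h x| ^+ 2 * ((1 + enorm x) ^+ d) ^+ 2)).
    by rewrite ler_wpM2l// sqr_ge0.
  have a0 : 0 <= (1 + enorm x) ^+ d * `|h x| by rewrite mulr_ge0// exprn_ge0// addr_ge0.
  rewrite -exprMn mulrC; apply: lerXn2r => //; rewrite nnegrE//.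
  exact: le_trans a0 (hc x).
have key x : ((cmod (f x) ^+ 2)%:E <= C%:E * (\prod_j phi j (x 0 j))%:E)%E.
  rewrite -EFinM lee_fin cmod_sqr mulrDl; apply: lerD.
    exact: (bound (fun x => complex.Re (f x))).
  exact: (bound (fun x => complex.Im (f x))).
have f0 x : (0 <= (cmod (f x) ^+ 2)%:E)%E by rewrite lee_fin sqr_ge0.
have := le_Rd_int f0 key; rewrite i2 i1 -EFinM => hle.
have fin : Rd_int (fun x => (cmod (f x) ^+ 2)%:E) \is a fin_num.
  by rewrite ge0_fin_numE ?Rd_int_ge0//; apply: le_lt_trans hle _; rewrite ltry.
exists (fine (Rd_int (fun x => (cmod (f x) ^+ 2)%:E))); split; last by rewrite fineK.
by rewrite fine_ge0// Rd_int_ge0.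
Qed.

End Schwartz.

(** * Summation over cubes *)

Lemma powR_prod {R : realType} (I : Type) (r : seq I) (P : pred I) (a : I -> R) (q : R) :
  (forall i, 0 <= a i) ->
  (\prod_(i <- r | P i) a i) `^ q = \prod_(i <- r | P i) a i `^ q.
Proof.
move=> a0; elim: r => [|i r IH]; first by rewrite !big_nil powR1.
rewrite !big_cons; case: (P i) => //; rewrite powRM ?IH//.
by apply: prodr_ge0.
Qed.

Lemma AM_GM_powR {R : realType} k (y : 'I_k.+1 -> R) : (forall i, 0 <= y i) ->
  (\prod_i y i) `^ (k.+1%:R^-1) <= (\sum_i y i) / k.+1%:R.
Proof.
move=> y0.
have s0 : 0 <= (\sum_i y i) / k.+1%:R by rewrite divr_ge0// sumr_ge0.
have [h _] := @leif_AGM R 'I_k.+1 predT y (fun i _ => y0 i).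
rewrite card_ord in h.
have -> : (\sum_i y i) / k.+1%:R = (((\sum_i y i) / k.+1%:R) ^+ k.+1) `^ (k.+1%:R^-1).
  by rewrite -powR_mulrn// -powRrM divff ?powRr1// pnatr_eq0.
by apply: ge0_ler_powR; rewrite ?nnegrE ?invr_ge0 ?exprn_ge0 ?prodr_ge0.
Qed.

(** Hoelder's inequality with k.+1 equal exponents: after dividing each X l i by its total over l,
    the inequality of arithmetic and geometric means applies for each l. Positivity makes the totals
    invertible. *)
Lemma hoelder_sum {R : realType} k n (X : 'I_n -> 'I_k.+1 -> R) :
  (forall l i, 0 < X l i) ->
  \sum_l (\prod_i X l i) `^ (k.+1%:R^-1) <= (\prod_i \sum_l X l i) `^ (k.+1%:R^-1).
Proof.
move=> X0; case: n X X0 => [|n] X X0; first by rewrite big_ord0 powR_ge0.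
pose T i := \sum_l X l i.
have T0 i : 0 < T i.
  rewrite /T (bigD1 ord0)//= ltr_pwDl// sumr_ge0// => l _; exact: ltW.
pose W := \prod_i T i.
have W0 : 0 < W by apply: prodr_gt0.
have hX l : (\prod_i X l i) `^ (k.+1%:R^-1) <=
    W `^ (k.+1%:R^-1) * ((\sum_i X l i / T i) / k.+1%:R).
  have -> : \prod_i X l i = W * \prod_i (X l i / T i).
    rewrite /W -big_split /=; apply: eq_bigr => i _.
    by rewrite mulrCA divff ?mulr1// gt_eqF.
  have y0 i : 0 <= X l i / T i by rewrite divr_ge0// ltW.
  rewrite powRM ?(ltW W0)//; last exact: prodr_ge0.
  by rewrite ler_wpM2l ?powR_ge0//; exact: AM_GM_powR.
apply: le_trans (ler_sum _ (fun l _ => hX l)) _.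
rewrite -mulr_sumr -mulr_suml exchange_big /=.
rewrite (eq_bigr (fun=> 1)) => [|i _]; last by rewrite -mulr_suml -/(T i) divff// gt_eqF.
by rewrite sumr_const card_ord divff ?mulr1// pnatr_eq0.
Qed.

Lemma prod_perturb {R : realType} (I : Type) (r : seq I) (a : I -> R) :
  (forall i, 0 <= a i) ->
  exists2 K : R, 0 <= K & forall e, 0 < e <= 1 ->
    \prod_(i <- r) (a i + e) <= \prod_(i <- r) a i + K * e.
Proof.
move=> a0; elim: r => [|i r [K K0 hK]].
  by exists 0 => // e _; rewrite !big_nil mul0r addr0.
pose P := \prod_(j <- r) a j.
have P0 : 0 <= P by exact: prodr_ge0.
exists (P + a i * K + K); first by rewrite !addr_ge0// mulr_ge0.
move=> e he; have /andP[e0 e1] := he; rewrite !big_cons -/P.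
apply: (@le_trans _ _ ((a i + e) * (P + K * e))).
  apply: ler_wpM2l; last exact: hK.
  by apply: addr_ge0 => //; exact: ltW.
have : K * e * e <= K * e by rewrite ler_piMr// mulr_ge0// (ltW e0).
by nra.
Qed.

(** Lets the regularization e tend to 0; dividing by c + 1 rather than c covers c = 0. *)
Lemma sqrt_prod_limit {R : realType} k (a : 'I_k -> R) (c : R) (X : \bar R) :
  (forall i, 0 <= a i) -> 0 <= c ->
  (forall e, 0 < e <= 1 -> (X <= (c * Num.sqrt (\prod_i (a i + e)))%:E)%E) ->
  (X <= (c * Num.sqrt (\prod_i a i))%:E)%E.
Proof.
move=> a0 c0 hX; apply/lee_addgt0Pr => del del0.
have [K K0 hK] := prod_perturb (index_enum 'I_k) a0.
pose e := Num.min 1 ((del / (c + 1)) ^+ 2 / (K + 1)).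
have c10 : 0 < c + 1 by rewrite ltr_wpDl.
have K10 : 0 < K + 1 by rewrite ltr_wpDl.
have e0 : 0 < e by rewrite lt_min ltr01 divr_gt0// exprn_gt0// divr_gt0.
have e1 : e <= 1 by rewrite ge_min lexx.
apply: le_trans (hX e _) _; first by rewrite e0.
rewrite -EFinD lee_fin.
have P0 : 0 <= \prod_i a i by exact: prodr_ge0.
have h : Num.sqrt (\prod_i (a i + e)) <= Num.sqrt (\prod_i a i) + del / (c + 1).
  have d0 : 0 <= del / (c + 1) by rewrite divr_ge0 ?ltW.
  rewrite -[leRHS]ger0_norm; last by rewrite addr_ge0// sqrtr_ge0.
  rewrite -sqrtr_sqr ler_wsqrtr//.
  apply: le_trans (hK e _) _; first by rewrite e0.
  rewrite sqrrD sqr_sqrtr// -addrA lerD2l.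
  have : K * e <= (del / (c + 1)) ^+ 2.
    apply: (@le_trans _ _ (K * ((del / (c + 1)) ^+ 2 / (K + 1)))).
      by rewrite ler_wpM2l// ge_min lexx orbT.
    by rewrite mulrCA ler_piMr ?sqr_ge0// ler_pdivrMr// mul1r lerDl.
  move=> h; apply: le_trans h _; rewrite lerDr mulrn_wge0// mulr_ge0// sqrtr_ge0.
apply: le_trans (ler_wpM2l c0 h) _; rewrite mulrDr lerD2l mulrCA ler_piMr ?(ltW del0)//.
by rewrite ler_pdivrMr// mul1r lerDl.
Qed.

Section Cover.
Variables (R : realType) (d : nat).
Local Notation Zd := {ffun 'I_d -> int}.

Definition center (w : Zd) (j : 'I_d) : R := 2 * (w j)%:~R.

Lemma center_cover (x : 'rV[R]_d) : exists w, forall j, `|x 0 j - center w j| <= 1.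
Proof.
exists [ffun j => Num.floor ((x 0 j + 1) / 2)] => j; rewrite /center ffunE.
have := floor_le ((x 0 j + 1) / 2); have := floorD1_gt ((x 0 j + 1) / 2).
set F := Num.floor _; rewrite intrD => h1 h2.
by rewrite ler_norml; apply/andP; split; lra.
Qed.

(** Centres are 2 apart and the cubes are half-open of side 8, so in each coordinate w_j - floor
    (x_j / 2) + 1 lies in {0, 1, 2, 3}. The points of Z^d are enumerated by [pickle_inv], which is
    injective where it is defined. *)
Lemma center_overlap n (x : 'rV[R]_d) :
  (#|[set k : 'I_n | `[< exists2 w : Zd, @pickle_inv Zd k = Some w &
      in_cube (fun j => (center w j - 4)%R) x >]]%SET| <= 4 ^ d)%N.
Proof.
set A := [set k | _]%SET.
pose F j : int := Num.floor (x 0 j / 2).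
pose h (k : 'I_n) : {ffun 'I_d -> 'I_4} :=
  [ffun j => inord (absz ((odflt [ffun=> 0] (@pickle_inv Zd k) : Zd) j - F j + 1))].
have injh : {in A &, injective h}.
  move=> k k'; rewrite !inE => -[w kw hw] [w' kw' hw'] /ffunP hh.
  suff ww : w = w'.
    apply: val_inj => /=.
    have := @pickle_invK Zd k; have := @pickle_invK Zd k'.
    rewrite kw kw' /= ww; by move=> <- <-.
  apply/ffunP => j; have := hh j; rewrite !ffunE kw kw' /= => /(congr1 val) /=.
  have rng (z : Zd) : in_cube (fun j => center z j - 4) x -> (0 <= z j - F j + 1 < 4)%R.
    move=> hz; have /andP[a1 a2] := hz j; rewrite /center in a1 a2.
    have b1 := floor_le (x 0 j / 2); have b2 := floorD1_gt (x 0 j / 2).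
    rewrite -/(F j) intrD in b1 b2.
    have c1 : (F j - 2 < z j)%R by rewrite -(ltr_int R) rmorphB /=; lra.
    have c2 : (z j < F j + 3)%R by rewrite -(ltr_int R) rmorphD /=; lra.
    by apply/andP; split; lia.
  have /andP[p1 p2] := rng w hw; have /andP[q1 q2] := rng w' hw'.
  rewrite !inordK; [|lia..].
  lia.
rewrite -(card_in_imset injh); apply: leq_trans (max_card _) _.
by rewrite card_ffun !card_ord.
Qed.

End Cover.

Section Global.
Variables (R : realType) (m d : nat).
Local Notation T := (bmx R m.+1 d).
Variable sigma : {measure set T -> \bar R}.
Hypothesis fin_sigma : (sigma setT < +oo)%E.
Hypothesis supp_sigma : sigma [set y : T | 1 < enorm (y : 'M[R]_(m.+1, d))] = 0%E.
Variable C0 : R.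
Hypothesis C00 : 0 <= C0.
Hypothesis HC0 : symbol_bound sigma C0.

Definition loc_const : R := 8 ^+ d * (3 + 2 * C0).

Lemma loc_const_ge1 : 1 <= loc_const.
Proof.
have h8 : 1 <= 8 ^+ d :> R by rewrite exprn_ege1// ler1n.
have h3 : 1 <= 3 + 2 * C0 by move: C00; lra.
by rewrite -[leLHS]mulr1 ler_pM.
Qed.

Variable f : 'I_m.+1 -> 'rV[R]_d -> R[i].
Variables (B L : R) (S : 'I_m.+1 -> R).
Hypotheses (B1 : 1 <= B) (L0 : 0 <= L) (nf : forall i, lip_bounded B L (f i)).
Hypothesis S0 : forall i, 0 <= S i.
Hypothesis SE : forall i, Rd_int (fun x => (cmod (f i x) ^+ 2)%:E) = (S i)%:E.

Local Notation PS := (\prod_i S i).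

(** The unit ball lies in the cube centred at 0. The p-th root turns W^(p/2) into the square root of
    W for every p; since [loc_const] >= 1 and 1 / p <= m.+1 / 2, the constant can be taken
    independent of p. *)
Lemma Lp_on_ball p : 2 / m.+1%:R <= p <= 2 ->
  (Lp_on [set x : 'rV[R]_d | (enorm x < 1)%R] p (Mloc sigma f) <=
   (loc_const `^ (m.+1%:R / 2) * Num.sqrt PS)%:E)%E.
Proof.
move=> /andP[p1 p2]; have p0 : 0 < p by apply: lt_le_trans p1; rewrite divr_gt0.
have pV : p^-1 <= m.+1%:R / 2.
  by rewrite -[leRHS]invrK lef_pV2 ?posrE ?invr_gt0 ?divr_gt0// invf_div.
apply: sqrt_prod_limit => //; first exact: powR_ge0.
move=> e /andP[e0 e1].
have [N [g [N0 hg gle _ hG]]] := local_estimate fin_sigma supp_sigma C00 HC0 (fun=> 0) B1 L0 nf e0.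
have /hG[G [G0 mG Gle IG]] : 0 < p <= 2 by rewrite p0.
have NS i : N i <= S i.
  have [g0 mg Ig] := hg i.
  by rewrite -lee_fin -Ig -SE; apply: le_Rd_int.
have W0 : 0 <= \prod_i (S i + e) by apply: prodr_ge0 => i _; rewrite addr_ge0// ltW.
have NW : \prod_i (N i + e) <= \prod_i (S i + e).
  by apply: ler_prod => i _; rewrite lerD2r NS addr_ge0// ltW.
have P0 : 0 <= \prod_i (N i + e) by apply: prodr_ge0 => i _; rewrite addr_ge0// ltW.
have le1 : (Rd_int (fun x : 'rV[R]_d => (\1_[set x : 'rV[R]_d | (enorm x < 1)%R] x)%:E * (`|Mloc sigma f x| `^ p))%E
    <= (loc_const * (\prod_i (S i + e)) `^ (p / 2))%:E)%E.
  apply: (@le_trans _ _ (Rd_int G)).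
    apply: le_Rd_int => x; first by rewrite mule_ge0 ?poweR_ge0// lee_fin indicE.
    rewrite indicE; have [hx|hx] := boolP (x \in _); last by rewrite mul0e.
    rewrite mul1e; apply: Gle => j; rewrite subr0.
    by rewrite inE /= in hx; apply: le_trans (coord_le_enorm x 0 j) (ltW hx).
  apply: le_trans IG _; rewrite lee_fin ler_wpM2l ?(le_trans ler01 loc_const_ge1)//.
  by apply: ge0_ler_powR => //; rewrite divr_ge0// ltW.
rewrite /Lp_on; apply: (@le_trans _ _ ((loc_const * (\prod_i (S i + e)) `^ (p / 2))%:E `^ p^-1)%E).
  apply: gt0_ler_poweR => //; first by rewrite invr_ge0 ltW.
  - rewrite in_itv /= leey andbT; apply: Rd_int_ge0 => x.
    by rewrite mule_ge0 ?poweR_ge0// lee_fin indicE.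
  - by rewrite in_itv /= leey andbT lee_fin mulr_ge0 ?powR_ge0// (le_trans ler01 loc_const_ge1).
rewrite poweR_EFin lee_fin powRM ?powR_ge0 ?(le_trans ler01 loc_const_ge1)//.
rewrite -powRrM mulrAC divff ?gt_eqF// mul1r powR12_sqrt//.
by rewrite ler_wpM2r ?sqrtr_ge0//; apply: ler_powR => //; exact: loc_const_ge1.
Qed.

(** For this p the exponent p / 2 is 1 / m.+1, exactly the one for which [hoelder_sum] turns a sum
    over cubes of products into a product of sums. The bounded overlap then controls each sum. *)
Lemma Rd_int_Mloc_le e : 0 < e <= 1 ->
  (Rd_int (fun x => `|Mloc sigma f x| `^ (2 / m.+1%:R)) <=
   (loc_const * (\prod_i ((4 ^ d)%:R * S i + e)) `^ (m.+1%:R^-1))%:E)%E.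
Proof.
move=> /andP[e0 e1].
pose p : R := 2 / m.+1%:R.
have p0 : 0 < p by rewrite divr_gt0.
have p2 : p <= 2 by rewrite ler_pdivrMr// ler_peMr// ler1n.
have pE : p / 2 = m.+1%:R^-1 by rewrite /p mulrAC divff ?mul1r.
pose Zd := {ffun 'I_d -> int}.
(* The errors allotted to the cubes add up to at most e, and each is positive, as [hoelder_sum]
   requires. *)
pose ek k : R := e / 2 ^+ k.+1.
have ek0 k : 0 < ek k by rewrite divr_gt0// exprn_gt0.
have lc0 : 0 <= loc_const := le_trans ler01 loc_const_ge1.
have step k : exists N : 'I_m.+1 -> R,
  exists g : 'I_m.+1 -> 'rV[R]_d -> \bar R, exists G : 'rV[R]_d -> \bar R,
  [/\ forall i, [/\ 0 <= N i, forall x, (0 <= g i x)%E, Rd_meas (g i) & Rd_int (g i) = (N i)%:E],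
      forall i x, (g i x <= (cmod (f i x) ^+ 2)%:E)%E,
      forall i x, ~ (exists2 w : Zd, pickle_inv k = Some w & in_cube (fun j => center R w j - 4) x) ->
         g i x = 0%E,
      [/\ forall x, (0 <= G x)%E, Rd_meas G &
       (Rd_int G <= (loc_const * (\prod_i (N i + ek k)) `^ (m.+1%:R^-1))%:E)%E] &
      forall (w : Zd) (x : 'rV[R]_d), pickle_inv k = Some w -> (forall j, `|x 0 j - center R w j| <= 1) ->
        (`|Mloc sigma f x| `^ p <= G x)%E].
  case E : (@pickle_inv Zd k) => [w|].
    have [N [g [N0 hg gle gout hG]]] :=
      local_estimate fin_sigma supp_sigma C00 HC0 (center R w) B1 L0 nf (ek0 k).
    have /hG[G [G0 mG Gle IG]] : 0 < p <= 2 by rewrite p0.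
    exists N, g, G; split=> //.
    - by move=> i; have [a b c] := hg i; split.
    - by move=> i x hx; apply: gout => hc; apply: hx; exists w.
    - by split=> //; rewrite -pE.
    - by move=> w' x [<-]; exact: Gle.
  (* A natural number that codes no point of Z^d contributes zero functions. *)
  have [z1 z2] := @Rd_meas_int0 R d.
  exists (fun=> 0), (fun _ _ => 0%E), (fun=> 0%E); split=> //.
  - by move=> i x; rewrite lee_fin sqr_ge0.
  - by split=> //; rewrite z2 lee_fin mulr_ge0 ?powR_ge0.
have /choice[N /choice[g /choice[G hk]]] := step.
have Gmeas n := @Rd_meas_int_sum R d _ (index_enum 'I_n) xpredT (fun k x => G k x)
  (fun k x => let: And5 _ _ _ (And3 h _ _) _ := hk k in h x)
  (fun k => let: And5 _ _ _ (And3 _ h _) _ := hk k in h).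
have G0 k x : (0 <= G k x)%E by have [_ _ _ [h _ _] _] := hk k.
have N0 k i : 0 <= N k i by have [h _ _ _ _] := hk k; have [] := h i.
pose Y := loc_const * (\prod_i ((4 ^ d)%:R * S i + e)) `^ (m.+1%:R^-1).
have SN n i : \sum_(k < n) N k i <= (4 ^ d)%:R * S i.
  have gi k : [/\ forall x, (0 <= g k i x)%E, Rd_meas (g k i) & Rd_int (g k i) = (N k i)%:E].
    by have [h _ _ _ _] := hk k; have [] := h i.
  have [m1 i1] := @Rd_meas_int_sum R d _ (index_enum 'I_n) xpredT (fun k x => g k i x)
     (fun k x => let: And3 h _ _ := gi k in h x) (fun k => let: And3 _ h _ := gi k in h).
  have F0 : 0 < (4 ^ d)%:R :> R by rewrite ltr0n expn_gt0.
  have FV0 : 0 <= ((4 ^ d)%:R)^-1 :> R by rewrite invr_ge0 ltW.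
  have sg0 x : (0 <= \sum_(k < n) g k i x)%E.
    by apply: sume_ge0 => k _; have [h _ _] := gi k.
  have [m2 i2] := Rd_meas_intZ FV0 sg0 m1.
  (* The factor 4^-d goes on the step functions, for which [Rd_meas] is known, and not on |f_i|^2,
     for which only monotonicity is used. *)
  have : (Rd_int (fun x => (((4 ^ d)%:R)^-1)%:E * \sum_(k < n) g k i x) <= (S i)%:E)%E.
    rewrite -SE; apply: le_Rd_int => x; first exact: mule_ge0.
    rewrite muleC lee_pdivrMr//.
    pose A := [set k : 'I_n | `[< exists2 w : Zd, pickle_inv k = Some w &
      in_cube (fun j => (center R w j - 4)%R) x >]]%SET.
    apply: (@le_trans _ _ (\sum_(k < n) (if k \in A then cmod (f i x) ^+ 2 else 0)%:E)%E).
      apply: lee_sum => k _; have [_ gle gout _ _] := hk k.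
      case: ifPn => [_|]; first exact: gle.
      by rewrite inE => /asboolPn hx; rewrite gout.
    rewrite sumEFin -big_mkcond /= sumr_const -EFinM lee_fin -[leLHS]mulr_natr.
    by rewrite ler_wpM2l ?sqr_ge0// ler_nat center_overlap.
  rewrite i2 i1.
  under eq_bigr do rewrite (let: And3 _ _ h := gi _ in h).
  by rewrite sumEFin -EFinM lee_fin ler_pdivrMl.
have IGle n : (Rd_int (fun x => \sum_(k < n) G k x) <= Y%:E)%E.
  rewrite (Gmeas n).2.
  apply: (@le_trans _ _ (\sum_(k < n) (loc_const * (\prod_i (N k i + ek k)) `^ (m.+1%:R^-1))%:E)%E).
    by apply: lee_sum => k _; have [_ _ _ [_ _ h] _] := hk k.
  rewrite sumEFin lee_fin -mulr_sumr ler_wpM2l//.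
  apply: le_trans (hoelder_sum (X := fun (k : 'I_n) i => N k i + ek k) _) _.
    by move=> k i; rewrite ltr_wpDl.
  apply: ge0_ler_powR; rewrite ?nnegrE ?invr_ge0//.
  - by apply: prodr_ge0 => i _; apply: sumr_ge0 => k _; rewrite addr_ge0// ltW.
  - by apply: prodr_ge0 => i _; rewrite addr_ge0 ?mulr_ge0// ltW.
  apply: ler_prod => i _; apply/andP; split.
    by apply: sumr_ge0 => k _; rewrite addr_ge0// ltW.
  rewrite big_split /=; apply: lerD; first exact: SN.
  rewrite (eq_bigr (fun k : 'I_n => e * (2^-1 * 2^-1 ^+ k))); last first.
    by move=> k _; rewrite /ek -exprS exprVn.
  rewrite -!mulr_sumr ler_piMr ?(ltW e0)//.
  have h : 0 <= (2^-1 : R) < 1 by lra.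
  have := geometric_sum_le n h.
  have -> : (1 - 2^-1 : R) = 2^-1 by lra.
  by rewrite invrK => hs; lra.
have nd x : {homo (fun n => (\sum_(k < n) G k x)%E) : a b / (a <= b)%N >-> (a <= b)%E}.
  by apply: (lee_sum_nneg_ord (fun k => G k x) xpredT) => k _.
have sG0 n x : (0 <= \sum_(k < n) G k x)%E by exact: sume_ge0.
have [mlim ilim] := @Rd_meas_int_lim R d (fun n x => \sum_(k < n) G k x)%E
  sG0 (fun n => (Gmeas n).1) nd.
apply: (@le_trans _ _ (Rd_int (fun x => limn (fun n => \sum_(k < n) G k x)%E))).
  apply: le_Rd_int => x; first exact: poweR_ge0.
  have [w hw] := center_cover x.
  have -> : limn (fun n => \sum_(k < n) G k x)%E = ereal_sup (range (fun n => \sum_(k < n) G k x)%E).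
    by apply/cvg_lim => //; exact: ereal_nondecreasing_cvgn.
  have hub : ((\sum_(k < (pickle w).+1) G k x) <= ereal_sup (range (fun n => \sum_(k < n) G k x)))%E.
    by apply: ereal_sup_ubound; exists (pickle w).+1.
  apply: le_trans hub.
  (* The partial sum with (pickle w).+1 terms ends with the cube whose centre is within 1 of x. *)
  have [_ _ _ _ h] := hk (pickle w); apply: le_trans (h w x (pickleK_inv w) hw) _.
  rewrite big_ord_recr /= leeDr//; exact: sG0.
rewrite ilim; apply: lime_le; last by apply: nearW => n; exact: IGle.
apply: ereal_nondecreasing_is_cvgn => a b ab; apply: le_Rd_int => x; last exact: nd.
exact: sG0.
Qed.

(** The overlap 4^d of each factor becomes 2^d under the square root, once for each of the m.+1
    functions. *)
Lemma Lp_on_setT :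
  (Lp_on setT (2 / m.+1%:R) (Mloc sigma f) <=
   (loc_const `^ (m.+1%:R / 2) * (2 ^+ d) ^+ m.+1 * Num.sqrt PS)%:E)%E.
Proof.
have p0 : 0 < 2 / m.+1%:R :> R by rewrite divr_gt0.
have lc0 : 0 <= loc_const := le_trans ler01 loc_const_ge1.
have -> : loc_const `^ (m.+1%:R / 2) * (2 ^+ d) ^+ m.+1 * Num.sqrt PS =
  loc_const `^ (m.+1%:R / 2) * Num.sqrt (\prod_i ((4 ^ d)%:R * S i)).
  rewrite -mulrA; congr (_ * _).
  rewrite big_split /= prodr_const card_ord sqrtrM ?exprn_ge0//; congr (_ * _).
  rewrite (_ : (4 ^ d)%:R ^+ m.+1 = ((2 ^+ d) ^+ m.+1) ^+ 2 :> R); last first.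
    by rewrite -natrX -!exprM -!natrX; congr (_%:R); rewrite (_ : 4 = 2 ^ 2)%N// -!expnM; congr (_ ^ _)%N; lia.
  by rewrite sqrtr_sqr ger0_norm// !exprn_ge0.
apply: sqrt_prod_limit; rewrite ?powR_ge0//; first by move=> i; rewrite mulr_ge0.
move=> e he; have /andP[e0 e1] := he.
have W0 : 0 <= \prod_i ((4 ^ d)%:R * S i + e).
  by apply: prodr_ge0 => i _; rewrite addr_ge0 ?mulr_ge0// ltW.
rewrite /Lp_on; under eq_Rd_int do rewrite indicT mul1e.
apply: (@le_trans _ _ ((loc_const * (\prod_i ((4 ^ d)%:R * S i + e)) `^ (m.+1%:R^-1))%:E `^ (2 / m.+1%:R)^-1)%E).
  apply: gt0_ler_poweR; rewrite ?in_itv /= ?leey ?andbT//.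
  - by apply: Rd_int_ge0 => x; exact: poweR_ge0.
  - by rewrite lee_fin mulr_ge0 ?powR_ge0.
  exact: Rd_int_Mloc_le.
rewrite poweR_EFin lee_fin powRM ?powR_ge0// invf_div -powRrM mulrA mulVf ?pnatr_eq0// mul1r.
by rewrite powR12_sqrt.
Qed.

End Global.

(** * Assembling the two estimates *)

Lemma L2normE (R : realType) d (f : 'rV[R]_d -> R[i]) (S : R) : 0 <= S ->
  Rd_int (fun x => (cmod (f x) ^+ 2)%:E) = S%:E -> L2norm f = (Num.sqrt S)%:E.
Proof.
move=> S0 SE; rewrite /L2norm /Lp_on.
rewrite (eq_Rd_int (h := fun x => (cmod (f x) ^+ 2)%:E)) => [|x].
  by rewrite SE poweR_EFin powR12_sqrt.
rewrite indicT mul1e gee0_abs ?lee_fin ?cmod_ge0// poweR_EFin.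
by rewrite powR_mulrn// cmod_ge0.
Qed.

Theorem theorem1p2 (R : realType) (m d : nat) (s : R)
    (sigma : {measure set (bmx R m d) -> \bar R}) :
  (2 <= m)%N -> (1 <= d)%N ->
  (m.-1)%:R * d%:R / 2 + 2^-1 < s ->
  (sigma setT < +oo)%E ->
  sigma [set y : bmx R m d | 1 < enorm (y : 'M[R]_(m, d))] = 0%E ->
  (exists A : R, forall xi : 'M[R]_(m, d),
      ft_abs sigma xi <= A * (1 + enorm xi) `^ (- s)) ->
  exists C : R, forall f : 'I_m -> 'rV[R]_d -> R[i],
    (forall i, schwartz (f i)) ->
    (forall p : R, 2 / m%:R <= p <= 2 ->
       (Lp_on [set x : 'rV[R]_d | (enorm x < 1)%R] p (Mloc sigma f)
        <= C%:E * \prod_(i < m) L2norm (f i))%E) /\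
    (Lp_on setT (2 / m%:R) (Mloc sigma f)
        <= C%:E * \prod_(i < m) L2norm (f i))%E.
Proof.
case: m sigma => // m sigma _ _ /= hs fin_sigma supp_sigma [A hA].
have s0 : 0 < s.
  by apply: lt_trans hs; rewrite ltr_wpDl ?invr_gt0// divr_ge0// mulr_ge0.
have [C0 C00 HC0] := symbol_estimate fin_sigma supp_sigma s0 hA hs.
(* The constant of the global estimate; it also serves on the ball, because the overlap factor (2 ^+
   d) ^+ m.+1 is at least 1. *)
exists (loc_const d C0 `^ (m.+1%:R / 2) * (2 ^+ d) ^+ m.+1) => f hf.
have [B [L [B1 L0 nf]]] := schwartz_uniform hf.
have /choice[S hS] : forall i, exists S : R, 0 <= S /\
    Rd_int (fun x => (cmod (f i x) ^+ 2)%:E) = S%:E.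
  by move=> i; exact: schwartz_L2_finite.
have S0 i : 0 <= S i := (hS i).1.
have SE i := (hS i).2.
have -> : (\prod_(i < m.+1) L2norm (f i) = (Num.sqrt (\prod_i S i))%:E)%E.
  rewrite -powR12_sqrt ?prodr_ge0// powR_prod// -prodEFin; apply: eq_bigr => i _.
  by rewrite powR12_sqrt//; exact: L2normE.
rewrite -EFinM; split; last exact: (Lp_on_setT fin_sigma supp_sigma C00 HC0 B1 L0 nf S0 SE).
move=> p hp; apply: le_trans (Lp_on_ball fin_sigma supp_sigma C00 HC0 B1 L0 nf S0 SE hp) _.
rewrite lee_fin ler_wpM2r ?sqrtr_ge0// ler_peMr ?powR_ge0//.
by rewrite exprn_ege1// exprn_ege1// ler1n.
Qed.
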